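(* For any $h\in[0,1]$, $$\int_{\theta}^{\tau} y(s)^{2(\gamma-h)}\,\sigma(s)^2\,ds = 2\log|Y_h(\tau)|\quad\text{almost surely},$$ where $Y_h(s)$, $s\in[\theta,\tau]$, is the complex-valued process satisfying $$dY_h(s)=i\,Y_h(s)\,\frac{dy(s)}{y(s)^h},\quad s\in(\theta,\tau),\qquad Y_h(\theta)=1.$$
   Context: Let $\theta\in\mathbb{R}$ and $T\in(\theta,+\infty)$ be given, together with a complete probability space $(\Omega,\mathcal{F},\mathbf{P})$ and a right-continuous filtration $\{\mathcal{F}_t\}_{t\in[\theta,T]}$ of complete $\sigma$-algebras of events. Let $w(t)$, $t\in[\theta,T]$, be a one-dimensional Wiener process with $w(\theta)=0$, adapted to $\{\mathcal{F}_t\}$, such that $\mathcal{F}_t$ is independent of $w(s)-w(q)$ whenever $s>q\ge t$. Let $\gamma\in[0,1]$, and let $\sigma(t)$ be a bounded real-valued $\mathcal{F}_t$-adapted process. Let $f(s,t):C([\theta,T])\times[\theta,T]\to\mathbb{R}$ be a measurable (possibly random) function such that $f(s,t)$ is $\mathcal{F}_t$-adapted for any $s\in C([\theta,T])$, and $f(s_1,t)=f(s_2,t)$ if $(s_1-s_2)|_{[\theta,t]}\equiv 0$. For any $\delta>0$ there are constants $c_k=c_k(\delta)>0$, $k=1,2$, such that, almost surely, $|f(s_1,t)-f(s_2,t)|\le c_1\|s_1-s_2\|_{C([\theta,T])}$ and $|f(s,t)|\le c_2(\|s\|_{C([\theta,T])}+1)$ for all $t\in[\theta,T]$ and all $s,s_1,s_2\in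 C([\theta,T])$ whose infimum over $[\theta,T]$ is larger than $\delta$. The process $y$ is the real-valued almost surely continuous $\mathcal{F}_t$-adapted solution, with $y(\theta)>0$, of the Itô equation $$dy(t)=f(y(\cdot),t)\,dt+\sigma(t)\,y(t)^{\gamma}\,dw(t)$$ on $[\theta,\tau]$, where $\tau$ is a Markov time (stopping time) with respect to $\{\mathcal{F}_t\}$ such that $\tau\in(\theta,T]$ a.s. and $\inf_{s\in[\theta,\tau]}y(s)>0$ a.s. Here $i=\sqrt{-1}$, and the equation for $Y_h$ is understood as an Itô equation driven by the continuous semimartingale $y$ on $[\theta,\tau]$. *)

(* Defs.v *)
From HB Require Import structures.
From mathcomp Require Import all_boot all_order all_algebra.
From mathcomp Require Import all_classical all_reals all_analysis.
From mathcomp Require Import measurable_realfun complex.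

Set Implicit Arguments.
Unset Strict Implicit.
Unset Printing Implicit Defensive.

Import Order.TTheory GRing.Theory Num.Theory.
Import numFieldNormedType.Exports.

Local Open Scope classical_set_scope.
Local Open Scope ring_scope.

(* Processes are functions [X : R -> Omega -> R] (time first); only their values
   at times in [theta, T] matter, and for a process living on [theta, tau] only
   its values at times [t <= tau omega]. *)

Section paths.
Context {R : realType}.
Implicit Types (theta T : R) (s : R -> R).

(* C([theta, T]): elements are represented by functions on R, considered
   through their values on [theta, T] only. *)
Definition Cspace theta T : set (R -> R) :=
  [set s | {within `[theta, T], continuous s}].

Definition Cnorm theta T s : R := sup [set `|s t| | t in `[theta, T]].

Definition Cinf theta T s : R := inf [set s t | t in `[theta, T]].

Definition Copen theta T (U : set (R -> R)) :=
  U `<=` Cspace theta T /\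
  forall s, U s -> exists2 e : R, 0 < e &
    forall r, Cspace theta T r -> Cnorm theta T (r - s) < e -> U r.

End paths.

Section stochastic_calculus.
Context {R : realType} {d : measure_display} {Omega : measurableType d}.
Variable P : probability Omega R.
Variables theta T : R.
Implicit Types (F : R -> set (set Omega)) (X w : R -> Omega -> R)
  (tau : Omega -> R).

Definition sub_measurable (G : set (set Omega)) (X : Omega -> R) :=
  forall B : set R, measurable B -> G (X @^-1` B).

Definition independent_of (G : set (set Omega)) (X : Omega -> R) :=
  forall A (B : set R), G A -> measurable B ->
    P (A `&` X @^-1` B) = (P A * P (X @^-1` B))%E.

Record complete_filtration F : Prop := {
  filtration_sigma_algebra :
    forall t, t \in `[theta, T] -> sigma_algebra setT (F t) ;
  filtration_measurable :
    forall t, t \in `[theta, T] -> F t `<=` measurable ;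
  filtration_mono :
    forall s t, theta <= s -> s <= t -> t <= T -> F s `<=` F t ;
  filtration_right_continuous :
    forall t, t \in `[theta, T[ -> F t = \bigcap_(s in `]t, T]) F s ;
  filtration_complete :
    forall t, t \in `[theta, T] -> P.-negligible `<=` F t }.

Definition adapted F X :=
  forall t, t \in `[theta, T] -> sub_measurable (F t) (X t).

Record wiener_process w : Prop := {
  wiener_measurable :
    forall t, t \in `[theta, T] -> measurable_fun setT (w t) ;
  wiener_start : {ae P, forall omega, w theta omega = 0} ;
  wiener_continuous :
    {ae P, forall omega, {within `[theta, T], continuous w^~ omega}} ;
  wiener_independent_increments :
    forall (n : nat) (t : nat -> R) (B : nat -> set R),
      (forall k, (k <= n)%N -> t k \in `[theta, T]) ->
      (forall k, (k < n)%N -> t k <= t k.+1) ->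
      (forall k, measurable (B k)) ->
      P (\bigcap_(k in `I_n) ((w (t k.+1) \- w (t k))%R @^-1` B k)) =
      (\big[*%E/1%E]_(k < n) P ((w (t k.+1) \- w (t k))%R @^-1` B k))%E ;
  (* the second parameter of [normal_prob] is the standard deviation *)
  wiener_gaussian_increments :
    forall q s, theta <= q -> q < s -> s <= T ->
      forall B : set R, measurable B ->
        P ((w s \- w q) @^-1` B) = normal_prob 0 (Num.sqrt (s - q)) B }.

Record filtered_wiener_process F w : Prop := {
  filtered_wiener : wiener_process w ;
  filtered_wiener_adapted : adapted F w ;
  filtered_wiener_independent :
    forall t q s, theta <= t -> t <= q -> q < s -> s <= T ->
      independent_of (F t) (w s \- w q) }.

Record markov_time F tau : Prop := {
  markov_time_event :
    forall t, t \in `[theta, T] -> F t [set omega | tau omega <= t] ;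
  markov_time_range : {ae P, forall omega, tau omega \in `]theta, T]} }.

Definition stopped tau (E : Type) (X : R -> Omega -> E) : R -> Omega -> E :=
  fun t omega => X (Num.min t (tau omega)) omega.

(* Stands for \sum_(k < n) xi_k 1_{]t_k, t_(k+1)]}. *)
Record simple_process := SimpleProcess {
  sp_size : nat ;
  sp_time : nat -> R ;
  sp_val : nat -> Omega -> R }.

Record simple_adapted F (H : simple_process) : Prop := {
  simple_time_range :
    forall k, (k <= sp_size H)%N -> sp_time H k \in `[theta, T] ;
  simple_time_mono :
    forall k, (k < sp_size H)%N -> sp_time H k <= sp_time H k.+1 ;
  simple_bounded :
    exists K : R, forall k omega, (k < sp_size H)%N ->
      `|sp_val H k omega| <= K ;
  simple_val_measurable :
    forall k, (k < sp_size H)%N -> sub_measurable (F (sp_time H k)) (sp_val H k) }.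

Definition simple_fun (H : simple_process) : R -> Omega -> R :=
  fun t omega => \sum_(k < sp_size H)
    sp_val H k omega * \1_(`]sp_time H k, sp_time H k.+1]) t.

Definition simple_integral w (H : simple_process) : R -> Omega -> R :=
  fun t omega => \sum_(k < sp_size H) sp_val H k omega *
    (w (Num.min (sp_time H k.+1) t) omega - w (Num.min (sp_time H k) t) omega).

Definition vanishes_in_probability (xi : nat -> Omega -> \bar R) :=
  (forall n, measurable_fun [set: Omega] (xi n)) /\
  forall e : R, 0 < e ->
    P [set omega | (e%:E <= xi n omega)%E] @[n --> \oo] --> 0%E.

(* [M] is the Ito integral t |-> \int_theta^t H dw on [theta, T]: the almost
   surely continuous process which is, at each time, the limit in probability of
   the integrals of simple adapted processes H_n such that
   \int_theta^T |H_n - H|^2 dt --> 0 in probability. That H is adapted (up to a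
   dt x dP-null set) and that \int_theta^T H^2 dt < +oo almost surely follow
   from the existence of the H_n. *)
Definition ito_integral F w (H M : R -> Omega -> R) :=
  [/\ {ae P, forall omega, measurable_fun `[theta, T] (H^~ omega)},
      {ae P, forall omega, {within `[theta, T], continuous M^~ omega}} &
      exists Hn : nat -> simple_process,
        [/\ forall n, simple_adapted F (Hn n),
            vanishes_in_probability (fun n omega =>
              \int[lebesgue_measure]_(t in `[theta, T])
                ((simple_fun (Hn n) t omega - H t omega) ^+ 2)%:E)%E &
            forall t, t \in `[theta, T] ->
              vanishes_in_probability (fun n omega =>
                `|simple_integral w (Hn n) t omega - M t omega|%:E)]].

(* dX = a dt + b dw on [theta, tau]. The Ito integral of b up to time t <= tau
   is that of b 1_{[theta, tau]}. *)
Record ito_process F w tau X (a b : R -> Omega -> R) : Prop := {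
  ito_adapted : adapted F (stopped tau X) ;
  ito_continuous :
    {ae P, forall omega,
      {within `[theta, tau omega], continuous X^~ omega}} ;
  ito_drift_integrable :
    {ae P, forall omega, lebesgue_measure.-integrable
      `[theta, tau omega] (EFin \o a^~ omega)} ;
  ito_equation :
    exists2 M : R -> Omega -> R, ito_integral F w
        (fun t omega => \1_(`[theta, tau omega]) t * b t omega) M &
      {ae P, forall omega, forall t, t \in `[theta, tau omega] ->
        X t omega = X theta omega +
          \int[lebesgue_measure]_(s in `[theta, t]) a s omega + M t omega} }.

(* Complex-valued Ito processes with real w: both components are Ito. *)
Definition complex_ito_process F w tau (Z A B : R -> Omega -> R[i]) :=
  ito_process F w tau (fun t omega => complex.Re (Z t omega))
    (fun t omega => complex.Re (A t omega))
    (fun t omega => complex.Re (B t omega)) /\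
  ito_process F w tau (fun t omega => complex.Im (Z t omega))
    (fun t omega => complex.Im (A t omega))
    (fun t omega => complex.Im (B t omega)).

(* dZ = G dX on [theta, tau], for the Ito process dX = a dt + b dw: by
   definition of the integral with respect to an Ito process,
   G dX = G a dt + G b dw. *)
Definition ito_driven F w tau X (a b : R -> Omega -> R)
    (Z G : R -> Omega -> R[i]) :=
  ito_process F w tau X a b /\
  complex_ito_process F w tau Z
    (fun t omega => G t omega * (a t omega)%:C%C)
    (fun t omega => G t omega * (b t omega)%:C%C).

Record diffusion_coefficient F (sigma : R -> Omega -> R) : Prop := {
  diffusion_bounded :
    exists K : R, forall t omega, t \in `[theta, T] -> `|sigma t omega| <= K ;
  diffusion_measurable :
    measurable_fun (`[theta, T] `*` setT)
      (fun p : measurableTypeR R * Omega => sigma p.1 p.2) ;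
  diffusion_adapted : adapted F sigma }.

(* C([theta, T]) x [theta, T] x Omega, and the product of the Borel
   sigma-algebra of the sup norm, the Borel sigma-algebra and [measurable]. *)
Definition drift_domain : set ((R -> R) * R * Omega) :=
  [set p | Cspace theta T p.1.1 /\ p.1.2 \in `[theta, T]].

Definition drift_rectangles : set (set ((R -> R) * R * Omega)) :=
  [set C | exists U (A : set R) (E : set Omega),
    [/\ Copen theta T U, measurable A, A `<=` `[theta, T], measurable E &
        C = U `*` A `*` E]].

Record drift_coefficient F (f : (R -> R) -> R -> Omega -> R) : Prop := {
  drift_measurable :
    forall B : set R, measurable B ->
      <<s drift_domain, drift_rectangles >>
        (drift_domain `&` [set p | B (f p.1.1 p.1.2 p.2)]) ;
  drift_adapted : forall s, Cspace theta T s -> adapted F (f s) ;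
  drift_causal :
    forall s1 s2 t omega, Cspace theta T s1 -> Cspace theta T s2 ->
      t \in `[theta, T] -> (forall r, r \in `[theta, t] -> s1 r = s2 r) ->
      f s1 t omega = f s2 t omega ;
  drift_regular :
    forall delta : R, 0 < delta -> exists c1 c2 : R,
      [/\ 0 < c1, 0 < c2 &
        {ae P, forall omega, forall t, t \in `[theta, T] ->
          (forall s1 s2, Cspace theta T s1 -> Cspace theta T s2 ->
             delta < Cinf theta T s1 -> delta < Cinf theta T s2 ->
             `|f s1 t omega - f s2 t omega| <= c1 * Cnorm theta T (s1 - s2)) /\
          (forall s, Cspace theta T s -> delta < Cinf theta T s ->
             `|f s t omega| <= c2 * (Cnorm theta T s + 1))}] }.

(* f(y(.), t) for t <= tau: the path y(.) of C([theta, T]) is the one frozen at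
   tau, and by [drift_causal] its values after t are irrelevant. *)
Definition drift_along tau (f : (R -> R) -> R -> Omega -> R) X :
    R -> Omega -> R :=
  fun t omega => f ((stopped tau X)^~ omega) t omega.

End stochastic_calculus.

(* Main.v *)
Require Import Defs.
From HB Require Import structures.
From mathcomp Require Import all_boot all_order all_algebra.
From mathcomp Require Import all_classical all_reals all_analysis.
From mathcomp Require Import measurable_realfun complex.
From mathcomp Require Import ring lra.

Set Implicit Arguments.
Unset Strict Implicit.
Unset Printing Implicit Defensive.

Import Order.TTheory GRing.Theory Num.Theory.
Import numFieldNormedType.Exports.

Local Open Scope classical_set_scope.
Local Open Scope ring_scope.

(** Write [Y = U + i V], with [dy = a dt + b dw], [beta = b / y^h] and
    [alpha = a / y^h]. Then [dU = - V (alpha dt + beta dw)] and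
    [dV = U (alpha dt + beta dw)], so in [d(U^2 + V^2)] the terms
    [2 (U dU + V dV)] cancel and only the quadratic variations remain:
    [d|Y|^2 = |Y|^2 beta^2 dt]. This is a pathwise linear equation, whose solution
    satisfies [log |Y|^2 = \int beta^2 dt].

    Ito's formula is replaced by a discretisation: along a grid [t_0 < ... < t_n],
    [U_t^2 + V_t^2] increases by [\sum 2 (U_k dU_k + V_k dV_k) +
    \sum (dU_k^2 + dV_k^2)]. Approximating the integrands by bounded simple
    processes and using the discrete Ito isometry, both sums are shown to be close,
    with probability close to 1 and for every fine grid, to [0] and to the integral
    of [|Y|^2 beta^2]. Grids of the two components are refined to a common one, and
    an almost sure identity is extracted at rational times, then extended by
    continuity. *)

(** * Independence and Gaussian moments *)

(** The obstacle is that [ito_integral] only provides limits in probability: at each fixed time,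
    without a rate and without an isometry for the limit. Every estimate is therefore made on simple
    processes and transferred outside a small measurable set ([likely]). As the integrals converge
    at given times only, the index of the approximation has to be chosen after the grid, while the
    mesh must be fixed before it. This is why two simple approximations are compared along a grid
    with a bound that does not depend on the grid. The cross sum is small because [U] and [V],
    frozen at the left ends of the cells, are close by continuity to their current values, for which
    the combination of the two integrands is identically zero; the drift terms cancel pathwise in
    the same way. The random time enters only through an indicator in the integrands and through
    stopping [U] and [V], so all grids are deterministic. Since the integrand is merely measurable
    in time, the logarithm is not differentiated: its increments are squeezed with an error
    quadratic in the step. *)

Section independence.
Context {R : realType} {d : measure_display} {Omega : measurableType d}.
Variable P : probability Omega R.

Definition independent_variables (X Z : Omega -> R) :=
  forall A B : set R, measurable A -> measurable B ->
    P (X @^-1` A `&` Z @^-1` B) = (P (X @^-1` A) * P (Z @^-1` B))%E.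

Lemma independent_variables_comp (f g : R -> R) (X Z : Omega -> R) :
  measurable_fun setT f -> measurable_fun setT g ->
  independent_variables X Z -> independent_variables (f \o X) (g \o Z).
Proof.
move=> mf mg XZ A B mA mB; rewrite 2!comp_preimage XZ//.
- by rewrite -[X in measurable X]setTI; exact: mf.
- by rewrite -[X in measurable X]setTI; exact: mg.
Qed.

Section joint_law.
Variables X Z : {mfun Omega >-> R}.
Hypothesis indep : independent_variables X Z.

Let XZ : Omega -> R * R := fun w => (X w, Z w).

Let mXZ : measurable_fun setT XZ.
Proof. exact: measurable_fun_pair. Qed.

HB.instance Definition _ := isMeasurableFun.Build _ _ _ _ XZ mXZ.

(** Independence is the equality of the two measures on rectangles, and these determine a finite
    measure on the product. *)
Let joint_law (A : set (R * R)) : measurable A ->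
  (distribution P X \x distribution P Z)%E A = distribution P XZ A.
Proof. by apply: product_measure_unique => B C mB mC; rewrite -indep. Qed.

Let measurable_mul : measurable_fun [set: R * R] (fun p => p.1 * p.2).
Proof.
by apply: measurable_funM; [exact: measurable_fst|exact: measurable_snd].
Qed.

Lemma ge0_integral_mul_indep_mfun :
  (forall w, 0 <= X w) -> (forall w, 0 <= Z w) ->
  (\int[P]_w (X w * Z w)%:E = \int[P]_w (X w)%:E * \int[P]_w (Z w)%:E)%E.
Proof.
move=> X0 Z0.
have mabs : measurable_fun setT (fun x : R => `|x|%:E).
  by apply/measurable_EFinP; exact: normr_measurable.
have mfst : measurable_fun [set: R * R] (fun p => `|p.1 * p.2|%:E).
  by apply/measurable_EFinP; exact: measurableT_comp.
(* The law lives on all of [R], so the integrand is the absolute value: it is nonnegative everywhere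
   and agrees with the identity on the values of [X']. *)
have EX (X' : {mfun Omega >-> R}) : (forall w, 0 <= X' w) ->
    (\int[P]_w (X' w)%:E = \int[distribution P X']_x `|x|%:E)%E.
  move=> X'0; rewrite ge0_integral_distribution//=.
  by apply: eq_integral => w _ /=; rewrite ger0_norm.
rewrite (EX X)// (EX Z)//.
transitivity (\int[distribution P XZ]_p (`|p.1 * p.2|)%:E)%E.
  rewrite ge0_integral_distribution//=.
  by apply: eq_integral => w _ /=; rewrite ger0_norm// mulr_ge0.
rewrite (eq_measure_integral (distribution P X \x distribution P Z)%E); last first.
  by move=> A mA _; apply/esym/joint_law.
rewrite fubini_tonelli1//= /fubini_F/=.
transitivity (\int[distribution P X]_x
  (`|x|%:E * \int[distribution P Z]_y `|y|%:E))%E.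
  apply: eq_integral => x _.
  rewrite -ge0_integralZl//=.
  by apply: eq_integral => y _; rewrite normrM EFinM.
by rewrite ge0_integralZr//=; apply: integral_ge0.
Qed.

Lemma integral_mul_indep_mfun :
  P.-integrable setT (EFin \o X) -> P.-integrable setT (EFin \o Z) ->
  P.-integrable setT (EFin \o (X \* Z)) ->
  (\int[P]_w (X w * Z w)%:E = \int[P]_w (X w)%:E * \int[P]_w (Z w)%:E)%E.
Proof.
move=> iX iZ iXZ.
have mul_E : measurable_fun [set: R * R] (fun p => (p.1 * p.2)%:E).
  exact/measurable_EFinP.
have EX (X' : {mfun Omega >-> R}) : P.-integrable setT (EFin \o X') ->
    (\int[P]_w (X' w)%:E = \int[distribution P X']_x x%:E)%E.
  by move=> iX'; rewrite integral_distribution.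
have iD (X' : {mfun Omega >-> R}) : P.-integrable setT (EFin \o X') ->
    (distribution P X').-integrable setT (EFin : R -> _).
  move=> /integrableP[_ fin]; apply/integrableP; split => //.
  by rewrite ge0_integral_distribution//; exact: measurableT_comp.
have iD2 : (distribution P X \x distribution P Z)%E.-integrable setT
    (fun p => (p.1 * p.2)%:E).
  apply/integrableP; split => //.
  rewrite (eq_measure_integral (distribution P XZ)); last first.
    by move=> A mA _; exact: joint_law.
  rewrite ge0_integral_distribution//; last exact: measurableT_comp.
  by case/integrableP : iXZ.
rewrite (EX X)// (EX Z)//.
transitivity (\int[distribution P XZ]_p (p.1 * p.2)%:E)%E.
  by rewrite integral_distribution.
rewrite (eq_measure_integral (distribution P X \x distribution P Z)%E); last first.
  by move=> A mA _; apply/esym/joint_law.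
rewrite -integral12_prod_meas1//= /fubini_F/=.
have fZ : (\int[distribution P Z]_y y%:E)%E \is a fin_num.
  by apply: integrable_fin_num => //; exact: iD.
transitivity (\int[distribution P X]_x
  (x%:E * \int[distribution P Z]_y y%:E))%E.
  apply: eq_integral => x _.
  by rewrite -integralZl//=; exact: iD.
by rewrite -(fineK fZ) integralZr//; exact: iD.
Qed.

End joint_law.

Lemma ge0_integral_mul_indep (X Z : Omega -> R) :
  measurable_fun setT X -> measurable_fun setT Z -> independent_variables X Z ->
  (forall w, 0 <= X w) -> (forall w, 0 <= Z w) ->
  (\int[P]_w (X w * Z w)%:E = \int[P]_w (X w)%:E * \int[P]_w (Z w)%:E)%E.
Proof.
move=> mX mZ; pose X' : {mfun _ >-> _} := mfun_Sub (mem_set mX).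
pose Z' : {mfun _ >-> _} := mfun_Sub (mem_set mZ).
exact: (@ge0_integral_mul_indep_mfun X' Z').
Qed.

Lemma integral_mul_indep (X Z : Omega -> R) :
  independent_variables X Z ->
  P.-integrable setT (EFin \o X) -> P.-integrable setT (EFin \o Z) ->
  P.-integrable setT (EFin \o (X \* Z)) ->
  (\int[P]_w (X w * Z w)%:E = \int[P]_w (X w)%:E * \int[P]_w (Z w)%:E)%E.
Proof.
move=> indep iX iZ.
have mX : measurable_fun setT X by case/integrableP : iX => /measurable_EFinP.
have mZ : measurable_fun setT Z by case/integrableP : iZ => /measurable_EFinP.
pose X' : {mfun _ >-> _} := mfun_Sub (mem_set mX).
pose Z' : {mfun _ >-> _} := mfun_Sub (mem_set mZ).
exact: (@integral_mul_indep_mfun X' Z').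
Qed.

End independence.

(** * Integration against a density *)

Section density.
Context {d} {T : measurableType d} {R : realType}.
Variables (mu nu : {measure set T -> \bar R}) (g : T -> R).
Hypotheses (mg : measurable_fun setT g) (g0 : forall x, 0 <= g x).
Hypothesis nuE : forall A, measurable A -> nu A = (\int[mu]_(x in A) (g x)%:E)%E.

Import HBNNSimple.

Let integral_density_nnsfun (f : {nnsfun T >-> R}) :
  (\int[nu]_x (f x)%:E = \int[mu]_x ((f x)%:E * (g x)%:E))%E.
Proof.
under [LHS]eq_integral do rewrite fimfunE -fsumEFin//.
rewrite [LHS]ge0_integral_fsum//; last 2 first.
  - by move=> r; exact/measurable_EFinP/measurableT_comp.
  - by move=> n x _; rewrite EFinM nnfun_muleindic_ge0.
under [RHS]eq_integral.
  move=> x xD; rewrite fimfunE -fsumEFin// muleC ge0_mule_fsumr; last first.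
    by move=> r; rewrite EFinM nnfun_muleindic_ge0.
  over.
rewrite [RHS]ge0_integral_fsum//; last 2 first.
  - by move=> r; apply: emeasurable_funM; apply/measurable_EFinP => //;
      exact/measurableT_comp.
  - by move=> n x _; apply: mule_ge0; [rewrite lee_fin|rewrite EFinM nnfun_muleindic_ge0].
apply: eq_fsbigr => r _; rewrite integralZl_indic_nnsfun//=.
(* A negative level is never attained; it is set apart because pulling the constant out of the
   integral requires it to be nonnegative. *)
have [r0|r0] := ltP r 0.
  rewrite preimage_nnfun0// integral_indic// set0I measure0 mule0.
  rewrite (eq_integral (cst 0%E)) ?integral0// => x _ /=.
  by rewrite indic0 mulr0 mule0.
under [RHS]eq_integral do rewrite EFinM muleCA.
rewrite ge0_integralZl//; last 2 first.
  - apply: emeasurable_funM; apply/measurable_EFinP => //.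
  - by move=> x _; rewrite mule_ge0// lee_fin.
congr (_ * _)%E; rewrite integral_indic// setIT nuE// integral_mkcond.
apply: eq_integral => x _; rewrite patchE indicE.
by case: ifPn; rewrite ?mule1 ?mule0.
Qed.

(** Linearity gives simple functions, and monotone convergence under both measures gives the rest.
    It serves to integrate against a normal law through its density. *)
Lemma ge0_integral_density (f : T -> \bar R) :
  measurable_fun setT f -> (forall x, 0 <= f x)%E ->
  (\int[nu]_x f x = \int[mu]_x (f x * (g x)%:E))%E.
Proof.
move=> mf f0.
pose f_ := nnsfun_approx measurableT mf.
transitivity (lim (\int[nu]_x (f_ n x)%:E @[n --> \oo])%E).
  rewrite -monotone_convergence//=.
  - apply: eq_integral => ? /[!inE] xD; apply/esym/cvg_lim => //=.
    exact: cvg_nnsfun_approx.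
  - by move=> n; exact/measurable_EFinP/measurable_funTS.
  - by move=> n ? _; rewrite lee_fin.
  - by move=> ? _ ? ? mn; rewrite lee_fin; exact/lefP/nd_nnsfun_approx.
rewrite [RHS](_ : _ = lim
    (\int[mu]_x ((f_ n x)%:E * (g x)%:E) @[n --> \oo])%E).
  by apply: congr_lim; apply/funext => n /=; exact: integral_density_nnsfun.
rewrite -monotone_convergence//=.
- apply: eq_integral => x _; apply/esym/cvg_lim => //=.
  apply: cvgeZr => //; exact: cvg_nnsfun_approx.
- by move=> n; apply: emeasurable_funM; exact/measurable_EFinP/measurable_funTS.
- by move=> n ? _; rewrite mule_ge0// lee_fin.
- move=> ? _ ? ? mn; rewrite lee_pmul ?lee_fin//.
  exact/lefP/nd_nnsfun_approx.
Qed.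

End density.

Lemma normal_peakM {R : realType} (q s : R) : 0 < q ->
  q * normal_peak (q * s) = normal_peak s.
Proof.
move=> q0; have qn0 : q != 0 by rewrite gt_eqF.
rewrite /normal_peak exprMn -mulrA -mulrnAr sqrtrM ?sqr_ge0// sqrtr_sqr.
by rewrite ger0_norm ?(ltW q0)// invfM mulVKf.
Qed.

(** Lets a limiting argument end with any fixed multiple of [e], and with [e] as small as
    convenient. *)
Lemma ler_small {R : realFieldType} (x y C : R) :
  (forall e, 0 < e < 1 -> x <= y + C * e) -> x <= y.
Proof.
move=> xy; apply/ler_addgt0Pr => e e0.
(* With this denominator [e / D] is below 1 and [C * (e / D)] is at most [e], whatever the sign of
   [C]. *)
pose D := `|C| + e + 1.
have D0 : 0 < D by rewrite /D; have := normr_ge0 C; lra.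
have eD : 0 < e / D < 1.
  rewrite divr_gt0//= ltr_pdivrMr// mul1r /D; have := normr_ge0 C; lra.
apply: (le_trans (xy _ eD)); rewrite lerD2l mulrA ler_pdivrMr//.
by have := ler_norm C; have := normr_ge0 C; rewrite /D; nra.
Qed.

(** * Gaussian moments deduced from exponential ones *)

Section normal_moments.
Context {R : realType} {d : measure_display} {Omega : measurableType d}.
Variables (P : probability Omega R) (Z : Omega -> R) (s : R).
Hypotheses (s0 : 0 < s) (mZ : measurable_fun setT Z).
Hypothesis lawZ : forall B, measurable B -> P (Z @^-1` B) = normal_prob 0 s B.

Local Notation mu := (@lebesgue_measure R).

Lemma ge0_integral_normal (f : R -> \bar R) :
  measurable_fun setT f -> (forall x, 0 <= f x)%E ->
  (\int[P]_w f (Z w) = \int[mu]_x (f x * (normal_pdf 0 s x)%:E))%E.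
Proof.
move=> mf f0; pose Z' : {mfun Omega >-> measurableTypeR R} :=
  @mfun_Sub _ _ Omega (measurableTypeR R) Z (mem_set mZ).
transitivity (\int[distribution P Z']_x f x)%E.
  by rewrite ge0_integral_distribution.
rewrite (eq_measure_integral (normal_prob 0 s)); last first.
  by move=> A mA _; exact: lawZ.
apply: (@ge0_integral_density _ _ _ mu (normal_prob 0 s)) => //.
- exact: measurable_normal_pdf.
- by move=> x; exact: normal_pdf_ge0.
Qed.

(** The exponential times the density of deviation [s] is [q] times the density of deviation
    [q * s]. Parametrising by [q] avoids a square root and allows negative [a]. *)
Lemma normal_expR_sqr (a q : R) : 0 < q -> (q ^+ 2)^-1 = 1 + 2 * a * s ^+ 2 ->
  (\int[P]_w (expR (- a * Z w ^+ 2))%:E = q%:E)%E.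
Proof.
move=> q0 aq.
have sn0 : s != 0 by rewrite gt_eqF.
have qn0 : q != 0 by rewrite gt_eqF.
rewrite (@ge0_integral_normal (fun x => (expR (- a * x ^+ 2))%:E)); last 2 first.
- by apply/measurable_EFinP; apply: measurableT_comp => //; apply: measurable_funM.
- by move=> x; rewrite lee_fin expR_ge0.
transitivity (\int[mu]_x (q%:E * (normal_pdf 0 (q * s) x)%:E))%E.
  apply: eq_integral => x _; rewrite -!EFinM; congr EFin.
  rewrite !normal_pdfE ?mulf_neq0// /normal_fun mulrCA [RHS]mulrA.
  rewrite normal_peakM//.
  rewrite -expRD; congr (_ * expR _).
  rewrite !subr0 exprMn -[in RHS]mulrnAr invfM aq -[s ^+ 2 *+ 2]mulr_natr.
  by field.
rewrite ge0_integralZl//=; last 3 first.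
- by apply/measurable_EFinP; exact: measurable_normal_pdf.
- by move=> x _; rewrite lee_fin normal_pdf_ge0.
- by rewrite lee_fin ltW.
by rewrite integral_normal_pdf mule1.
Qed.

(** Completing the square turns the integrand into a multiple of the normal density with mean
    [c * s ^+ 2]. *)
Lemma normal_expR_lin (c : R) :
  (\int[P]_w (expR (c * Z w))%:E = (expR (c ^+ 2 * s ^+ 2 / 2))%:E)%E.
Proof.
have sn0 : s != 0 by rewrite gt_eqF.
rewrite (@ge0_integral_normal (fun x => (expR (c * x))%:E)); last 2 first.
- by apply/measurable_EFinP; apply: measurableT_comp => //; apply: measurable_funM.
- by move=> x; rewrite lee_fin expR_ge0.
transitivity (\int[mu]_x ((expR (c ^+ 2 * s ^+ 2 / 2))%:E *
    (normal_pdf (c * s ^+ 2) s x)%:E))%E.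
  apply: eq_integral => x _; rewrite -!EFinM; congr EFin.
  rewrite !normal_pdfE// /normal_fun mulrCA [RHS]mulrCA -!expRD; congr (_ * expR _).
  by rewrite !subr0 -[s ^+ 2 *+ 2]mulr_natr; field.
rewrite ge0_integralZl//=; last 2 first.
- by apply/measurable_EFinP; exact: measurable_normal_pdf.
- by move=> x _; rewrite lee_fin normal_pdf_ge0.
by rewrite integral_normal_pdf mule1.
Qed.

Let integral_one : (\int[P]__ 1 = 1)%E.
Proof. by have := expectation_cst P 1; rewrite unlock. Qed.

Let measurable_sqr : measurable_fun setT (fun w => Z w ^+ 2).
Proof. exact: measurable_funX. Qed.

Let measurable_expR_sqr (a : R) :
  measurable_fun setT (fun w => (expR (- a * Z w ^+ 2))%:E).
Proof.
by apply/measurable_EFinP; apply: measurableT_comp => //; apply: measurable_funM.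
Qed.

(** The exponent 3/8 makes [1 + 2 * a * s ^+ 2] equal to 1/4, hence [q = 2]: a finite moment which
    dominates every power of [Z]. *)
Let expR_sqr_moment :
  (\int[P]_w (expR (3 / 8 / s ^+ 2 * Z w ^+ 2))%:E = 2%:E)%E.
Proof.
have sn0 : s != 0 by rewrite gt_eqF.
rewrite -(@normal_expR_sqr (- (3 / 8 / s ^+ 2)) 2)//; last by field.
by apply: eq_integral => w _; rewrite opprK.
Qed.

(** Only the order [s ^+ 4] matters later. With [y] the exponent of [expR_sqr_moment], the integrand
    is at most [30 * s ^+ 4 * expR y], and the mean of [expR y] is 2. *)
Lemma normal_sqr_deviation :
  (\int[P]_w ((Z w ^+ 2 - s ^+ 2) ^+ 2)%:E <= (60 * s ^+ 4)%:E)%E.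
Proof.
have sn0 : s != 0 by rewrite gt_eqF.
have -> : (60 * s ^+ 4)%:E =
    (\int[P]_w ((30 * s ^+ 4)%:E * (expR (3 / 8 / s ^+ 2 * Z w ^+ 2))%:E))%E.
  rewrite ge0_integralZl//=; last 2 first.
  - by have := measurable_expR_sqr (- (3 / 8 / s ^+ 2)); rewrite opprK.
  - by rewrite lee_fin mulr_ge0// exprn_ge0// ltW.
  by rewrite expR_sqr_moment -EFinM; congr EFin; ring.
apply: ge0_le_integral => //.
- by move=> w _; rewrite lee_fin sqr_ge0.
- apply/measurable_EFinP; apply: measurable_funX; exact: measurable_funB.
- apply: emeasurable_funM => //.
  by have := measurable_expR_sqr (- (3 / 8 / s ^+ 2)); rewrite opprK.
- move=> w _; rewrite -EFinM lee_fin.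
  set y := 3 / 8 / s ^+ 2 * Z w ^+ 2.
  have Zy : Z w ^+ 2 = 8 / 3 * s ^+ 2 * y by rewrite /y; field.
  have y0 : 0 <= y by rewrite mulr_ge0 ?sqr_ge0// divr_ge0 ?sqr_ge0//; lra.
  (* Squaring [1 + y / 2 <= expR (y / 2)] yields a quadratic lower bound for [expR y]. *)
  have ey : y ^+ 2 <= 4 * expR y.
    have -> : expR y = expR (y / 2) ^+ 2.
      by rewrite expr2 -expRD -splitr.
    have := expR_ge1Dx (y / 2) => h.
    have h2 : (1 + y / 2) ^+ 2 <= expR (y / 2) ^+ 2.
      by rewrite ler_sqr ?nnegrE ?expR_ge0//; lra.
    by apply: le_trans (ler_wpM2l _ h2); [nra|lra].
  have ey1 : 1 <= expR y by rewrite -expR0 ler_expR.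
  have s4 : 0 < s ^+ 4 by rewrite exprn_gt0.
  have -> : (Z w ^+ 2 - s ^+ 2) ^+ 2 = s ^+ 4 * (8 / 3 * y - 1) ^+ 2.
    by rewrite Zy; ring.
  have -> : 30 * s ^+ 4 * expR y = s ^+ 4 * (30 * expR y) by ring.
  by rewrite ler_pM2l//; nra.
Qed.

Let integrable_expR_sqr :
  P.-integrable setT (fun w => (expR (3 / 8 / s ^+ 2 * Z w ^+ 2))%:E).
Proof.
apply/integrableP; split.
  by have := measurable_expR_sqr (- (3 / 8 / s ^+ 2)); rewrite opprK.
under eq_integral do rewrite abse_EFin ger0_norm ?expR_ge0//.
by rewrite expR_sqr_moment ltry.
Qed.

Lemma integrable_normal_sqr : P.-integrable setT (fun w => (Z w ^+ 2)%:E).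
Proof.
have sn0 : s != 0 by rewrite gt_eqF.
have h := integrableZl measurableT (8 / 3 * s ^+ 2) integrable_expR_sqr.
apply: le_integrable h => //; first exact/measurable_EFinP.
move=> w _; rewrite lee_fin.
set y := 3 / 8 / s ^+ 2 * Z w ^+ 2.
have Zy : Z w ^+ 2 = 8 / 3 * s ^+ 2 * y by rewrite /y; field.
have c0 : 0 <= 8 / 3 * s ^+ 2 by rewrite mulr_ge0 ?sqr_ge0//; lra.
rewrite (ger0_norm (sqr_ge0 _)) (ger0_norm (mulr_ge0 c0 (expR_ge0 _))).
by rewrite Zy ler_wpM2l//; have := expR_ge1Dx y; lra.
Qed.

(** Amounts to differentiating the moment of [normal_expR_sqr] at [a = 0]. The tangent inequality 1
    - a z^2 <= exp(- a z^2) gives [1 - a * m <= q]; letting [q] tend to 1 from both sides determines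
    [m]. *)
Lemma integral_normal_sqr : (\int[P]_w (Z w ^+ 2)%:E = (s ^+ 2)%:E)%E.
Proof.
have sn0 : s != 0 by rewrite gt_eqF.
have fm : (\int[P]_w (Z w ^+ 2)%:E)%E \is a fin_num.
  by apply: integrable_fin_num => //; exact: integrable_normal_sqr.
rewrite -(fineK fm); set m := fine _; congr EFin.
have s2 : 0 < s ^+ 2 by rewrite exprn_gt0.
have key (q : R) : 0 < q -> 1 - (q ^- 2 - 1) / (2 * s ^+ 2) * m <= q.
  move=> q0; set a := _ / _.
  have qn0 : q != 0 by rewrite gt_eqF.
  have aq : (q ^+ 2)^-1 = 1 + 2 * a * s ^+ 2 by rewrite /a; field; rewrite sn0.
  have int_lin : P.-integrable setT (fun w => (1 - a * Z w ^+ 2)%:E).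
    have h := integrableZl measurableT a integrable_normal_sqr.
    have := integrableB measurableT (@finite_measure_integrable_cst _ _ _ P setT 1 measurableT) h.
    by apply: eq_integrable.
  rewrite -lee_fin -(normal_expR_sqr q0 aq).
  have -> : (1 - a * m)%:E = (\int[P]_w (1 - a * Z w ^+ 2)%:E)%E.
    rewrite (_ : (fun w => _) = (fun w => 1%:E - a%:E * (Z w ^+ 2)%:E)%E)//.
    rewrite integralB//=; last 2 first.
    - exact: finite_measure_integrable_cst.
    - by apply: integrableZl => //; exact: integrable_normal_sqr.
    rewrite integralZl//; last exact: integrable_normal_sqr.
    by rewrite integral_one -(fineK fm).
  apply: le_integral => //.
    apply/integrableP; split => //.
    under eq_integral do rewrite abse_EFin ger0_norm ?expR_ge0//.
    by rewrite (normal_expR_sqr q0 aq) ltry.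
  by move=> w _; rewrite lee_fin -mulNr; exact: expR_ge1Dx.
(* The factor [1 - q] is kept: its sign decides whether [q] yields an upper bound ([q = 1 + e]) or a
   lower bound ([q = 1 - e]) on [m]. *)
have key2 (q : R) : 0 < q -> 2 * s ^+ 2 * (1 - q) * q ^+ 2 <= (1 - q) * (1 + q) * m.
  move=> q0; have := key _ q0.
  have -> : (q ^- 2 - 1) / (2 * s ^+ 2) * m =
      (1 - q) * (1 + q) * m / (2 * s ^+ 2 * q ^+ 2).
    by field; rewrite sn0 gt_eqF.
  rewrite lerBlDr -lerBlDl ler_pdivlMr; last by rewrite mulr_gt0 ?exprn_gt0//; lra.
  by apply: le_trans; rewrite -subr_ge0 (_ : _ - _ = 0)//; ring.
apply/eqP; rewrite eq_le; apply/andP; split.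
- apply: (@ler_small _ _ _ (3 * s ^+ 2)) => e e01.
  have q0 : 0 < 1 + e by lra.
  have h := key2 _ q0.
  have h2 : (2 + e) * m <= 2 * s ^+ 2 * (1 + e) ^+ 2.
    have e0 : 0 < e by lra.
    by rewrite -(ler_pM2l e0); nra.
  have p : 0 < 2 + e by lra.
  rewrite -(ler_pM2l p); apply: (le_trans h2).
  rewrite (_ : (2 + e) * _ = s ^+ 2 * ((2 + e) * (1 + 3 * e))); last ring.
  rewrite (_ : 2 * _ * _ = s ^+ 2 * (2 * (1 + e) ^+ 2)); last ring.
  by rewrite ler_pM2l//; nra.
- apply: (@ler_small _ _ _ (3 * s ^+ 2)) => e e01.
  have q0 : 0 < 1 - e by lra.
  have h := key2 _ q0.
  have h2 : 2 * s ^+ 2 * (1 - e) ^+ 2 <= (2 - e) * m.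
    have e0 : 0 < e by lra.
    by rewrite -(ler_pM2l e0); nra.
  have p : 0 < 2 - e by lra.
  rewrite -(ler_pM2l p) mulrDr; apply: le_trans; last first.
    by apply: lerD; [exact: h2|exact: lexx].
  rewrite -subr_ge0.
  rewrite (_ : _ - _ = s ^+ 2 * (2 * (1 - e) ^+ 2 + (2 - e) * (3 * e) - (2 - e))); last ring.
  by apply: mulr_ge0; [exact: ltW|nra].
Qed.

Lemma integrable_normal : P.-integrable setT (fun w => (Z w)%:E).
Proof.
have := integrableD measurableT (@finite_measure_integrable_cst _ _ _ P setT 1 measurableT)
  integrable_normal_sqr.
apply: le_integrable => //; first exact/measurable_EFinP.
move=> w _ /=; rewrite lee_fin [leRHS]ger0_norm ?addr_ge0 ?sqr_ge0//.
by rewrite -(real_normK (num_real (Z w))); have := normr_ge0 (Z w); nra.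
Qed.

(** Again by a tangent: [1 + c * m] stays below a function that is 1 plus a term of order [c ^+ 2],
    for [c] of either sign, which forces [m = 0]. *)
Lemma integral_normal : (\int[P]_w (Z w)%:E = 0)%E.
Proof.
have fm : (\int[P]_w (Z w)%:E)%E \is a fin_num.
  by apply: integrable_fin_num => //; exact: integrable_normal.
rewrite -(fineK fm); set m := fine _; congr EFin.
have key (c : R) : 1 + c * m <= expR (c ^+ 2 * s ^+ 2 / 2).
  rewrite -lee_fin -normal_expR_lin.
  have -> : (1 + c * m)%:E = (\int[P]_w (1 + c * Z w)%:E)%E.
    rewrite (_ : (fun w => _) = (fun w => 1%:E + c%:E * (Z w)%:E)%E)//.
    rewrite integralD//=; last 2 first.
    - exact: finite_measure_integrable_cst.
    - by apply: integrableZl => //; exact: integrable_normal.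
    rewrite integralZl//; last exact: integrable_normal.
    by rewrite integral_one -(fineK fm).
  apply: le_integral => //.
  - have h := integrableZl measurableT c integrable_normal.
    have := integrableD measurableT (@finite_measure_integrable_cst _ _ _ P setT 1 measurableT) h.
    by apply: eq_integrable.
  - apply/integrableP; split.
      by apply/measurable_EFinP; apply: measurableT_comp => //; exact: measurable_funM.
    under eq_integral do rewrite abse_EFin ger0_norm ?expR_ge0//.
    by rewrite normal_expR_lin ltry.
  - by move=> w _; rewrite lee_fin; exact: expR_ge1Dx.
(* For [u] at most 1/2, [expR u * (1 - u) <= 1] implies [expR u <= 1 + 2 * u]. *)
have key2 (c : R) : c ^+ 2 * s ^+ 2 <= 1 -> c * m <= c ^+ 2 * s ^+ 2.
  move=> c1; have := key c; set u := c ^+ 2 * s ^+ 2 / 2 => h.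
  have u0 : 0 <= u by apply: divr_ge0 => //; apply: mulr_ge0; exact: sqr_ge0.
  have u1 : u <= 1 / 2 by rewrite /u; lra.
  have e1 : expR u * expR (- u) = 1 by rewrite -expRD subrr expR0.
  have e2 := expR_ge1Dx (- u).
  have e3 := expR_gt0 u.
  have -> : c ^+ 2 * s ^+ 2 = 2 * u by rewrite /u; field.
  have e4 : expR u * (1 - u) <= 1 by rewrite -[leRHS]e1 ler_pM2l.
  by nra.
have s2 : 0 < s ^+ 2 by rewrite exprn_gt0.
have spos := s0.
have D0 : 0 < 1 + s by lra.
(* Dividing by [1 + s] brings [c = e / (1 + s)] into the range where [key2] applies. *)
have small (e : R) : 0 < e < 1 -> (e / (1 + s)) ^+ 2 * s ^+ 2 <= 1.
  move=> e01; rewrite -exprMn -[leRHS](expr1n _ 2%N) ler_sqr ?nnegrE//; last first.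
    by apply: mulr_ge0; [apply: divr_ge0|]; lra.
  by rewrite -mulrA (mulrC _ s) mulrA ler_pdivrMr//; nra.
apply/eqP; rewrite eq_le; apply/andP; split.
- apply: (@ler_small _ _ _ (s ^+ 2 / (1 + s))) => e e01.
  have c0 : 0 < e / (1 + s) by apply: divr_gt0 => //; lra.
  rewrite -(ler_pM2l c0); apply: (le_trans (key2 _ (small _ e01))).
  by rewrite -subr_ge0 (_ : _ - _ = 0)//; field; rewrite gt_eqF.
- apply: (@ler_small _ _ _ (s ^+ 2 / (1 + s))) => e e01.
  have c0 : 0 < e / (1 + s) by apply: divr_gt0 => //; lra.
  have := key2 (- (e / (1 + s))); rewrite sqrrN => /(_ (small _ e01)) h.
  rewrite -(ler_pM2l c0) mulr0 mulrDr -subr_ge0 subr0.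
  rewrite -lerBlDl sub0r -mulNr; apply: le_trans h _.
  by rewrite -subr_ge0 (_ : _ - _ = 0)//; field; rewrite gt_eqF.
Qed.

End normal_moments.

(** * Martingale increments *)

(** Makes the closure properties of [measurable_fun] available for a sub-sigma-algebra, which is
    turned into a measurable type. *)
Lemma sub_measurableP {R : realType} {d} {Omega : measurableType d}
    (G : set (set Omega)) (X : Omega -> R) : sigma_algebra setT G ->
  sub_measurable G X <->
  @measurable_fun _ _ (g_sigma_algebraType G) _ setT X.
Proof.
move=> sG; split=> [h _ B mB|h B mB].
  by rewrite setTI /measurable/= (sigma_algebra_id sG); exact: h.
have /(_ measurableT _ mB) := h.
by rewrite setTI /measurable/= (sigma_algebra_id sG).
Qed.

Section measurable_wrt.
Context {R : realType} {d} {Omega : measurableType d}.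
Variables (G : set (set Omega)) (sG : sigma_algebra setT G).
Implicit Types X Y : Omega -> R.

Lemma sub_measurable_cst (c : R) : sub_measurable G (fun=> c).
Proof. by apply/(sub_measurableP _ sG); exact: measurable_cst. Qed.

Lemma sub_measurable_comp (f : R -> R) X : measurable_fun setT f ->
  sub_measurable G X -> sub_measurable G (f \o X).
Proof.
by move=> mf /(sub_measurableP _ sG) mX; apply/(sub_measurableP _ sG);
  exact: measurableT_comp.
Qed.

Lemma sub_measurableD X Y : sub_measurable G X -> sub_measurable G Y ->
  sub_measurable G (fun w => X w + Y w).
Proof.
by move=> /(sub_measurableP _ sG) mX /(sub_measurableP _ sG) mY;
  apply/(sub_measurableP _ sG); exact: measurable_funD.
Qed.

Lemma sub_measurableM X Y : sub_measurable G X -> sub_measurable G Y ->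
  sub_measurable G (fun w => X w * Y w).
Proof.
by move=> /(sub_measurableP _ sG) mX /(sub_measurableP _ sG) mY;
  apply/(sub_measurableP _ sG); exact: measurable_funM.
Qed.

Lemma sub_measurable_sum (I : Type) (s : seq I) (p : pred I) (X : I -> Omega -> R) :
  (forall i, p i -> sub_measurable G (X i)) ->
  sub_measurable G (fun w => \sum_(i <- s | p i) X i w).
Proof.
move=> mX; elim: s => [|i s ih].
  by under eq_fun do rewrite big_nil; exact: sub_measurable_cst.
have [pi|/negbTE npi] := boolP (p i).
  under eq_fun do rewrite big_cons pi.
  by apply: sub_measurableD => //; exact: mX.
by under eq_fun do rewrite big_cons npi.
Qed.

Lemma sub_measurableW (G' : set (set Omega)) X : G `<=` G' ->
  sub_measurable G X -> sub_measurable G' X.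
Proof. by move=> GG' mX B /mX; exact: GG'. Qed.

Lemma sub_measurable_le X (c : R) : sub_measurable G X ->
  sub_measurable G (fun w => (X w <= c)%R%:R : R).
Proof.
move=> mX; apply: (@sub_measurable_comp (fun x => (x <= c)%R%:R : R) X _ mX).
have -> : (fun x : R => (x <= c)%R%:R : R) = \1_([set` `]-oo, c]] : set R) :> (R -> R).
  by apply/funext => x; rewrite indicE mem_setE in_itv.
exact: measurable_indic.
Qed.

End measurable_wrt.

Section second_moments.
Context {R : realType} {d : measure_display} {Omega : measurableType d}.
Variable P : probability Omega R.
Implicit Types X Y Z S xi : Omega -> R.

Definition square_integrable X := measurable_fun setT X /\
  P.-integrable setT (fun w => (X w ^+ 2)%:E).

Lemma square_integrable_mul X Y : square_integrable X -> square_integrable Y ->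
  P.-integrable setT (fun w => (X w * Y w)%:E).
Proof.
move=> [mX iX] [mY iY]; have := integrableD measurableT iX iY.
apply: le_integrable => //; first exact/measurable_EFinP/measurable_funM.
move=> w _ /=; rewrite lee_fin [leRHS]ger0_norm ?addr_ge0 ?sqr_ge0//.
rewrite normrM -(real_normK (num_real (X w))) -(real_normK (num_real (Y w))).
by have := sqr_ge0 (`|X w| - `|Y w|); have := sqr_ge0 (`|X w| + `|Y w|); nra.
Qed.

Lemma square_integrableD X Y : square_integrable X -> square_integrable Y ->
  square_integrable (fun w => X w + Y w).
Proof.
move=> sX sY; have [mX iX] := sX; have [mY iY] := sY.
split; first exact: measurable_funD.
have h := integrableZl measurableT 2 (square_integrable_mul sX sY).
have := integrableD measurableT (integrableD measurableT iX iY) h.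
apply: eq_integrable => // w _ /=; rewrite -!EFinM -!EFinD; congr EFin; ring.
Qed.

(* One step of a discrete martingale: the cross term [S xi Z] has mean 0. *)
Lemma integral_sqr_martingale_step (G : set (set Omega)) S xi Z :
  sigma_algebra setT G -> G `<=` measurable ->
  sub_measurable G S -> sub_measurable G xi -> independent_of P G Z ->
  square_integrable S -> square_integrable xi -> square_integrable Z ->
  (\int[P]_w (Z w)%:E = 0)%E ->
  square_integrable (fun w => S w + xi w * Z w) /\
  (\int[P]_w ((S w + xi w * Z w) ^+ 2)%:E =
   \int[P]_w (S w ^+ 2)%:E + \int[P]_w (xi w ^+ 2)%:E * \int[P]_w (Z w ^+ 2)%:E)%E.
Proof.
move=> sG Gm mS mxi indZ lS lxi lZ Z0.
have indep X : sub_measurable G X -> independent_variables P X Z.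
  by move=> mX A B mA mB; apply: indZ => //; exact: mX.
have mX X : sub_measurable G X -> measurable_fun setT X.
  by move=> mX _ B mB; rewrite setTI; apply/Gm/mX.
have sqE : (\int[P]_w ((xi w * Z w) ^+ 2)%:E =
    \int[P]_w (xi w ^+ 2)%:E * \int[P]_w (Z w ^+ 2)%:E)%E.
  rewrite -ge0_integral_mul_indep//.
  - by apply: eq_integral => w _; rewrite exprMn.
  - by apply: measurable_funX; exact: mX.
  - by apply: measurable_funX; exact: lZ.1.
  - have := @independent_variables_comp _ _ _ P (fun x => x ^+ 2) (fun x => x ^+ 2) _ _ _ _ (indep _ mxi).
    by apply; exact: exprn_measurable.
  - by move=> w; rewrite sqr_ge0.
  - by move=> w; rewrite sqr_ge0.
(* A product of square integrable variables need not be square integrable; here independence factors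
   the second moment into two finite ones. *)
have lxiZ : square_integrable (fun w => xi w * Z w).
  split; first by apply: measurable_funM; [exact: mX|exact: lZ.1].
  apply/integrableP; split.
    by apply/measurable_EFinP; apply: measurable_funX; apply: measurable_funM;
      [exact: mX|exact: lZ.1].
  under eq_integral do rewrite abse_EFin ger0_norm ?sqr_ge0//.
  have f1 : (\int[P]_w (xi w ^+ 2)%:E)%E \is a fin_num.
    by apply: integrable_fin_num => //; exact: lxi.2.
  have f2 : (\int[P]_w (Z w ^+ 2)%:E)%E \is a fin_num.
    by apply: integrable_fin_num => //; exact: lZ.2.
  by rewrite sqE -(fineK f1) -(fineK f2) -EFinM ltry.
split; first exact: square_integrableD.
have iSxi : P.-integrable setT (fun w => (S w * xi w)%:E).
  exact: square_integrable_mul.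
have iSxiZ : P.-integrable setT (fun w => (S w * xi w * Z w)%:E).
  by under eq_fun do rewrite -mulrA; exact: square_integrable_mul.
have cross : (\int[P]_w (S w * xi w * Z w)%:E = 0)%E.
  rewrite (@integral_mul_indep _ _ _ P (fun w => S w * xi w) Z)//.
  - by rewrite Z0 mule0.
  - by apply: indep; exact: sub_measurableM.
  - have l1 : square_integrable (fun=> 1).
      split => //; under eq_fun do rewrite expr1n.
      exact: (finite_measure_integrable_cst P 1 measurableT).
    by have := square_integrable_mul lZ l1; under eq_fun do rewrite mulr1.
transitivity (\int[P]_w ((S w ^+ 2)%:E + ((xi w * Z w) ^+ 2)%:E
    + 2%:E * (S w * xi w * Z w)%:E))%E.
  by apply: eq_integral => w _; rewrite -!EFinM -!EFinD; congr EFin; ring.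
rewrite integralD//=; last 2 first.
- by apply: integrableD => //; [exact: lS.2|exact: lxiZ.2].
- exact: integrableZl.
rewrite integralZl// cross mule0 adde0 integralD//; last 2 first.
- exact: lS.2.
- exact: lxiZ.2.
by rewrite sqE.
Qed.

End second_moments.

Section discrete_martingale.
Context {R : realType} {d : measure_display} {Omega : measurableType d}.
Variable P : probability Omega R.

(** Orthogonality of martingale increments, one step at a time. [Z i] is the increment from stage
    [i] to stage [i.+1]: independent of [G i], measurable for [G i.+1]. Measurability of the partial
    sum is part of the conclusion because the induction feeds it to the next step. *)
Lemma integral_sqr_martingale (G : nat -> set (set Omega))
    (xi Z : nat -> Omega -> R) n :
  (forall i, (i <= n)%N -> sigma_algebra setT (G i)) ->
  (forall i, (i <= n)%N -> G i `<=` measurable) ->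
  (forall i, (i < n)%N -> G i `<=` G i.+1) ->
  (forall i, (i < n)%N -> sub_measurable (G i) (xi i)) ->
  (forall i, (i < n)%N -> sub_measurable (G i.+1) (Z i)) ->
  (forall i, (i < n)%N -> independent_of P (G i) (Z i)) ->
  (forall i, (i < n)%N -> square_integrable P (xi i)) ->
  (forall i, (i < n)%N -> square_integrable P (Z i)) ->
  (forall i, (i < n)%N -> (\int[P]_w (Z i w)%:E = 0)%E) ->
  [/\ sub_measurable (G n) (fun w => \sum_(i < n) xi i w * Z i w),
      square_integrable P (fun w => \sum_(i < n) xi i w * Z i w) &
      (\int[P]_w ((\sum_(i < n) xi i w * Z i w)%R ^+ 2)%:E =
       \sum_(i < n) (\int[P]_w (xi i w ^+ 2)%:E * \int[P]_w (Z i w ^+ 2)%:E))%E].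
Proof.
elim: n => [|n ih] sG Gm GG mxi mZ indZ lxi lZ Z0.
  have E0 : (fun w => \sum_(i < 0) xi i w * Z i w) = (fun=> 0).
    by apply/funext => w; rewrite big_ord0.
  rewrite E0 big_ord0; split.
  - by apply: sub_measurable_cst; exact: sG.
  - split => //; under eq_fun do rewrite expr0n/=; exact: integrable0.
  - under eq_integral do rewrite big_ord0 expr0n/=; exact: integral0.
have [mS lS SE] := ih (fun i h => sG i (leqW h)) (fun i h => Gm i (leqW h))
  (fun i h => GG i (leqW h)) (fun i h => mxi i (leqW h)) (fun i h => mZ i (leqW h))
  (fun i h => indZ i (leqW h)) (fun i h => lxi i (leqW h))
  (fun i h => lZ i (leqW h)) (fun i h => Z0 i (leqW h)).
have [lS' SE'] := integral_sqr_martingale_step (sG n (leqnSn n)) (Gm n (leqnSn n))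
  mS (mxi n (ltnSn n)) (indZ n (ltnSn n)) lS (lxi n (ltnSn n)) (lZ n (ltnSn n))
  (Z0 n (ltnSn n)).
have ES : (fun w => \sum_(i < n.+1) xi i w * Z i w) =
    (fun w => \sum_(i < n) xi i w * Z i w + xi n w * Z n w).
  by apply/funext => w; rewrite big_ord_recr.
split.
- rewrite ES; apply: sub_measurableD; first exact: sG.
    exact: sub_measurableW (GG n (ltnSn n)) mS.
  apply: sub_measurableM; [exact: sG| |exact: mZ].
  by apply: sub_measurableW (GG n (ltnSn n)) _; exact: mxi.
- by rewrite ES.
- rewrite big_ord_recr/= -SE -SE'.
  by apply: eq_integral => w _; rewrite big_ord_recr.
Qed.

End discrete_martingale.

(** * Events of probability close to one *)

Section likely_events.
Context {R : realType} {d : measure_display} {Omega : measurableType d}.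
Variable P : probability Omega R.
Implicit Types (e c : R) (Q : Omega -> Prop).

(* Only the exceptional set has to be measurable, not [Q] itself. *)
Definition likely e Q := exists A : set Omega,
  [/\ measurable A, (P A <= e%:E)%E & forall w, ~ A w -> Q w].

Lemma likely_sub e Q Q' : (forall w, Q w -> Q' w) -> likely e Q -> likely e Q'.
Proof. by move=> QQ' [A [mA PA AQ]]; exists A; split => // w /AQ /QQ'. Qed.

Lemma likelyW e e' Q : e <= e' -> likely e Q -> likely e' Q.
Proof.
by move=> ee' [A [mA PA AQ]]; exists A; split => //; apply: le_trans PA _;
  rewrite lee_fin.
Qed.

Lemma likely_and e1 e2 Q1 Q2 : likely e1 Q1 -> likely e2 Q2 ->
  likely (e1 + e2) (fun w => Q1 w /\ Q2 w).
Proof.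
move=> [A [mA PA AQ]] [B [mB PB BQ]]; exists (A `|` B); split.
- exact: measurableU.
- by rewrite EFinD (le_trans (measureU2 _ _ _))// leeD.
- by move=> w /not_orP[/AQ ? /BQ].
Qed.

Lemma likely_ae Q : {ae P, forall w, Q w} -> likely 0 Q.
Proof.
move=> [A [mA PA AQ]]; exists A; split => //; first by rewrite PA.
by move=> w nAw; apply: contrapT => nQ; exact/nAw/AQ.
Qed.

Lemma likely_forall e n (Q : nat -> Omega -> Prop) :
  (forall k, (k < n)%N -> likely e (Q k)) ->
  likely (n%:R * e) (fun w => forall k, (k < n)%N -> Q k w).
Proof.
elim: n => [|n ih] h.
  by rewrite mul0r; exists set0; split; rewrite ?measure0.
have := likely_and (ih (fun k kn => h k (leqW kn))) (h n (ltnSn n)).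
rewrite -natr1 mulrDl mul1r; apply: likely_sub => w [h1 h2] k.
by rewrite ltnS leq_eqVlt => /predU1P[->|/h1].
Qed.

Lemma likely_markov (X : Omega -> R) e c : 0 < e ->
  measurable_fun setT X -> (forall w, 0 <= X w) ->
  (\int[P]_w (X w)%:E <= c%:E)%E -> likely (c / e) (fun w => X w < e).
Proof.
move=> e0 mX X0 Xc; exists (X @^-1` `[e, +oo[); split.
- by rewrite -[X in measurable X]setTI; exact: mX.
- have := @le_integral_comp_abse _ _ _ P setT measurableT (EFin \o X) e id
    (@measurable_id _ _ _) (fun _ h => h) (fun _ _ _ _ h => h) _ e0.
  move=> h; rewrite EFinM lee_pdivlMr// muleC.
  apply: le_trans (le_trans (h _) _); last first.
  + apply: le_trans Xc; rewrite le_eqVlt; apply/orP; left; apply/eqP.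
    by apply: eq_integral => w _; rewrite /= ger0_norm.
  + exact/measurable_EFinP.
  + rewrite setTI le_eqVlt; apply/orP; left; apply/eqP; congr (_ * P _)%E.
    apply/seteqP; split => w /=; rewrite in_itv/= andbT lee_fin ger0_norm//.
- by move=> w /=; rewrite in_itv/= andbT => /negP; rewrite -ltNge.
Qed.

Lemma likely_vanishes (xi : nat -> Omega -> \bar R) (a e : R) :
  vanishes_in_probability P xi -> 0 < a -> 0 < e ->
  exists N, forall n, (N <= n)%N -> likely e (fun w => (xi n w < a%:E)%E).
Proof.
move=> [mxi xi0] a0 e0; have := xi0 _ a0.
move=> /fine_cvgP[_ /cvgrPdist_lt/(_ _ e0)[N _ h]].
exists N => n Nn; exists [set w | (a%:E <= xi n w)%E].
have mA : measurable [set w | (a%:E <= xi n w)%E].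
  by rewrite -[X in measurable X]setTI; exact: emeasurable_fun_c_infty.
split => //.
- have := h n Nn; rewrite /= sub0r normrN.
  rewrite ger0_norm ?fine_ge0// => /ltW; rewrite -lee_fin fineK//.
  exact: fin_num_measure.
- by move=> w /negP; rewrite -ltNge.
Qed.

End likely_events.

(** * Wiener increments and discrete stochastic integrals *)

Section wiener.
Context {R : realType} {d : measure_display} {Omega : measurableType d}.
Variables (P : probability Omega R) (theta T : R).
Variables (F : R -> set (set Omega)) (w : R -> Omega -> R).
Hypothesis F_filtration : complete_filtration P theta T F.
Hypothesis w_wiener : filtered_wiener_process P theta T F w.

Let sF t : t \in `[theta, T] -> sigma_algebra setT (F t).
Proof. exact: filtration_sigma_algebra F_filtration t. Qed.

Let Fm t : t \in `[theta, T] -> F t `<=` measurable.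
Proof. exact: filtration_measurable F_filtration t. Qed.

Section increment.
Variables s t : R.
Hypotheses (ths : theta <= s) (st : s < t) (tT : t <= T).

Let D := w t \- w s.

Let sI : s \in `[theta, T].
Proof. by rewrite in_itv/= ths (le_trans (ltW st)). Qed.

Let tI : t \in `[theta, T].
Proof. by rewrite in_itv/= tT (le_trans ths (ltW st)). Qed.

Lemma measurable_increment : measurable_fun setT D.
Proof.
by apply: measurable_funB; apply: (wiener_measurable (filtered_wiener w_wiener)).
Qed.

Lemma adapted_increment : sub_measurable (F t) D.
Proof.
have wt := filtered_wiener_adapted w_wiener tI.
have ws := filtered_wiener_adapted w_wiener sI.
rewrite /D; apply: (sub_measurableD (sF tI) wt).
apply: (sub_measurable_comp (sF tI) (f := -%R)) => //.
apply: sub_measurableW ws.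
exact: (filtration_mono F_filtration ths (ltW st) tT).
Qed.

Lemma independent_increment : independent_of P (F s) D.
Proof. exact: (filtered_wiener_independent w_wiener ths (lexx _) st tT). Qed.

Let law : forall B, measurable B ->
  P (D @^-1` B) = normal_prob 0 (Num.sqrt (t - s)) B.
Proof. exact: (wiener_gaussian_increments (filtered_wiener w_wiener) ths st tT). Qed.

Let sd_gt0 : 0 < Num.sqrt (t - s).
Proof. by rewrite sqrtr_gt0 subr_gt0. Qed.

Let sd_sqr : Num.sqrt (t - s) ^+ 2 = t - s.
Proof. by rewrite sqr_sqrtr// subr_ge0 ltW. Qed.

Lemma square_integrable_increment : square_integrable P D.
Proof.
split; first exact: measurable_increment.
exact: (integrable_normal_sqr sd_gt0 measurable_increment law).
Qed.

Lemma integral_increment : (\int[P]_x (D x)%:E = 0)%E.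
Proof. exact: (integral_normal sd_gt0 measurable_increment law). Qed.

Lemma integral_sqr_increment : (\int[P]_x (D x ^+ 2)%:E = (t - s)%:E)%E.
Proof.
by rewrite (integral_normal_sqr sd_gt0 measurable_increment law) sd_sqr.
Qed.

(** The centred square is again independent of the past with mean 0, so sums of squared increments
    are controlled by the same martingale argument as sums of increments. *)
Let D2 x := D x ^+ 2 - (t - s).

Let D2E : D2 = (fun x => x ^+ 2 - (t - s)) \o D.
Proof. by []. Qed.

Let measurable_D2 : measurable_fun setT (fun x : R => x ^+ 2 - (t - s)).
Proof. exact: measurable_funB. Qed.

Lemma adapted_sqr_increment : sub_measurable (F t) D2.
Proof.
rewrite D2E; apply: (sub_measurable_comp (sF tI)) => //.
exact: adapted_increment.
Qed.

Lemma independent_sqr_increment : independent_of P (F s) D2.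
Proof.
move=> A B FA mB; rewrite D2E comp_preimage; apply: independent_increment => //.
by rewrite -[X in measurable X]setTI; exact: measurable_D2.
Qed.

Lemma sqr_increment_deviation :
  (\int[P]_x (D2 x ^+ 2)%:E <= (60 * (t - s) ^+ 2)%:E)%E.
Proof.
have := normal_sqr_deviation sd_gt0 measurable_increment law.
rewrite sd_sqr (_ : Num.sqrt (t - s) ^+ 4 = (t - s) ^+ 2)//.
by rewrite (exprM _ 2 2) sd_sqr.
Qed.

Lemma square_integrable_sqr_increment : square_integrable P D2.
Proof.
have mD2 : measurable_fun setT D2.
  rewrite D2E; apply: measurableT_comp => //; exact: measurable_increment.
split => //; apply/integrableP; split.
  by apply/measurable_EFinP; exact: measurable_funX.
under eq_integral do rewrite abse_EFin ger0_norm ?sqr_ge0//.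
by apply: le_lt_trans sqr_increment_deviation _; rewrite ltry.
Qed.

Lemma integral_sqr_increment_centered : (\int[P]_x (D2 x)%:E = 0)%E.
Proof.
under eq_integral do rewrite /D2 EFinB.
rewrite integralB//=; last 2 first.
- exact: square_integrable_increment.2.
- exact: (finite_measure_integrable_cst P (t - s) measurableT).
rewrite integral_sqr_increment.
have := expectation_cst P (t - s); rewrite unlock /= => ->.
by rewrite subee.
Qed.

End increment.

End wiener.

Section discrete_integral.
Context {R : realType} {d : measure_display} {Omega : measurableType d}.
Variables (P : probability Omega R) (theta T : R).
Variables (F : R -> set (set Omega)) (w : R -> Omega -> R).
Hypothesis F_filtration : complete_filtration P theta T F.
Hypothesis w_wiener : filtered_wiener_process P theta T F w.
Variables (n : nat) (r : nat -> R).
Hypothesis r_range : forall i, (i <= n)%N -> theta <= r i <= T.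
Hypothesis r_incr : forall i, (i < n)%N -> r i < r i.+1.

Let sF i : (i <= n)%N -> sigma_algebra setT (F (r i)).
Proof.
by move=> /r_range h; apply: (filtration_sigma_algebra F_filtration); rewrite in_itv.
Qed.

Let Fm i : (i <= n)%N -> F (r i) `<=` measurable.
Proof.
by move=> /r_range h; apply: (filtration_measurable F_filtration); rewrite in_itv.
Qed.

Let FF i : (i < n)%N -> F (r i) `<=` F (r i.+1).
Proof.
move=> ni; have /andP[h1 _] := r_range (ltnW ni); have /andP[_ h2] := r_range ni.
by apply: (filtration_mono F_filtration) => //; exact/ltW/r_incr.
Qed.

Let range1 i : (i < n)%N -> theta <= r i.
Proof. by move=> ni; have /andP[] := r_range (ltnW ni). Qed.

Let range2 i : (i < n)%N -> r i.+1 <= T.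
Proof. by move=> ni; have /andP[] := r_range ni. Qed.

Let bounded_square_integrable i (X : Omega -> R) (K : R) : (i < n)%N ->
  sub_measurable (F (r i)) X -> (forall x, X x ^+ 2 <= K) ->
  square_integrable P X.
Proof.
move=> ni mX XK.
have mX' : measurable_fun setT X.
  by move=> _ B mB; rewrite setTI; apply/(Fm (ltnW ni))/mX.
split => //.
apply: (le_integrable _ _ _ (finite_measure_integrable_cst P K measurableT)) => //.
  by apply/measurable_EFinP; exact: measurable_funX.
by move=> x _ /=; rewrite lee_fin ger0_norm ?sqr_ge0// (le_trans (XK x))// ler_norm.
Qed.

Lemma discrete_ito_isometry (xi : nat -> Omega -> R) :
  (forall i, (i < n)%N -> sub_measurable (F (r i)) (xi i)) ->
  (forall i, (i < n)%N -> square_integrable P (xi i)) ->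
  measurable_fun setT (fun x => \sum_(i < n) xi i x * (w (r i.+1) x - w (r i) x)) /\
  (\int[P]_x ((\sum_(i < n) xi i x * (w (r i.+1) x - w (r i) x))%R ^+ 2)%:E =
   (\sum_(i < n) fine (\int[P]_x (xi i x ^+ 2)%:E) * (r i.+1 - r i))%:E)%E.
Proof.
move=> mxi lxi.
have [mS lS SE] := @integral_sqr_martingale _ _ _ P (fun i => F (r i)) xi
  (fun i => w (r i.+1) \- w (r i)) n sF Fm FF mxi
  (fun i ni => adapted_increment F_filtration w_wiener
     (range1 ni) (r_incr ni) (range2 ni))
  (fun i ni => independent_increment w_wiener (range1 ni) (r_incr ni) (range2 ni))
  lxi
  (fun i ni => square_integrable_increment w_wiener
     (range1 ni) (r_incr ni) (range2 ni))
  (fun i ni => integral_increment w_wiener (range1 ni) (r_incr ni) (range2 ni)).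
split; first exact: lS.1.
rewrite SE -sumEFin; apply: eq_bigr => i _.
rewrite (integral_sqr_increment w_wiener (range1 (ltn_ord i)) (r_incr (ltn_ord i))
  (range2 (ltn_ord i))).
rewrite EFinM fineK//; apply: integrable_fin_num => //.
exact: (lxi i (ltn_ord i)).2.
Qed.

(** The sum is a discrete martingale in the centred squares, with second moment at most [60 * K]
    times the sum of the squared steps; Chebyshev's inequality concludes. The bound vanishes with
    the mesh, as the sum of squared steps is at most the mesh times the length. *)
Lemma likely_quadratic_variation (xi : nat -> Omega -> R) (K e : R) : 0 < e ->
  (forall i, (i < n)%N -> sub_measurable (F (r i)) (xi i)) ->
  (forall i x, (i < n)%N -> xi i x ^+ 2 <= K) ->
  likely P (60 * K * (\sum_(i < n) (r i.+1 - r i) ^+ 2) / e ^+ 2) (fun x =>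
    `|\sum_(i < n) xi i x * ((w (r i.+1) x - w (r i) x) ^+ 2 - (r i.+1 - r i))| < e).
Proof.
move=> e0 mxi xiK.
have lxi i (ni : (i < n)%N) : square_integrable P (xi i).
  by apply: (bounded_square_integrable ni (mxi i ni)) => x; exact: xiK.
have [mS lS SE] := @integral_sqr_martingale _ _ _ P (fun i => F (r i)) xi
  (fun i x => (w (r i.+1) \- w (r i)) x ^+ 2 - (r i.+1 - r i)) n sF Fm FF mxi
  (fun i ni => adapted_sqr_increment F_filtration w_wiener
     (range1 ni) (r_incr ni) (range2 ni))
  (fun i ni => independent_sqr_increment w_wiener (range1 ni) (r_incr ni) (range2 ni))
  lxi
  (fun i ni => square_integrable_sqr_increment w_wiener
     (range1 ni) (r_incr ni) (range2 ni))
  (fun i ni => integral_sqr_increment_centered w_wiener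
     (range1 ni) (r_incr ni) (range2 ni)).
have e2 : 0 < e ^+ 2 by rewrite exprn_gt0.
pose X x := \sum_(i < n) xi i x * ((w (r i.+1) x - w (r i) x) ^+ 2 - (r i.+1 - r i)).
apply: (@likely_sub _ _ _ P _ (fun x => X x ^+ 2 < e ^+ 2)).
  by move=> x h; rewrite -ltr_sqr ?nnegrE ?(ltW e0)// real_normK ?num_real.
apply: likely_markov => //.
- by apply: measurable_funX; exact: lS.1.
- by move=> x; rewrite sqr_ge0.
- rewrite SE mulr_sumr -sumEFin; apply: lee_sum => i _.
  rewrite [60 * K]mulrC -mulrA EFinM; apply: lee_pmul.
  + by apply: integral_ge0 => x _; rewrite lee_fin sqr_ge0.
  + by apply: integral_ge0 => x _; rewrite lee_fin sqr_ge0.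
  + have := expectation_cst P K; rewrite unlock /= => <-.
    apply: ge0_le_integral => //.
    * by move=> x _; rewrite lee_fin sqr_ge0.
    * by apply/measurable_EFinP; apply: measurable_funX; exact: (lxi i (ltn_ord i)).1.
    * by move=> x _; rewrite lee_fin xiK.
  + exact: (sqr_increment_deviation w_wiener (range1 (ltn_ord i))
      (r_incr (ltn_ord i)) (range2 (ltn_ord i))).
Qed.

(* The integrand is cut off once its squared norm exceeds [delta]: this keeps it
   adapted and makes the isometry applicable. *)
Lemma likely_sum_sqr_blocks (g : nat -> Omega -> R) N (b : nat -> nat -> bool)
    (delta e : R) : 0 < delta -> 0 < e ->
  (forall i, (i < n)%N -> sub_measurable (F (r i)) (g i)) ->
  (forall i, (i < n)%N -> (\sum_(k < N) b k i <= 1)%N) ->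
  likely P (delta / e) (fun x =>
    \sum_(i < n) g i x ^+ 2 * (r i.+1 - r i) <= delta ->
    \sum_(k < N) (\sum_(i < n) (b k i)%:R * g i x * (w (r i.+1) x - w (r i) x)) ^+ 2
      < e).
Proof.
move=> d0 e0 mg b1.
(* The running norm includes the current term [i], which is known at time [r i]; [h] is thus adapted
   and vanishes from the first crossing of [delta] on. No bound on [g] is required. *)
pose S i x := \sum_(l < i.+1) g l x ^+ 2 * (r l.+1 - r l).
pose h i x := g i x * (S i x <= delta)%R%:R.
have r0 i : (i < n)%N -> 0 < r i.+1 - r i by move=> ni; rewrite subr_gt0 r_incr.
have FF' i j : (j < n)%N -> (i <= j)%N -> F (r i) `<=` F (r j).
  elim: j => [|j ih] nj; first by rewrite leqn0 => /eqP ->.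
  rewrite leq_eqVlt => /predU1P[->//|ij].
  by apply: subset_trans (ih (ltnW nj) ij) _; apply: FF; exact: ltnW.
have mh i : (i < n)%N -> sub_measurable (F (r i)) (h i).
  move=> ni; apply: sub_measurableM; [exact: sF (ltnW ni)|exact: mg|].
  apply: sub_measurable_le; first exact: sF (ltnW ni).
  apply: sub_measurable_sum; first exact: sF (ltnW ni).
  move=> l _; have li : (l <= i)%N by rewrite -ltnS.
  have mgl : sub_measurable (F (r i)) (g l).
    by apply: sub_measurableW (FF' _ _ ni li) _; apply: mg; exact: leq_ltn_trans ni.
  apply: (sub_measurable_comp (sF (ltnW ni)) (f := fun y => y ^+ 2 * (r l.+1 - r l))) => //.
  by apply: measurable_funM.
have h2 i x : (i < n)%N -> h i x ^+ 2 * (r i.+1 - r i) <= delta.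
  move=> ni; rewrite /h; case: (boolP (S i x <= delta)) => Sd; last first.
    by rewrite mulr0 expr0n/= mul0r ltW.
  rewrite mulr1; apply: le_trans Sd; rewrite /S big_ord_recr/= lerDr.
  apply: sumr_ge0 => l _; apply: mulr_ge0; first exact: sqr_ge0.
  by apply/ltW/r0; exact: ltn_trans ni.
(* The terms kept are those with [S i x <= delta], and the last of these partial sums dominates all
   of them. *)
have sum_h m x : (m <= n)%N -> \sum_(i < m) h i x ^+ 2 * (r i.+1 - r i) <= delta.
  elim: m => [|m ih] mn; first by rewrite big_ord0 ltW.
  rewrite big_ord_recr/= {2}/h; case: (boolP (S m x <= delta)) => Sd; last first.
    by rewrite mulr0 expr0n/= mul0r addr0; apply: ih; exact: ltnW.
  apply: le_trans Sd; rewrite /S [leRHS]big_ord_recr/= mulr1 lerD2r.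
  apply: ler_sum => i _; apply: ler_wpM2r.
    by apply/ltW/r0; exact: ltn_trans mn.
  rewrite /h exprMn -[leRHS]mulr1; apply: ler_wpM2l; first exact: sqr_ge0.
  by case: (S i x <= delta); rewrite ?expr1n ?expr0n.
(* On the event of the premise the cut-off never acts, so the bound proved for [h] is the one wanted
   for [g]. *)
have hg x : \sum_(i < n) g i x ^+ 2 * (r i.+1 - r i) <= delta ->
    forall i, (i < n)%N -> h i x = g i x.
  move=> gd i ni; rewrite /h (_ : (S i x <= delta) = true) ?mulr1//.
  apply: le_trans gd; rewrite /S.
  rewrite -(subnKC ni) big_split_ord/= lerDl; apply: sumr_ge0 => l _.
  apply: mulr_ge0; first exact: sqr_ge0.
  apply/ltW/r0; rewrite -[X in (_ < X)%N](subnKC ni) ltn_add2l//.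
have lh i : (i < n)%N -> square_integrable P (h i).
  move=> ni; apply: (bounded_square_integrable (K := delta / (r i.+1 - r i)) ni (mh _ ni)).
  by move=> x; rewrite ler_pdivlMr ?r0// h2.
pose c i := fine (\int[P]_x (h i x ^+ 2)%:E).
have cE i : (i < n)%N -> (\int[P]_x (h i x ^+ 2)%:E = (c i)%:E)%E.
  move=> ni; rewrite fineK//; apply: integrable_fin_num => //; exact: (lh i ni).2.
have mbh k i : (i < n)%N -> sub_measurable (F (r i)) (fun x => (b k i)%:R * h i x).
  move=> ni; apply: sub_measurableM; [exact: sF (ltnW ni)| |exact: mh].
  by apply: sub_measurable_cst; exact: sF (ltnW ni).
have lbh k i : (i < n)%N -> square_integrable P (fun x => (b k i)%:R * h i x).
  move=> ni; apply: (bounded_square_integrable (K := delta / (r i.+1 - r i)) ni (mbh k _ ni)).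
  move=> x; rewrite ler_pdivlMr ?r0//; apply: le_trans (h2 i x ni).
  apply: ler_wpM2r; first exact/ltW/r0.
  by case: (b k i); rewrite ?mul1r// mul0r expr0n/= sqr_ge0.
have isom k := @discrete_ito_isometry (fun i x => (b k i)%:R * h i x) (mbh k) (lbh k).
pose X x := \sum_(k < N) (\sum_(i < n) (b k i)%:R * h i x *
  (w (r i.+1) x - w (r i) x)) ^+ 2.
apply: (@likely_sub _ _ _ _ _ (fun x => X x < e)).
  move=> x Xe /hg ghx; apply: le_lt_trans Xe; rewrite le_eqVlt; apply/orP; left.
  apply/eqP/eq_bigr => k _; congr (_ ^+ 2); apply: eq_bigr => i _.
  by rewrite ghx.
apply: likely_markov => //.
- apply: measurable_sum => k; apply: measurable_funX; exact: (isom k).1.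
- by move=> x; apply: sumr_ge0 => k _; exact: sqr_ge0.
- under eq_integral do rewrite -sumEFin.
  rewrite ge0_integral_sum//; last 2 first.
  + by move=> k; apply/measurable_EFinP; apply: measurable_funX; exact: (isom k).1.
  + by move=> k x _; rewrite lee_fin sqr_ge0.
  under eq_bigr do rewrite (isom _).2.
  rewrite sumEFin lee_fin exchange_big/=.
  (* The cells of distinct blocks are disjoint, so the isometries of all blocks together count each
     cell at most once. *)
  apply: (@le_trans _ _ (\sum_(i < n) c i * (r i.+1 - r i))).
    apply: ler_sum => i _.
    have c0 : 0 <= c i.
      by apply: fine_ge0; apply: integral_ge0 => x _; rewrite lee_fin sqr_ge0.
    rewrite -mulr_suml; apply: ler_wpM2r; first exact/ltW/r0.
    have -> : \sum_(k < N) fine (\int[P]_x (((b k i)%:R * h i x) ^+ 2)%:E) =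
        \sum_(k < N) (b k i)%:R * c i.
      apply: eq_bigr => k _; case: (b k i).
        by rewrite mul1r; congr fine; apply: eq_integral => x _; rewrite mul1r.
      rewrite mul0r (_ : (fun x => _) = cst 0%E) ?integral0//.
      by apply/funext => x; rewrite mul0r expr0n.
    rewrite -mulr_suml -[leRHS]mul1r; apply: ler_wpM2r => //.
    by rewrite -natr_sum (ler_nat _ _ 1) b1.
  rewrite -lee_fin -sumEFin.
  have -> : (\sum_(i < n) (c i * (r i.+1 - r i))%:E =
      \int[P]_x (\sum_(i < n) (h i x ^+ 2 * (r i.+1 - r i))%:E))%E.
    rewrite ge0_integral_sum//; last 2 first.
    - move=> i; apply/measurable_EFinP/measurable_funM => //.
      by apply: measurable_funX; exact: (lh i (ltn_ord i)).1.
    - by move=> i x _; rewrite lee_fin mulr_ge0 ?sqr_ge0// ltW// r0.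
    apply: eq_bigr => i _; rewrite EFinM -cE//.
    under [RHS]eq_integral do rewrite EFinM.
    rewrite ge0_integralZr//.
    + apply/measurable_EFinP; apply: measurable_funX.
      exact: (lh i (ltn_ord i)).1.
    + by move=> x _; rewrite lee_fin sqr_ge0.
    + by rewrite lee_fin ltW// r0.
  have := expectation_cst P delta; rewrite unlock /= => <-.
  apply: ge0_le_integral => //.
  + move=> x _; apply: sume_ge0 => i _.
    by rewrite lee_fin mulr_ge0 ?sqr_ge0// ltW// r0.
  + apply: emeasurable_sum => i; apply/measurable_EFinP/measurable_funM => //.
    by apply: measurable_funX; exact: (lh i (ltn_ord i)).1.
  + by move=> x _; rewrite sumEFin lee_fin sum_h.
Qed.

End discrete_integral.

(** * Grids and simple processes *)

Section grid.
Context {R : realType}.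
Implicit Types (a b x y : R) (n : nat) (r : nat -> R).

(** Strict steps keep the Wiener increments over the cells nondegenerate; [n = 0] is the grid of a
    one-point interval. *)
Definition is_grid a b n r :=
  [/\ r 0%N = a, r n = b & forall i, (i < n)%N -> r i < r i.+1].

Definition grid_point n r x := exists2 i, (i <= n)%N & r i = x.

(** Constant on cells open on the left and closed on the right, like [simple_fun]; the
    representative value is therefore read at the right end, and nothing is said at [r 0]. *)
Definition stepwise n r (phi : R -> R) :=
  forall i y, (i < n)%N -> r i < y <= r i.+1 -> phi y = phi (r i.+1).

Section theory.
Variables (a b : R) (n : nat) (r : nat -> R).
Hypothesis gr : is_grid a b n r.

Lemma grid_le i j : (i <= j)%N -> (j <= n)%N -> r i <= r j.
Proof.
case: gr => _ _ inc; elim: j => [|j ih]; first by rewrite leqn0 => /eqP ->.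
rewrite leq_eqVlt => /predU1P[->//|ij] jn.
by apply: le_trans (ih ij (ltnW jn)) (ltW _); exact: inc.
Qed.

Lemma grid_lt i j : (i < j)%N -> (j <= n)%N -> r i < r j.
Proof.
move=> ij jn; case: gr => _ _ inc; apply: lt_le_trans (grid_le ij jn).
by apply: inc; exact: leq_trans jn.
Qed.

Lemma grid_leE i j : (i <= n)%N -> (j <= n)%N -> (r i <= r j) = (i <= j)%N.
Proof.
move=> ni nj; case: (leqP i j) => [ij|ji]; first exact: grid_le.
by apply/negbTE; rewrite -ltNge grid_lt.
Qed.

Lemma grid_range i : (i <= n)%N -> a <= r i <= b.
Proof.
case: (gr) => <- <- _ ni; apply/andP; split; last exact: grid_le.
exact: (grid_le (leq0n i) ni).
Qed.

Lemma grid_point_range x : grid_point n r x -> a <= x <= b.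
Proof. by move=> [i ni <-]; exact: grid_range. Qed.

(** Since [x] is a grid point, the selected cells are exactly those before it, and the sum
    telescopes. *)
Lemma grid_sum_le (g : R -> R) x : grid_point n r x ->
  \sum_(i < n) (r i.+1 <= x)%R%:R * (g (r i.+1) - g (r i)) = g x - g a.
Proof.
move=> [j jn <-]; rewrite -(subnKC jn) big_split_ord/=.
rewrite [X in _ + X]big1 ?addr0; last first.
  move=> i _; rewrite grid_leE//; last first.
    by rewrite -[X in (_ <= X)%N](subnKC jn) ltn_add2l.
  by rewrite leqNgt ltnS leq_addr mul0r.
have := telescope_sumr (g \o r) (leq0n j); rewrite /= big_mkord.
case: (gr) => -> _ _ <-.
apply: eq_bigr => i _; rewrite grid_leE//; last exact: leq_trans jn.
by rewrite ltn_ord mul1r.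
Qed.

Lemma grid_sum_lt_le (g : R -> R) x y : grid_point n r x -> grid_point n r y ->
  x <= y ->
  \sum_(i < n) (x < r i.+1 <= y)%R%:R * (g (r i.+1) - g (r i)) = g y - g x.
Proof.
move=> px py xy.
have -> : g y - g x = (g y - g a) - (g x - g a) by ring.
rewrite -(grid_sum_le g px) -(grid_sum_le g py) -sumrB; apply: eq_bigr => i _.
rewrite -mulrBl; congr (_ * _); rewrite ltNge.
case: (leP (r i.+1) x) => [rx|xr]; first by rewrite (le_trans rx xy) subrr.
by rewrite subr0.
Qed.

Lemma grid_between i x : (i < n)%N -> grid_point n r x -> x < r i.+1 -> x <= r i.
Proof.
by move=> ni [j nj <-]; rewrite ltNge !grid_leE// ?(ltnW ni)// -ltnNge ltnS.
Qed.

Local Notation mu := (@lebesgue_measure R).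

(** Cells are added one at a time. The induction starts from the single point [a], which is null, so
    the value of [phi] there does not matter. *)
Lemma stepwise_integral (phi : R -> R) : (forall y, 0 <= phi y) ->
  stepwise n r phi ->
  (\int[mu]_(y in `[a, b]) (phi y)%:E =
   (\sum_(i < n) phi (r i.+1) * (r i.+1 - r i))%:E)%E.
Proof.
move=> phi0 st; case: (gr) => r0 <- inc.
suff : forall m, (m <= n)%N -> measurable_fun `[a, r m] phi /\
    (\int[mu]_(y in `[a, r m]) (phi y)%:E =
     (\sum_(i < m) phi (r i.+1) * (r i.+1 - r i))%:E)%E.
  by move=> /(_ n (leqnn n))[].
elim => [|m ih] mn.
  rewrite r0 set_itv1 big_ord0; split; first exact: measurable_fun_set1.
  by rewrite integral_set1.
have [mphi phiE] := ih (ltnW mn).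
have ar : a <= r m by have /andP[] := grid_range (ltnW mn).
have rr : r m < r m.+1 by exact: inc.
have U : `[a, r m.+1]%classic = `[a, r m]%classic `|` `]r m, r m.+1]%classic.
  by rewrite -itv_bndbnd_setU// bnd_simp// ltW.
have cst2 y : y \in `]r m, r m.+1]%classic -> phi y = phi (r m.+1).
  by rewrite inE/= in_itv/= => h; apply: st.
have mphi2 : measurable_fun `]r m, r m.+1] phi.
  by apply: (eq_measurable_fun (cst (phi (r m.+1)))) => // y /cst2.
split; first by rewrite U; apply/measurable_funU.
rewrite U ge0_integral_setU//=; last 3 first.
- by rewrite -U; apply/measurable_EFinP; rewrite U; apply/measurable_funU.
- by move=> y _; rewrite lee_fin.
- rewrite disj_set2E; apply/eqP/seteqP; split => // y [] /=.
  by rewrite !in_itv/= => /andP[_ h1] /andP[h2 _]; move: (lt_le_trans h2 h1); rewrite ltxx.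
rewrite phiE big_ord_recr/= EFinD; congr (_ + _)%E.
rewrite (eq_integral (cst (phi (r m.+1))%:E)); last by move=> y /cst2 ->.
rewrite integral_cst//= lebesgue_measure_itv/= lte_fin rr -EFinB -EFinM.
by [].
Qed.

End theory.
End grid.

Section simple_process.
Context {R : realType} {d : measure_display} {Omega : measurableType d}.
Implicit Types (H : @simple_process R d Omega) (om : Omega).

(** The grid stops at [t], so later breakpoints are moved to [t]. *)
Definition refines n (r : nat -> R) (t : R) H :=
  forall k, (k <= sp_size H)%N -> grid_point n r (Num.min (sp_time H k) t).

Variables (theta t : R) (n : nat) (r : nat -> R) (H : @simple_process R d Omega).
Hypotheses (gr : is_grid theta t n r) (rH : refines n r t H).

Let rt i : (i <= n)%N -> r i <= t.
Proof. by move=> /(grid_range gr)/andP[]. Qed.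

Let break_le k i : (k <= sp_size H)%N -> (i < n)%N ->
  sp_time H k < r i.+1 -> sp_time H k <= r i.
Proof.
move=> kH ni sr; have := rH kH; rewrite min_l; last first.
  exact: le_trans (ltW sr) (rt ni).
by move=> h; exact: (grid_between gr ni h sr).
Qed.

Lemma simple_fun_stepwise om : stepwise n r (fun y => simple_fun H y om).
Proof.
move=> i y ni /andP[ry yr]; apply: eq_bigr => k _; congr (_ * _).
rewrite !indicE !mem_setE !in_itv/=; congr ((nat_of_bool _)%:R).
have k1 := break_le (ltnW (ltn_ord k)) ni; have k2 := break_le (ltn_ord k) ni.
apply/idP/idP => /andP[h1 h2]; apply/andP; split.
- exact: lt_le_trans yr.
- by rewrite leNgt; apply/negP => /k2 h; have := le_lt_trans h ry; rewrite ltNge h2.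
- exact: le_lt_trans (k1 h1) ry.
- exact: le_trans yr h2.
Qed.

(** Each increment between breakpoints is split along the grid, and exchanging the sums collects the
    coefficient of every cell. Processes with different breakpoints thereby become sums over the
    same Wiener increments. *)
Lemma simple_integral_grid (w : R -> Omega -> R) x om : grid_point n r x ->
  (forall k, (k < sp_size H)%N -> sp_time H k <= sp_time H k.+1) ->
  simple_integral w H x om =
  \sum_(i < n) (r i.+1 <= x)%R%:R * simple_fun H (r i.+1) om *
    (w (r i.+1) om - w (r i) om).
Proof.
move=> px mono.
have pm k : (k <= sp_size H)%N -> grid_point n r (Num.min (sp_time H k) x).
  move=> kH; have xt : x <= t by have /andP[] := grid_point_range gr px.
  rewrite -(min_r xt) minA; case: (leP (Num.min (sp_time H k) t) x) => _ //.
  exact: rH.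
transitivity (\sum_(i < n) \sum_(k < sp_size H) sp_val H k om *
    ((Num.min (sp_time H k) x < r i.+1 <= Num.min (sp_time H k.+1) x)%R%:R *
    (w (r i.+1) om - w (r i) om))).
  rewrite exchange_big/=; apply: eq_bigr => k _; rewrite -mulr_sumr.
  congr (_ * _); rewrite (grid_sum_lt_le gr (w^~ om))//.
  - by apply: pm; exact: ltnW.
  - exact: pm.
  - by rewrite le_min2// mono.
apply: eq_bigr => i _; rewrite -mulrA /simple_fun mulr_suml mulr_sumr.
apply: eq_bigr => k _; rewrite [RHS]mulrCA -mulrA; congr (_ * _).
rewrite mulrA; congr (_ * _); rewrite indicE mem_setE in_itv/= -natrM.
rewrite mulnb; congr ((nat_of_bool _)%:R); rewrite gt_min le_min.
by case: (leP (r i.+1) x) => [rx|xr]; rewrite ?andbF ?orbF ?andbT.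
Qed.

Lemma simple_integral_increment (w : R -> Omega -> R) x y om :
  grid_point n r x -> grid_point n r y -> x <= y ->
  (forall k, (k < sp_size H)%N -> sp_time H k <= sp_time H k.+1) ->
  simple_integral w H y om - simple_integral w H x om =
  \sum_(i < n) (x < r i.+1 <= y)%R%:R * simple_fun H (r i.+1) om *
    (w (r i.+1) om - w (r i) om).
Proof.
move=> px py xy mono; rewrite !simple_integral_grid// -sumrB.
apply: eq_bigr => i _; rewrite -!mulrA -mulrBl; congr (_ * _); rewrite ltNge.
case: (leP (r i.+1) x) => [rx|xr]; first by rewrite (le_trans rx xy) subrr.
by rewrite subr0.
Qed.

(** The value is read at the right end of a cell but known at its left end: no breakpoint lies
    strictly inside the cell, so every value active there was revealed by time [r i]. *)
Lemma simple_fun_adapted (F : R -> set (set Omega)) i : (i < n)%N ->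
  sigma_algebra setT (F (r i)) ->
  (forall k, (k < sp_size H)%N -> sp_time H k <= r i -> F (sp_time H k) `<=` F (r i)) ->
  (forall k, (k < sp_size H)%N -> sub_measurable (F (sp_time H k)) (sp_val H k)) ->
  sub_measurable (F (r i)) (simple_fun H (r i.+1)).
Proof.
move=> ni sF FF mH; apply: sub_measurable_sum => // k _.
have [kr|rk] := ltP (sp_time H k) (r i.+1); last first.
  rewrite (_ : (fun w => _) = fun=> 0); first exact: sub_measurable_cst.
  apply/funext => om; rewrite indicE mem_setE in_itv/=.
  by rewrite ltNge rk/= mulr0.
apply: sub_measurableM => //; last exact: sub_measurable_cst.
apply: sub_measurableW (FF k _ _) _ => //; last exact: mH.
exact: (break_le (ltnW (ltn_ord k)) ni kr).
Qed.

End simple_process.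

Section grid_existence.
Context {R : realType}.
Implicit Types (a b : R) (s : seq R).

Lemma grid_through a b s : a <= b -> {in s, forall x, a <= x <= b} ->
  exists n r, is_grid a b n r /\ {in s, forall x, grid_point n r x}.
Proof.
move=> ab sab; pose l := sort <=%R (undup (a :: b :: s)).
have lin x : x \in l = (x \in a :: b :: s) by rewrite mem_sort mem_undup.
have lab x : x \in l -> a <= x <= b.
  by rewrite lin !inE => /or3P[/eqP->|/eqP->|/sab//]; rewrite ?lexx ?ab.
have lsort : sorted <%R l.
  rewrite lt_sorted_uniq_le sort_uniq undup_uniq/=.
  by apply: sort_sorted; exact: le_total.
have al : a \in l by rewrite lin inE eqxx.
have bl : b \in l by rewrite lin !inE eqxx orbT.
have sl : (0 < size l)%N by case: (l) al.
have pt x : x \in l -> grid_point (size l).-1 (nth b l) x.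
  move=> xl; exists (index x l); last exact: nth_index.
  by rewrite -ltnS prednK// index_mem.
have inc i : (i < (size l).-1)%N -> nth b l i < nth b l i.+1.
  by move=> h; apply: (sortedP b lsort); rewrite -ltn_predRL.
have lemono : forall i j, (i <= j)%N -> (j < size l)%N -> nth b l i <= nth b l j.
  move=> i j ij jl; have := @sorted_leq_nth _ _ le_trans lexx b l.
  move=> /(_ (sub_sorted (@ltW _ _) lsort)); apply => //.
  by rewrite inE (leq_ltn_trans ij).
exists (size l).-1, (nth b l); split; last by move=> x xs; apply: pt; rewrite lin !inE xs !orbT.
split => //.
- apply/eqP; rewrite eq_le; apply/andP; split; last first.
    by have /andP[] := lab _ (mem_nth b sl).
  by rewrite -[leRHS](nth_index b al) lemono// index_mem.
- have sl' : ((size l).-1 < size l)%N by rewrite prednK.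
  apply/eqP; rewrite eq_le; apply/andP; split.
    by have /andP[] := lab _ (mem_nth b sl').
  rewrite -[leLHS](nth_index b bl) lemono//.
  by rewrite -ltnS prednK// index_mem.
Qed.

Lemma fine_grid_through a b s (e : R) : a <= b -> 0 < e ->
  {in s, forall x, a <= x <= b} ->
  exists n r, [/\ is_grid a b n r, {in s, forall x, grid_point n r x} &
    forall i, (i < n)%N -> r i.+1 - r i < e].
Proof.
move=> ab e0 sab; pose m := Num.truncn ((b - a) / e).
(* Points spaced by [e / 2], cut at [b]; [m.+1 * 2] steps suffice because [m.+1 * e] exceeds
   [b - a]. *)
pose u := [seq Num.min (a + k%:R * (e / 2)) b | k <- iota 0 (m.+1 * 2).+1].
have [n [r [gr pt]]] : exists n r, is_grid a b n r /\
    {in s ++ u, forall x, grid_point n r x}.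
  apply: grid_through => // x; rewrite mem_cat => /orP[/sab//|/mapP[k _ ->]].
  rewrite ge_min lexx orbT andbT le_min ab andbT lerDl mulr_ge0//.
  by rewrite divr_ge0// ltW.
exists n, r; split => //; first by move=> x xs; apply: pt; rewrite mem_cat xs.
(* [k] indexes the last spaced point not after [r i]. The next one is a grid point after [r i],
   hence not before [r i.+1], so the step is at most [e / 2]. *)
move=> i ni; pose k := Num.truncn ((r i - a) / (e / 2)).
have e20 : 0 < e / 2 by rewrite divr_gt0.
have ri0 : 0 <= r i - a.
  by rewrite subr_ge0; have /andP[] := grid_range gr (ltnW ni).
have rib : r i < b.
  apply: lt_le_trans (_ : r i.+1 <= b); first by case: gr => _ _; exact.
  by have /andP[] := grid_range gr ni.
have /andP[kr rk] : k%:R <= (r i - a) / (e / 2) < k.+1%:R.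
  by rewrite truncn_itv// divr_ge0// ltW.
rewrite ler_pdivlMr// in kr; rewrite ltr_pdivrMr// in rk.
have km : (k < m.+1 * 2)%N.
  rewrite -(ltr_nat R) natrM.
  have /andP[_ bm] : m%:R <= (b - a) / e < m.+1%:R.
    by rewrite truncn_itv// divr_ge0 ?subr_ge0// ltW.
  rewrite ltr_pdivrMr// in bm.
  rewrite -(ltr_pM2r e20) (_ : m.+1%:R * 2 * (e / 2) = m.+1%:R * e); last by field.
  by apply: le_lt_trans kr _; lra.
have pk : grid_point n r (Num.min (a + k.+1%:R * (e / 2)) b).
  apply: pt; rewrite mem_cat; apply/orP; right; apply/mapP; exists k.+1 => //.
  by rewrite mem_iota add0n.
have : ~ (Num.min (a + k.+1%:R * (e / 2)) b < r i.+1).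
  move=> /(grid_between gr ni pk); rewrite ge_min leNgt (leNgt b) rib orbF.
  by move/negP; apply; lra.
move/negP; rewrite -leNgt le_min => /andP[h _].
apply: le_lt_trans (_ : k.+1%:R * (e / 2) - k%:R * (e / 2) < e); first lra.
by rewrite -natr1; lra.
Qed.
End grid_existence.

(** * Comparison of square integrals *)

Section integral_comparison.
Context {d} {T : measurableType d} {R : realType}.
Variables (mu : {measure set T -> \bar R}) (D : set T).
Hypothesis mD : measurable D.
Implicit Types a b c f g : T -> R.

Lemma ge0_integral_le_lin2 a b c (k1 k2 B C : R) :
  measurable_fun D a -> measurable_fun D b -> measurable_fun D c ->
  (forall x, D x -> 0 <= a x) -> (forall x, D x -> 0 <= b x) ->
  (forall x, D x -> 0 <= c x) -> 0 <= k1 -> 0 <= k2 ->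
  (forall x, D x -> a x <= k1 * b x + k2 * c x) ->
  (\int[mu]_(x in D) (b x)%:E <= B%:E)%E ->
  (\int[mu]_(x in D) (c x)%:E <= C%:E)%E ->
  (\int[mu]_(x in D) (a x)%:E <= (k1 * B + k2 * C)%:E)%E.
Proof.
move=> ma mb mc a0 b0 c0 k10 k20 abc bB cC.
apply: (@le_trans _ _ (\int[mu]_(x in D) (k1%:E * (b x)%:E + k2%:E * (c x)%:E))%E).
  apply: ge0_le_integral => //.
  - exact/measurable_EFinP.
  - by apply: emeasurable_funD; apply: emeasurable_funM => //; exact/measurable_EFinP.
rewrite ge0_integralD//=; last 4 first.
- by move=> x Dx; rewrite lee_fin mulr_ge0// b0.
- by apply: emeasurable_funM => //; exact/measurable_EFinP.
- by move=> x Dx; rewrite lee_fin mulr_ge0// c0.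
- by apply: emeasurable_funM => //; exact/measurable_EFinP.
rewrite !ge0_integralZl//; last 2 first.
- exact/measurable_EFinP.
- exact/measurable_EFinP.
by rewrite EFinD !EFinM; apply: leeD; apply: lee_wpmul2l.
Qed.

(** Young's inequality applied to x^2 - y^2 = (y - x)^2 - 2 y (y - x). A small [l] makes the term in
    [y ^+ 2] harmless, at the price of a large factor on the distance. *)
Lemma ler_norm_sqrB (x y l : R) : 0 < l ->
  `|x ^+ 2 - y ^+ 2| <= (1 + l^-1) * (y - x) ^+ 2 + l * y ^+ 2.
Proof.
move=> l0; have h : 0 <= (l * y - (y - x)) ^+ 2 / l by rewrite divr_ge0 ?sqr_ge0// ltW.
have h' : 0 <= (l * y + (y - x)) ^+ 2 / l by rewrite divr_ge0 ?sqr_ge0// ltW.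
have E1 : (l * y - (y - x)) ^+ 2 / l =
    l * y ^+ 2 - 2 * y * (y - x) + l^-1 * (y - x) ^+ 2 by field; rewrite gt_eqF.
have E2 : (l * y + (y - x)) ^+ 2 / l =
    l * y ^+ 2 + 2 * y * (y - x) + l^-1 * (y - x) ^+ 2 by field; rewrite gt_eqF.
rewrite E1 in h; rewrite E2 in h'; have := sqr_ge0 (y - x).
by rewrite ler_norml; nra.
Qed.

(** Integrates the pointwise inequality in both directions. Only [g] is known to have a finite norm;
    finiteness for [f] comes from the first direction and is needed to state the second with
    [fine]. *)
Lemma integral_sqr_close f g (delta l C : R) :
  measurable_fun D f -> measurable_fun D g -> 0 < l ->
  (\int[mu]_(x in D) (g x ^+ 2)%:E <= C%:E)%E ->
  (\int[mu]_(x in D) ((g x - f x) ^+ 2)%:E <= delta%:E)%E ->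
  (\int[mu]_(x in D) (f x ^+ 2)%:E)%E \is a fin_num /\
  `|fine (\int[mu]_(x in D) (f x ^+ 2)%:E) - fine (\int[mu]_(x in D) (g x ^+ 2)%:E)|
    <= (1 + l^-1) * delta + l * C.
Proof.
move=> mf mg l0 gC fg.
have mf2 : measurable_fun D (fun x => f x ^+ 2) by exact: measurable_funX.
have mg2 : measurable_fun D (fun x => g x ^+ 2) by exact: measurable_funX.
have mfg2 : measurable_fun D (fun x => (g x - f x) ^+ 2).
  by apply: measurable_funX; exact: measurable_funB.
have iv : 0 <= l^-1 by rewrite invr_ge0 ltW.
have I0 (k : T -> R) : (0 <= \int[mu]_(x in D) (k x ^+ 2)%:E)%E.
  by apply: integral_ge0 => x _; rewrite lee_fin sqr_ge0.
have fingE : (\int[mu]_(x in D) (g x ^+ 2)%:E)%E \is a fin_num.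
  by rewrite ge0_fin_numE// (le_lt_trans gC)// ltry.
have fE : (\int[mu]_(x in D) (f x ^+ 2)%:E <=
    (1 * ((1 + l^-1) * delta + l * C) + 1 * fine (\int[mu]_(x in D) (g x ^+ 2)%:E))%:E)%E.
  apply: (@ge0_integral_le_lin2 _
    (fun x => (1 + l^-1) * (g x - f x) ^+ 2 + l * g x ^+ 2) (fun x => g x ^+ 2)) => //.
  - by apply: measurable_funD; apply: measurable_funM.
  - by move=> x _; rewrite sqr_ge0.
  - by move=> x _; rewrite addr_ge0// mulr_ge0 ?sqr_ge0// ?addr_ge0// ltW.
  - by move=> x _; rewrite sqr_ge0.
  - by move=> x _; have := ler_norm_sqrB (f x) (g x) l0; rewrite ler_norml; lra.
  - apply: (@ge0_integral_le_lin2 _ (fun x => (g x - f x) ^+ 2) (fun x => g x ^+ 2)) => //.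
    + by apply: measurable_funD; apply: measurable_funM.
    + by move=> x _; rewrite addr_ge0// mulr_ge0 ?sqr_ge0// ?addr_ge0// ltW.
    + by move=> x _; rewrite sqr_ge0.
    + by move=> x _; rewrite sqr_ge0.
    + by rewrite addr_ge0.
    + exact: ltW.
  - by rewrite fineK.
have finf : (\int[mu]_(x in D) (f x ^+ 2)%:E)%E \is a fin_num.
  by rewrite ge0_fin_numE// (le_lt_trans fE)// ltry.
split => //.
have gE : (\int[mu]_(x in D) (g x ^+ 2)%:E <=
    (1 * ((1 + l^-1) * delta + l * C) + 1 * fine (\int[mu]_(x in D) (f x ^+ 2)%:E))%:E)%E.
  apply: (@ge0_integral_le_lin2 _
    (fun x => (1 + l^-1) * (g x - f x) ^+ 2 + l * g x ^+ 2) (fun x => f x ^+ 2)) => //.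
  - by apply: measurable_funD; apply: measurable_funM.
  - by move=> x _; rewrite sqr_ge0.
  - by move=> x _; rewrite addr_ge0// mulr_ge0 ?sqr_ge0// ?addr_ge0// ltW.
  - by move=> x _; rewrite sqr_ge0.
  - by move=> x _; have := ler_norm_sqrB (f x) (g x) l0; rewrite ler_norml; lra.
  - apply: (@ge0_integral_le_lin2 _ (fun x => (g x - f x) ^+ 2) (fun x => g x ^+ 2)) => //.
    + by apply: measurable_funD; apply: measurable_funM.
    + by move=> x _; rewrite addr_ge0// mulr_ge0 ?sqr_ge0// ?addr_ge0// ltW.
    + by move=> x _; rewrite sqr_ge0.
    + by move=> x _; rewrite sqr_ge0.
    + by rewrite addr_ge0.
    + exact: ltW.
  - by rewrite fineK.
rewrite -(fineK finf) lee_fin in fE; rewrite -(fineK fingE) lee_fin in gE.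
by rewrite ler_norml; lra.
Qed.

End integral_comparison.

(* [lebesgue_measure] lives on [measurableTypeR R], which is convertible to, but
   not unified with, the canonical measurable type on [R]. *)
Section lebesgue_comparison.
Context {R : realType}.
Variables (D : set R) (mD : measurable D).
Local Notation mu := (@lebesgue_measure R).

Lemma lebesgue_integral_le_lin2 (a b c : R -> R) (k1 k2 B C : R) :
  measurable_fun D a -> measurable_fun D b -> measurable_fun D c ->
  (forall x, D x -> 0 <= a x) -> (forall x, D x -> 0 <= b x) ->
  (forall x, D x -> 0 <= c x) -> 0 <= k1 -> 0 <= k2 ->
  (forall x, D x -> a x <= k1 * b x + k2 * c x) ->
  (\int[mu]_(x in D) (b x)%:E <= B%:E)%E ->
  (\int[mu]_(x in D) (c x)%:E <= C%:E)%E ->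
  (\int[mu]_(x in D) (a x)%:E <= (k1 * B + k2 * C)%:E)%E.
Proof. exact: (@ge0_integral_le_lin2 _ (measurableTypeR R)). Qed.

Lemma lebesgue_integral_sqr_close (f g : R -> R) (delta l C : R) :
  measurable_fun D f -> measurable_fun D g -> 0 < l ->
  (\int[mu]_(x in D) (g x ^+ 2)%:E <= C%:E)%E ->
  (\int[mu]_(x in D) ((g x - f x) ^+ 2)%:E <= delta%:E)%E ->
  (\int[mu]_(x in D) (f x ^+ 2)%:E)%E \is a fin_num /\
  `|fine (\int[mu]_(x in D) (f x ^+ 2)%:E) - fine (\int[mu]_(x in D) (g x ^+ 2)%:E)|
    <= (1 + l^-1) * delta + l * C.
Proof. exact: (@integral_sqr_close _ (measurableTypeR R)). Qed.

End lebesgue_comparison.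

Lemma lebesgue_integral_itv_le {R : realType} (a b K : R) (f : R -> R) :
  a <= b -> 0 <= K -> measurable_fun `[a, b] f -> (forall x, 0 <= f x) ->
  (forall x, f x <= K) ->
  (\int[lebesgue_measure]_(x in `[a, b]) (f x)%:E <= (K * (b - a))%:E)%E.
Proof.
move=> ab K0 mf f0 fK.
apply: (@le_trans _ _ (\int[lebesgue_measure]_(y in `[a, b]) K%:E)%E).
  apply: ge0_le_integral => //.
  - by move=> y _; rewrite lee_fin.
  - by apply/measurable_EFinP; exact: mf.
  - by move=> y _; rewrite lee_fin.
by rewrite integral_cst//= lebesgue_measure_itv/= lte_fin; case: ifPn => _;
  rewrite ?mule0 ?lee_fin ?mulr_ge0 ?subr_ge0// -EFinB -EFinM.
Qed.

(** * Approximation of Ito integrals by simple processes *)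

Section approximation.
Context {R : realType} {d : measure_display} {Omega : measurableType d}.
Variables (P : probability Omega R) (theta T : R).
Variables (F : R -> set (set Omega)) (w : R -> Omega -> R).
Hypothesis F_filtration : complete_filtration P theta T F.
Hypothesis w_wiener : filtered_wiener_process P theta T F w.

Local Notation mu := (@lebesgue_measure R).

Lemma simple_fun_sqr_bounded (S : simple_process) : simple_adapted theta T F S ->
  exists2 K : R, 0 <= K & forall y om, simple_fun S y om ^+ 2 <= K.
Proof.
move=> [_ _ [K SK] _]; exists (((sp_size S)%:R * `|K|) ^+ 2); first exact: sqr_ge0.
move=> y om; rewrite -real_normK ?num_real// ler_sqr ?nnegrE ?mulr_ge0//.
rewrite /simple_fun; apply: le_trans (ler_norm_sum _ _ _) _.
rewrite -[in leRHS](card_ord (sp_size S)) mulr_natl -sumr_const.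
apply: ler_sum => k _; rewrite normrM -[leRHS]mulr1; apply: ler_pM => //.
  by apply: le_trans (SK _ _ (ltn_ord k)) (ler_norm _).
by rewrite indicE; case: (_ \in _); rewrite ?normr1 ?normr0.
Qed.

Lemma measurable_simple_fun (S : @simple_process R d Omega) (D : set R) om :
  measurable_fun D (fun y => simple_fun S y om).
Proof.
by apply: measurable_sum => k; exact: measurable_funM.
Qed.

Lemma simple_fun_grid_adapted (S : simple_process) t n r i :
  simple_adapted theta T F S -> t <= T -> is_grid theta t n r -> refines n r t S ->
  (i < n)%N -> sub_measurable (F (r i)) (simple_fun S (r i.+1)).
Proof.
move=> [Srange Smono _ Smeas] tT gr rS ni.
have /andP[r1 r2] := grid_range gr (ltnW ni).
apply: (simple_fun_adapted gr rS ni) => //.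
  by apply: (filtration_sigma_algebra F_filtration); rewrite in_itv/= r1 (le_trans r2).
move=> k kS kr; apply: (filtration_mono F_filtration) => //.
  by have := Srange k (ltnW kS); rewrite in_itv/= => /andP[].
exact: le_trans tT.
Qed.

Lemma likely_eventually_forall n (Q : nat -> nat -> Omega -> Prop) (e : R) :
  (forall k, (k < n)%N -> exists N, forall m, (N <= m)%N -> likely P e (Q k m)) ->
  exists N, forall m, (N <= m)%N ->
    likely P (n%:R * e) (fun om => forall k, (k < n)%N -> Q k m om).
Proof.
move=> h; suff [N hN] : exists N, forall k, (k < n)%N -> forall m, (N <= m)%N ->
    likely P e (Q k m).
  by exists N => m Nm; apply: likely_forall => k kn; exact: hN.
elim: n h => [|n ih] h; first by exists 0%N.
have [N hN] := ih (fun k kn => h k (leqW kn)).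
have [N' hN'] := h n (ltnSn n).
exists (maxn N N') => k; rewrite ltnS leq_eqVlt => /predU1P[->|kn] m.
  by rewrite geq_max => /andP[_ /hN'].
by rewrite geq_max => /andP[/(hN k kn)].
Qed.

(** The form in which the definition of the integral is used: closeness of the integrands, and
    closeness of the integrals at finitely many times simultaneously, with a threshold that depends
    on these times. *)
Definition ito_approximation (H M : R -> Omega -> R) (S : nat -> simple_process) :=
  [/\ forall n, simple_adapted theta T F (S n),
      forall a e : R, 0 < a -> 0 < e -> exists N, forall n, (N <= n)%N ->
        likely P e (fun om => (\int[mu]_(y in `[theta, T])
          ((simple_fun (S n) y om - H y om) ^+ 2)%:E < a%:E)%E) &
      forall n (x : nat -> R) (a e : R),
        (forall k, (k <= n)%N -> theta <= x k <= T) -> 0 < a -> 0 < e ->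
        exists N, forall m, (N <= m)%N -> likely P e (fun om =>
          forall k, (k < n.+1)%N ->
            `|simple_integral w (S m) (x k) om - M (x k) om| < a)].

Lemma ito_integral_approximation (H M : R -> Omega -> R) :
  ito_integral P theta T F w H M -> exists S, ito_approximation H M S.
Proof.
move=> [_ _ [S [adS limH limM]]]; exists S; split => //.
  by move=> a e a0 e0; exact: likely_vanishes limH _ _.
move=> n x a e xT a0 e0.
have e10 : 0 < e / n.+1%:R by rewrite divr_gt0.
have [N hN] : exists N, forall m, (N <= m)%N -> likely P (n.+1%:R * (e / n.+1%:R))
    (fun om => forall k, (k < n.+1)%N ->
      (`|simple_integral w (S m) (x k) om - M (x k) om|%:E < a%:E)%E).
  apply: likely_eventually_forall => k kn.
  by apply: likely_vanishes => //; apply: limM; rewrite in_itv/= xT.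
exists N => m /hN; rewrite mulrCA divff// mulr1; apply: likely_sub => om h k kn.
by rewrite -lte_fin; exact: h.
Qed.

Let subT t : t <= T -> `[theta, t]%classic `<=` `[theta, T]%classic.
Proof. by move=> tT y /=; rewrite !in_itv/= => /andP[->] /le_trans; apply. Qed.

Let integral_subT t (f : R -> R) : t <= T -> measurable_fun `[theta, T] f ->
  (forall y, 0 <= f y) ->
  (\int[mu]_(y in `[theta, t]) (f y)%:E <= \int[mu]_(y in `[theta, T]) (f y)%:E)%E.
Proof.
move=> tT mf f0; apply: ge0_subset_integral => //; last exact: subT.
- exact/measurable_EFinP.
- by move=> y _; rewrite lee_fin.
Qed.

(** A single approximating simple process suffices: it is bounded, and H^2 <= 2 (S - H)^2 + 2
    S^2. *)
Lemma likely_ito_norm_bounded (H M : R -> Omega -> R) (e : R) :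
  ito_integral P theta T F w H M -> theta <= T -> 0 < e ->
  exists2 L : R, 0 <= L & likely P e (fun om =>
    (\int[mu]_(y in `[theta, T]) (H y om ^+ 2)%:E <= L%:E)%E).
Proof.
move=> HM thT e0; have [mH _ _] := HM.
have [S [adS limH _]] := ito_integral_approximation HM.
have [N hN] := limH _ _ ltr01 e0; have {}hN := hN N (leqnn N).
have [K K0 SK] := simple_fun_sqr_bounded (adS N).
exists (2 * 1 + 2 * (K * (T - theta))).
  by rewrite addr_ge0// !mulr_ge0// subr_ge0.
have := likely_and (likely_ae mH) hN; rewrite add0r.
apply: likely_sub => om [mHom]; have mS := measurable_simple_fun (S N).
move=> /ltW h1; apply: (@lebesgue_integral_le_lin2 _ _ _ _
  (fun y => (simple_fun (S N) y om - H y om) ^+ 2) (fun y => simple_fun (S N) y om ^+ 2)) => //.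
- exact: measurable_funX.
- by apply: measurable_funX; exact: measurable_funB.
- exact: measurable_funX.
- by move=> y _; rewrite sqr_ge0.
- by move=> y _; rewrite sqr_ge0.
- by move=> y _; rewrite sqr_ge0.
- by move=> y _; have := sqr_ge0 (2 * simple_fun (S N) y om - H y om); nra.
- apply: lebesgue_integral_itv_le => //; first exact: measurable_funX.
  by move=> y; rewrite sqr_ge0.
Qed.

(* L2-closeness of the integrands [S] and [S'] makes the increments of their
   integrals close in l2, uniformly over the grids. *)
Lemma likely_increments_close (S S' : simple_process) t N x (a a' e : R) (H : R -> Omega -> R) :
  simple_adapted theta T F S -> simple_adapted theta T F S' ->
  theta <= t -> t <= T -> is_grid theta t N x -> 0 < a -> 0 < a' ->
  {ae P, forall om, measurable_fun `[theta, T] (H^~ om)} ->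
  likely P e (fun om => (\int[mu]_(y in `[theta, T])
          ((simple_fun S y om - H y om) ^+ 2)%:E < a%:E)%E) ->
  likely P e (fun om => (\int[mu]_(y in `[theta, T])
          ((simple_fun S' y om - H y om) ^+ 2)%:E < a%:E)%E) ->
  likely P (4 * a / a' + (e + e)) (fun om => \sum_(k < N)
    ((simple_integral w S (x k.+1) om - simple_integral w S (x k) om) -
     (simple_integral w S' (x k.+1) om - simple_integral w S' (x k) om)) ^+ 2 < a').
Proof.
move=> adS adS' tht tT gx a0 a'0 mH cS cS'.
(* A common refinement of the coarse grid and of the breakpoints of both processes. *)
pose pts := [seq x k | k <- iota 0 N.+1] ++
  ([seq Num.min (sp_time S k) t | k <- iota 0 (sp_size S).+1] ++
   [seq Num.min (sp_time S' k) t | k <- iota 0 (sp_size S').+1]).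
have minr (S0 : simple_process) k : simple_adapted theta T F S0 ->
    k \in iota 0 (sp_size S0).+1 -> theta <= Num.min (sp_time S0 k) t <= t.
  move=> [Srange _ _ _]; rewrite mem_iota/= add0n ltnS => /Srange.
  by rewrite in_itv/= => /andP[h _]; rewrite le_min h tht ge_min lexx orbT.
have [n [r [gr pt]]] : exists n r, is_grid theta t n r /\
    {in pts, forall z, grid_point n r z}.
  apply: grid_through => // z; rewrite !mem_cat => /or3P[] /mapP[k kI ->].
  - by apply: (grid_range gx); rewrite mem_iota/= add0n ltnS in kI.
  - exact: minr kI.
  - exact: minr kI.
have px k : (k <= N)%N -> grid_point n r (x k).
  move=> kN; apply: pt; rewrite mem_cat; apply/orP; left; apply: map_f.
  by rewrite mem_iota/= add0n ltnS.
have rS : refines n r t S.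
  move=> k kS; apply: pt; rewrite !mem_cat; apply/or3P; apply: Or32.
  by apply/mapP; exists k => //; rewrite mem_iota/= add0n ltnS.
have rS' : refines n r t S'.
  move=> k kS; apply: pt; rewrite !mem_cat; apply/or3P; apply: Or33.
  by apply/mapP; exists k => //; rewrite mem_iota/= add0n ltnS.
have rT i : (i <= n)%N -> theta <= r i <= T.
  by move=> /(grid_range gr)/andP[-> h]/=; exact: le_trans tT.
have rinc : forall i, (i < n)%N -> r i < r i.+1 by case: gr.
have sF i : (i < n)%N -> sigma_algebra setT (F (r i)).
  by move=> ni; apply: (filtration_sigma_algebra F_filtration); rewrite in_itv/= rT// ltnW.
pose g i om := simple_fun S (r i.+1) om - simple_fun S' (r i.+1) om.
(* The blocks are the cells of the coarse grid; telescoping over [k] shows that a fine cell lies in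
   at most one of them. *)
pose b k i := x k < r i.+1 <= x k.+1.
have xinc : forall k, (k < N)%N -> x k < x k.+1 by case: gx.
have mg i : (i < n)%N -> sub_measurable (F (r i)) (g i).
  move=> ni; apply: sub_measurableD; first exact: sF.
    exact: (simple_fun_grid_adapted adS tT gr rS).
  apply: (sub_measurable_comp (sF _ ni) (f := -%R)) => //.
  exact: (simple_fun_grid_adapted adS' tT gr rS').
have b1 i : (i < n)%N -> (\sum_(k < N) b k i <= 1)%N.
  move=> ni; rewrite -(ler_nat R) natr_sum.
  have -> : \sum_(k < N) (b k i)%:R = (r i.+1 <= x N)%R%:R - (r i.+1 <= x 0%N)%R%:R :> R.
    rewrite -(telescope_sumr (fun k => (r i.+1 <= x k)%R%:R) (leq0n N)) big_mkord.
    apply: eq_bigr => k _; rewrite /b ltNge.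
    case: (leP (r i.+1) (x k)) => [rx|xr]; last by rewrite subr0.
    by rewrite (le_trans rx (ltW (xinc _ (ltn_ord k)))) subrr.
  by case: (_ <= x N); case: (_ <= x 0%N) => /=; lra.
have a40 : 0 < 4 * a by rewrite mulr_gt0.
have key := likely_sum_sqr_blocks F_filtration w_wiener rT rinc a40 a'0 mg b1.
have := likely_and key (likely_and (likely_ae mH) (likely_and cS cS')).
rewrite add0r; apply: likely_sub => om [h [mHom [h1 h2]]].
have gE : (\sum_(i < n) g i om ^+ 2 * (r i.+1 - r i))%:E =
    (\int[mu]_(y in `[theta, t]) ((simple_fun S y om - simple_fun S' y om) ^+ 2)%:E)%E.
  rewrite (stepwise_integral gr)//.
    by move=> y; exact: sqr_ge0.
  move=> i y ni ry.
  by rewrite (simple_fun_stepwise gr rS om ni ry) (simple_fun_stepwise gr rS' om ni ry).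
have mS := measurable_simple_fun S; have mS' := measurable_simple_fun S'.
(* Each integrand is within [a] of [H] in squared norm, hence within [4 * a] of the other by (p +
   q)^2 <= 2 p^2 + 2 q^2. *)
have {h} /h : \sum_(i < n) g i om ^+ 2 * (r i.+1 - r i) <= 4 * a.
  rewrite -lee_fin gE; apply: le_trans (integral_subT tT _ _) _.
  - by apply: measurable_funX; exact: measurable_funB.
  - by move=> y; rewrite sqr_ge0.
  have -> : 4 * a = 2 * a + 2 * a by ring.
  apply: (@lebesgue_integral_le_lin2 _ _ _ _
    (fun y => (simple_fun S y om - H y om) ^+ 2)
    (fun y => (simple_fun S' y om - H y om) ^+ 2)) => //; try exact: ltW.
  - by apply: measurable_funX; exact: measurable_funB.
  - by apply: measurable_funX; exact: measurable_funB.
  - by apply: measurable_funX; exact: measurable_funB.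
  - by move=> y _; rewrite sqr_ge0.
  - by move=> y _; rewrite sqr_ge0.
  - by move=> y _; rewrite sqr_ge0.
  - move=> y _; have := sqr_ge0 (simple_fun S y om + simple_fun S' y om - 2 * H y om).
    by nra.
apply: le_lt_trans; rewrite le_eqVlt; apply/orP; left; apply/eqP.
apply: eq_bigr => k _; congr (_ ^+ 2).
have [_ Sm _ _] := adS; have [_ Sm' _ _] := adS'.
have pxk := px _ (ltnW (ltn_ord k)); have pxk1 := px _ (ltn_ord k).
have xk := ltW (xinc _ (ltn_ord k)).
rewrite (simple_integral_increment gr rS)// (simple_integral_increment gr rS')//.
rewrite -sumrB; apply: eq_bigr => i _.
by rewrite -mulrBl -mulrBr.
Qed.

End approximation.

(** * Quadratic and cross variation of Ito integrals *)

Section quadratic_variation.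
Context {R : realType} {d : measure_display} {Omega : measurableType d}.
Variables (P : probability Omega R) (theta T : R).
Variables (F : R -> set (set Omega)) (w : R -> Omega -> R).
Hypothesis F_filtration : complete_filtration P theta T F.
Hypothesis w_wiener : filtered_wiener_process P theta T F w.

Local Notation mu := (@lebesgue_measure R).

Lemma ler_norm_sum_sqrB N (x y : nat -> R) (l : R) : 0 < l ->
  `|\sum_(k < N) x k ^+ 2 - \sum_(k < N) y k ^+ 2| <=
  (1 + l^-1) * (\sum_(k < N) (y k - x k) ^+ 2) + l * \sum_(k < N) y k ^+ 2.
Proof.
move=> l0; rewrite -sumrB !mulr_sumr -big_split/=.
apply: le_trans (ler_norm_sum _ _ _) _; apply: ler_sum => k _.
exact: ler_norm_sqrB.
Qed.

Lemma simple_increment_on_refining_grid (S : @simple_process R d Omega) t N x k om :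
  is_grid theta t N x -> refines N x t S -> (k < N)%N ->
  (forall k, (k < sp_size S)%N -> sp_time S k <= sp_time S k.+1) ->
  simple_integral w S (x k.+1) om - simple_integral w S (x k) om =
  simple_fun S (x k.+1) om * (w (x k.+1) om - w (x k) om).
Proof.
move=> gx xS kN mono; have [_ _ inc] := gx.
rewrite (simple_integral_increment gx xS w om _ _ (ltW (inc _ kN)) mono)//.
- rewrite (bigD1 (Ordinal kN))//= inc// lexx mul1r big1 ?addr0// => i ik.
  have E1 : (x i.+1 <= x k) = (i < k)%N by apply: (grid_leE gx) => //; exact: ltnW.
  have E2 : (x i.+1 <= x k.+1) = (i <= k)%N by rewrite (grid_leE gx).
  rewrite ltNge E1 E2 -leqNgt -eqn_leq.
  move: ik; rewrite -val_eqE/= eq_sym => /negbTE ->.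
  by rewrite !mul0r.
- by exists k => //; exact: ltnW.
- by exists k.+1.
Qed.

(** A fixed simple process [S n0] near [H] has increments [c k] times Wiener increments on any grid
    through its breakpoints, whence the set [D]; its sum of squares is handled by
    [likely_quadratic_variation]. The increments of [M] are compared with it through a later [S m],
    chosen once the grid is known. *)
Lemma ito_quadratic_variation (H M : R -> Omega -> R) t e :
  ito_integral P theta T F w H M -> theta <= t -> t <= T -> 0 < e ->
  exists (D : seq R) (eta : R), [/\ {in D, forall z, theta <= z <= t}, 0 < eta &
    forall N x, is_grid theta t N x -> {in D, forall z, grid_point N x z} ->
      (forall k, (k < N)%N -> x k.+1 - x k < eta) ->
      likely P e (fun om => `|\sum_(k < N) (M (x k.+1) om - M (x k) om) ^+ 2 -
        fine (\int[mu]_(y in `[theta, t]) (H y om ^+ 2)%:E)| < e)].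
Proof.
move=> HM tht tT e0; have [mH _ _] := HM.
have thT := le_trans tht tT.
(* Seven exceptional sets share [e]: one each for [cL], [cn], [cM], [cQ], and three for [cI]. *)
pose e1 := e / 7; have e10 : 0 < e1 by rewrite divr_gt0.
have [L L0 cL] := likely_ito_norm_bounded HM thT e10.
pose C := 2 * 1 + 2 * L; have C0 : 0 <= C by rewrite /C; lra.
(* [l] and [kap] are the two weights of [ler_norm_sqrB]; [l] is small against [C + 1], which bounds
   the square sums of the increments of [S n0]. *)
pose l := e / (8 * (C + 1)).
have l0 : 0 < l by apply: divr_gt0 => //; lra.
have lC : l * (C + 1) = e / 8 by rewrite /l; field; rewrite gt_eqF//; lra.
pose kap := 1 + l^-1; have kap0 : 0 < kap by rewrite addr_gt0// invr_gt0.
pose e' := e / (32 * kap).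
have e'0 : 0 < e' by apply: divr_gt0 => //; lra.
have e'E : kap * e' = e / 32 by rewrite /e'; field; rewrite gt_eqF.
(* The three bounds serve, in order, the norm of [S n0], the comparison of the integrals of squares,
   and the probability in [likely_increments_close]. *)
pose delta := Num.min 1 (Num.min (e / (8 * kap)) (e1 * e' / 4)).
have delta0 : 0 < delta.
  rewrite /delta !lt_min ltr01/=; apply/andP; split; apply: divr_gt0 => //; first lra.
  exact: mulr_gt0.
have delta1 : delta <= 1 by rewrite ge_min lexx.
have delta2 : kap * delta <= e / 8.
  have : delta <= e / (8 * kap) by rewrite !ge_min lexx orbT.
  rewrite -(ler_pM2l kap0) => h; apply: le_trans h _.
  by rewrite -subr_ge0 (_ : _ - _ = 0)//; field; rewrite gt_eqF.
have delta3 : 4 * delta / e' <= e1.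
  have : delta <= e1 * e' / 4 by rewrite !ge_min lexx !orbT.
  by rewrite ler_pdivrMr//; lra.
have [S [adS limH limM]] := ito_integral_approximation HM.
have [n0 hn0] := limH _ _ delta0 e10.
have {}cn := hn0 n0 (leqnn n0).
have [K K0 SK] := simple_fun_sqr_bounded (adS n0).
have [_ Smono _ Smeas] := adS n0.
pose e2 := Num.min 1 (e / 8).
have e20 : 0 < e2 by rewrite lt_min ltr01 divr_gt0.
(* Makes the probability in [likely_quadratic_variation] at most [e1], as the squared steps sum to
   at most [eta * (t - theta)]; the added ones keep the denominator positive. *)
pose eta := e1 * e2 ^+ 2 / (60 * (K ^+ 2 + 1) * (t - theta + 1)).
have K20 := sqr_ge0 K.
have den0 : 0 < 60 * (K ^+ 2 + 1) * (t - theta + 1) by apply: mulr_gt0; lra.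
have eta0 : 0 < eta by apply: divr_gt0 => //; apply: mulr_gt0 => //; rewrite exprn_gt0.
exists [seq Num.min (sp_time (S n0) k) t | k <- iota 0 (sp_size (S n0)).+1], eta.
split => //.
  move=> z /mapP[k kI ->]; have [Srange _ _ _] := adS n0.
  move: kI; rewrite mem_iota/= add0n ltnS => /Srange.
  by rewrite in_itv/= => /andP[h _]; rewrite le_min h tht ge_min lexx orbT.
move=> N x gx Dx mesh.
have xS : refines N x t (S n0).
  by move=> k kS; apply: Dx; apply/mapP; exists k => //; rewrite mem_iota/= add0n ltnS.
have xT k : (k <= N)%N -> theta <= x k <= T.
  by move=> /(grid_range gx)/andP[-> h]/=; exact: le_trans tT.
have [x0 xN xinc] := gx.
(* The errors at the grid points are added over the [N] cells, so their size has to depend on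
   [N]. *)
pose a := Num.min 1 (e / (128 * kap * N.+1%:R)).
have a0 : 0 < a.
  by rewrite lt_min ltr01/=; apply: divr_gt0 => //; rewrite !mulr_gt0.
have a2 : kap * (8 * (N%:R * a ^+ 2)) <= e / 16.
  have aa : a ^+ 2 <= a.
    by rewrite expr2 -[leRHS]mulr1 ler_wpM2l ?(ltW a0)// ge_min lexx.
  have ae : a <= e / (128 * kap * N.+1%:R) by rewrite ge_min lexx orbT.
  have N0 : 0 <= N%:R :> R by [].
  have NS : 0 < N.+1%:R :> R by [].
  have h1 : kap * (8 * (N%:R * a ^+ 2)) <= kap * (8 * (N.+1%:R * (e / (128 * kap * N.+1%:R)))).
    apply: ler_wpM2l; first exact: ltW.
    apply: ler_wpM2l => //; apply: ler_pM => //; first exact: sqr_ge0.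
      by rewrite ler_nat.
    exact: le_trans ae.
  apply: le_trans h1 _; rewrite -subr_ge0 (_ : _ - _ = 0)//.
  by field; rewrite !gt_eqF.
have [m0 hm0] := limM N x a _ xT a0 e10.
pose m := maxn n0 m0.
have cm := hn0 m (leq_maxl _ _).
have cM := hm0 m (leq_maxr _ _).
have cI := likely_increments_close F_filtration w_wiener (adS m) (adS n0) tht tT
  gx delta0 e'0 mH cm cn.
pose c k om := simple_fun (S n0) (x k.+1) om.
have mc k : (k < N)%N -> sub_measurable (F (x k)) (c k).
  exact: (simple_fun_grid_adapted F_filtration (adS n0) tT gx xS).
have mc2 k : (k < N)%N -> sub_measurable (F (x k)) (fun om => c k om ^+ 2).
  move=> kN; apply: (sub_measurable_comp _ (f := fun z => z ^+ 2)) => //.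
    by apply: (filtration_sigma_algebra F_filtration); rewrite in_itv/= xT// ltnW.
  exact: mc.
have Kc k om : (k < N)%N -> (c k om ^+ 2) ^+ 2 <= K ^+ 2.
  by move=> kN; rewrite ler_sqr ?nnegrE ?sqr_ge0//; exact: SK.
have cQ := likely_quadratic_variation F_filtration w_wiener xT xinc e20 mc2 Kc.
have sumD : \sum_(k < N) (x k.+1 - x k) ^+ 2 <= eta * (t - theta).
  have -> : t - theta = \sum_(k < N) (x k.+1 - x k).
    by rewrite -x0 -xN -(telescope_sumr x (leq0n N)) big_mkord.
  rewrite mulr_sumr; apply: ler_sum => k _.
  have := mesh _ (ltn_ord k); have := xinc _ (ltn_ord k) => h1 h2.
  by rewrite expr2 ler_wpM2r ?subr_ge0 ?ltW.
have {}cQ : likely P e1 (fun om =>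
    `|\sum_(k < N) c k om ^+ 2 * ((w (x k.+1) om - w (x k) om) ^+ 2 - (x k.+1 - x k))|
      < e2).
  apply: likelyW cQ; rewrite ler_pdivrMr ?exprn_gt0//.
  apply: (@le_trans _ _ (60 * K ^+ 2 * (eta * (t - theta)))).
    by apply: ler_wpM2l => //; apply: mulr_ge0.
  have E0 : eta * (60 * (K ^+ 2 + 1) * (t - theta + 1)) = e1 * e2 ^+ 2.
    by rewrite /eta; field; rewrite !gt_eqF//; clear -F_filtration w_wiener K20 tht; lra.
  rewrite -E0 (_ : 60 * K ^+ 2 * _ = eta * (60 * K ^+ 2 * (t - theta))); last ring.
  rewrite ler_wpM2l ?(ltW eta0)//.
  have tt0 : 0 <= t - theta by rewrite subr_ge0.
  by clear -F_filtration w_wiener K20 tt0; nra.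
have := likely_and (likely_ae mH) (likely_and cL (likely_and cn
  (likely_and cI (likely_and cM cQ)))).
move=> big; apply: (likely_sub _ (likelyW _ big)); last by rewrite /e1 in delta3 *; clear -F_filtration w_wiener delta3; lra.
move=> om [mHom [HL [HnH [hI [hM hQ]]]]].
have mHt : measurable_fun `[theta, t] (H^~ om).
  apply: measurable_funS mHom => //.
  by move=> y /=; rewrite !in_itv/= => /andP[->] /le_trans; apply.
have mS n (D : set R) := @measurable_simple_fun _ _ _ (S n) D om.
have subI (g : R -> R) (B : R) : measurable_fun `[theta, T] g -> (forall y, 0 <= g y) ->
    (\int[mu]_(y in `[theta, T]) (g y)%:E <= B%:E)%E ->
    (\int[mu]_(y in `[theta, t]) (g y)%:E <= B%:E)%E.
  move=> mg g0; apply: le_trans; apply: ge0_subset_integral => //.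
  - by apply/measurable_EFinP; exact: mg.
  - by move=> y _; rewrite lee_fin.
  - by move=> y /=; rewrite !in_itv/= => /andP[->] /le_trans; apply.
have {}HL : (\int[mu]_(y in `[theta, t]) (H y om ^+ 2)%:E <= L%:E)%E.
  by apply: (subI _ _ _ _ HL) => [|y]; [exact: measurable_funX|exact: sqr_ge0].
have {}HnH : (\int[mu]_(y in `[theta, t])
    ((simple_fun (S n0) y om - H y om) ^+ 2)%:E <= delta%:E)%E.
  apply: (subI (fun y => (simple_fun (S n0) y om - H y om) ^+ 2) _ _ _ (ltW HnH)).
    by apply: measurable_funX; exact: measurable_funB.
  by move=> y; exact: sqr_ge0.
have SC : (\int[mu]_(y in `[theta, t]) (simple_fun (S n0) y om ^+ 2)%:E <= C%:E)%E.
  have h : (\int[mu]_(y in `[theta, t]) (simple_fun (S n0) y om ^+ 2)%:E <=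
      (2 * delta + 2 * L)%:E)%E.
    apply: (@lebesgue_integral_le_lin2 _ _ _ _
      (fun y => (simple_fun (S n0) y om - H y om) ^+ 2) (fun y => H y om ^+ 2)) => //.
    - exact: measurable_funX.
    - by apply: measurable_funX; exact: measurable_funB.
    - exact: measurable_funX.
    - by move=> y _; rewrite sqr_ge0.
    - by move=> y _; rewrite sqr_ge0.
    - by move=> y _; rewrite sqr_ge0.
    - move=> y _; have := sqr_ge0 (simple_fun (S n0) y om - 2 * H y om); clear -F_filtration w_wiener; nra.
  by apply: le_trans h _; rewrite lee_fin /C; clear -F_filtration w_wiener delta1; lra.
have mD : measurable (`[theta, t]%classic : set R) by [].
have [_ hclose] := lebesgue_integral_sqr_close mD mHt (mS n0 _) l0 SC HnH.
have SE : (\int[mu]_(y in `[theta, t]) (simple_fun (S n0) y om ^+ 2)%:E =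
    (\sum_(k < N) c k om ^+ 2 * (x k.+1 - x k))%:E)%E.
  rewrite (stepwise_integral gx)// => [y|i y ni ry]; first exact: sqr_ge0.
  by rewrite (simple_fun_stepwise gx xS om ni ry).
rewrite SE /= in hclose; rewrite SE lee_fin in SC.
(* Increments of the limit ([al]), of the fixed approximation ([be]) and of the late one ([ga]),
   which links the other two. *)
pose al k := M (x k.+1) om - M (x k) om.
pose be k := simple_integral w (S n0) (x k.+1) om - simple_integral w (S n0) (x k) om.
pose ga k := simple_integral w (S m) (x k.+1) om - simple_integral w (S m) (x k) om.
have beE k : (k < N)%N -> be k = c k om * (w (x k.+1) om - w (x k) om).
  by move=> kN; exact: (simple_increment_on_refining_grid om gx xS kN Smono).
have sbe : \sum_(k < N) be k ^+ 2 = \sum_(k < N) c k om ^+ 2 * (x k.+1 - x k) +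
    \sum_(k < N) c k om ^+ 2 * ((w (x k.+1) om - w (x k) om) ^+ 2 - (x k.+1 - x k)).
  by rewrite -big_split/=; apply: eq_bigr => k _; rewrite beE//; ring.
have e21 : e2 <= 1 by rewrite ge_min lexx.
have e28 : e2 <= e / 8 by rewrite ge_min lexx orbT.
have sab : \sum_(k < N) (be k - al k) ^+ 2 <= 2 * e' + 8 * (N%:R * a ^+ 2).
  (* (be - al)^2 <= 2 (ga - be)^2 + 2 (ga - al)^2, where [ga] and [al] differ by at most [a] at each
     end of the cell. *)
  apply: (@le_trans _ _ (\sum_(k < N) (2 * (ga k - be k) ^+ 2 + 8 * a ^+ 2))).
    apply: ler_sum => k _.
    have g2 : `|ga k - al k| <= 2 * a.
      have h1 := hM _ (ltn_ord k : (k.+1 < N.+1)%N).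
      have h2 := hM _ (ltnW (ltn_ord k : (k.+1 < N.+1)%N)).
      rewrite (_ : ga k - al k =
        (simple_integral w (S m) (x k.+1) om - M (x k.+1) om) -
        (simple_integral w (S m) (x k) om - M (x k) om)); last by rewrite /ga /al; ring.
      by apply: le_trans (ler_normB _ _) _; clear -F_filtration w_wiener h1 h2; lra.
    have g3 : (ga k - al k) ^+ 2 <= 4 * a ^+ 2.
      rewrite -real_normK ?num_real// (_ : 4 * a ^+ 2 = (2 * a) ^+ 2); last ring.
      by rewrite ler_sqr// nnegrE mulr_ge0// ltW.
    by have := sqr_ge0 (2 * ga k - be k - al k); clear -F_filtration w_wiener g3; nra.
  rewrite big_split/= -mulr_sumr sumr_const card_ord -mulr_natl.
  by have := ltW hI; rewrite -/ga -/be; clear -F_filtration w_wiener; lra.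
have := ler_norm_sum_sqrB N al be l0 => hab.
have B1 : kap * \sum_(k < N) (be k - al k) ^+ 2 <= e / 8.
  apply: (@le_trans _ _ (kap * (2 * e' + 8 * (N%:R * a ^+ 2)))).
    by rewrite ler_wpM2l// ltW.
  by clear -F_filtration w_wiener a2 e'E; lra.
have B2 : l * \sum_(k < N) be k ^+ 2 <= e / 8.
  rewrite -lC ler_wpM2l ?(ltW l0)// sbe; move: hQ; rewrite ltr_norml; clear -F_filtration w_wiener SC e21; lra.
have B3 : l * C <= e / 8.
  by rewrite -lC ler_wpM2l ?(ltW l0)// lerDl.
move: hab hclose hQ; rewrite -/kap -/al.
set A1 := \sum_(k < N) al k ^+ 2; set A2 := \sum_(k < N) be k ^+ 2 in sbe B2 *.
rewrite !ler_norml !ltr_norml; clear -F_filtration w_wiener sbe B1 B2 B3 delta2 e28 e0; lra.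
Qed.

End quadratic_variation.

(** * Moduli of continuity, for one path and with high probability *)

Section uniform_modulus.
Context {R : realType}.
Implicit Types (a b : R) (X : R -> R).

Lemma within_continuous_modulus_at a b X x (e : R) :
  {within `[a, b], continuous X} -> a <= x <= b -> 0 < e ->
  exists2 r : R, 0 < r & forall z, a <= z <= b -> `|z - x| < r -> `|X z - X x| < e.
Proof.
move=> /subspace_continuousP cX xab e0.
have /cvgrPdist_lt/(_ _ e0) := cX x xab.
rewrite /= near_withinE => /nbhs_ballP[r /= r0 h]; exists r => // z zab zr.
by rewrite distrC; apply: h; rewrite /ball/= 1?distrC.
Qed.

Lemma within_continuous_modulus a b X (e : R) :
  {within `[a, b], continuous X} -> 0 < e ->
  exists2 m : R, 0 < m & forall s t, a <= s <= b -> a <= t <= b ->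
    `|s - t| < m -> `|X s - X t| < e.
Proof.
move=> cX e0.
have /compact_near_coveringP cab := @segment_compact R a b.
have e20 : 0 < e / 2 by rewrite divr_gt0.
pose Q (m s : R) := a <= s <= b -> forall t, a <= t <= b ->
  `|s - t| < m -> `|X s - X t| < e.
have : \forall m \near 0^'+, `[a, b] `<=` Q m.
  apply: cab => x; rewrite /= in_itv/= => xab.
  have [r r0 Xr] := within_continuous_modulus_at cX xab e20.
  have r20 : 0 < r / 2 by rewrite divr_gt0.
  exists (ball x (r / 2), [set m | m < r / 2]) => /=.
    by split; [exact: nbhsx_ballx|exact: nbhs_right_lt].
  move=> [s m] [/= xs mr] sab t tab st.
  have h1 : `|X s - X x| < e / 2.
    by apply: Xr => //; move: xs; rewrite /ball/= distrC; lra.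
  have h2 : `|X t - X x| < e / 2.
    apply: Xr => //; rewrite (_ : t - x = (t - s) + (s - x)); last ring.
    apply: le_lt_trans (ler_normD _ _) _.
    by move: xs; rewrite /ball/= distrC (distrC t s); lra.
  rewrite (_ : X s - X t = (X s - X x) - (X t - X x)); last ring.
  by apply: le_lt_trans (ler_normB _ _) _; lra.
move=> h; have : \forall m \near 0^'+, 0 < m /\ `[a, b] `<=` Q m.
  by near=> m; split; near: m => //; exact: nbhs_right_gt.
move=> /filter_ex[m [m0 Qm]]; exists m => // s t sab tab.
by apply: Qm => //=; rewrite in_itv.
Unshelve. all: by end_near. Qed.

End uniform_modulus.

Lemma clamp_contract {R : realDomainType} (a b x y : R) : a <= y <= b ->
  `|Num.max a (Num.min b x) - y| <= `|x - y|.
Proof.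
move=> /andP[ay yb]; have [bx|xb] := leP b x.
  rewrite max_r ?(le_trans ay)// !ger0_norm ?subr_ge0// ?lerD2r//.
  exact: le_trans bx.
have [ax|xa] := leP a x; first by [].
rewrite !ler0_norm ?subr_le0// ?lerN2 ?lerD2r ?(ltW xa)//.
exact: le_trans (ltW xa) _.
Qed.

Section likely_modulus.
Context {R : realType} {d : measure_display} {Omega : measurableType d}.
Variable P : probability Omega R.

(** The complements decrease to a null set, so their probabilities tend to 0. *)
Lemma likely_nondecreasing (E : nat -> set Omega) (e : R) :
  (forall m, measurable (E m)) -> (forall m, E m `<=` E m.+1) ->
  {ae P, forall om, exists m, E m om} -> 0 < e ->
  exists m, likely P e (E m).
Proof.
move=> mE subE [N [mN PN NE]] e0.
pose A m := ~` E m.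
have mA m : measurable (A m) by exact: measurableC.
have PA0 : P (\bigcap_m A m) = 0%E.
  apply/eqP; rewrite eq_le measure_ge0 andbT -PN le_measure ?inE//.
    exact: bigcapT_measurable.
  by move=> om h; apply: NE => -[m Em]; exact: (h m I).
have : P (A m) @[m --> \oo] --> P (\bigcap_m A m).
  apply: nonincreasing_cvg_mu => //.
  - by rewrite (le_lt_trans (probability_le1 _ (mA 0%N)))// ltry.
  - exact: bigcapT_measurable.
  - by apply/nonincreasing_seqP => m; apply/subsetPset/subsetC; exact: subE.
rewrite PA0 => /fine_cvgP[_ /cvgrPdist_lt/(_ _ e0)[m _ h]].
exists m, (A m); split => //; last by move=> om /contrapT.
have := h m (leqnn m); rewrite /= sub0r normrN ger0_norm ?fine_ge0// => /ltW.
by rewrite -lee_fin fineK// fin_num_measure.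
Qed.

(** Each path has its own modulus; outside a small set one modulus serves all. To have measurable
    events, the condition is imposed on countably many times and extended by density, which is why
    the conclusion is a weak inequality. *)
Lemma likely_uniform_modulus (theta T : R) (X : R -> Omega -> R) (a e : R) :
  theta <= T -> (forall t, theta <= t <= T -> measurable_fun setT (X t)) ->
  {ae P, forall om, {within `[theta, T], continuous X^~ om}} ->
  0 < a -> 0 < e ->
  exists2 m : R, 0 < m & likely P e (fun om => forall s t,
    theta <= s <= T -> theta <= t <= T -> `|s - t| < m ->
    `|X s om - X t om| <= a).
Proof.
move=> thT mX cX a0 e0.
(* Clamped rationals always lie in the interval and approximate each of its points, the ends
   included. *)
pose cl (q : rat) := Num.max theta (Num.min T (ratr q)).
have clT q : theta <= cl q <= T by rewrite le_max lexx/= ge_max thT ge_min lexx.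
pose E1 m (pq : rat * rat) := if `|cl pq.1 - cl pq.2| < m.+1%:R^-1 then
  [set om | `|X (cl pq.1) om - X (cl pq.2) om| <= a] else setT.
(* The default pair is harmless: its two times coincide, so its condition always holds. *)
pose pq k := odflt (0, 0) (unpickle k : option (rat * rat)).
pose E m := \bigcap_k E1 m (pq k).
have mE1 m p : measurable (E1 m p).
  rewrite /E1; case: ifPn => // _.
  rewrite (_ : [set om | _] =
    (fun om => `|X (cl p.1) om - X (cl p.2) om|) @^-1` `]-oo, a]); last first.
    by apply/seteqP; split => om /=; rewrite in_itv.
  rewrite -[X in measurable X]setTI.
  have : measurable_fun setT (fun om => `|X (cl p.1) om - X (cl p.2) om|).
    by apply: measurableT_comp => //; apply: measurable_funB; exact: mX.
  by apply.
have mE m : measurable (E m) by exact: bigcapT_measurable.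
have subE m : E m `<=` E m.+1.
  move=> om Em k _; have := Em k I; rewrite /E1.
  case: (ltP _ m.+2%:R^-1) => // h; rewrite (lt_le_trans h)//.
  by rewrite lef_pV2 ?posrE// ler_nat.
have EP m om : E m om -> forall p q, `|cl p - cl q| < m.+1%:R^-1 ->
    `|X (cl p) om - X (cl q) om| <= a.
  move=> Em p q pqm; have := Em (pickle (p, q)) I.
  by rewrite /E1 /pq pickleK/= pqm.
have exE : {ae P, forall om, exists m, E m om}.
  apply: filterS cX => om /within_continuous_modulus /(_ a0)[r r0 hr].
  exists (Num.truncn r^-1) => k _; rewrite /E1; case: ifPn => //= h.
  apply/ltW/hr => //; apply: lt_trans h _.
  by rewrite invf_plt ?posrE// truncnS_gt.
have [m hm] := likely_nondecreasing mE subE exE e0.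
pose iv : R := m.+1%:R^-1.
exists iv; first by rewrite invr_gt0.
have := likely_and (likely_ae cX) hm; rewrite add0r; apply: likely_sub.
move=> om [cXom Em] s t sT tT st; apply/ler_addgt0Pr => b b0.
have b20 : 0 < b / 2 by rewrite divr_gt0.
have [r r0 hr] := within_continuous_modulus cXom b20.
(* Moving both times by less than [rho] keeps their distance below [iv]. *)
pose rho := Num.min r ((iv - `|s - t|) / 2).
have rho0 : 0 < rho by rewrite lt_min r0 divr_gt0// subr_gt0.
have approx (y : R) : theta <= y <= T -> exists p, `|cl p - y| < rho.
  move=> yT; have /rat_in_itvoo[p] : y - rho < y + rho by lra.
  rewrite in_itv/= => pI; exists p; apply: le_lt_trans (clamp_contract _ yT) _.
  by rewrite ltr_norml; lra.
have [p sp] := approx _ sT; have [q tq] := approx _ tT.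
have rr : rho <= r by rewrite ge_min lexx.
have rm : rho <= (iv - `|s - t|) / 2 by rewrite ge_min lexx orbT.
have h1 := hr _ _ (clT p) sT (lt_le_trans sp rr).
have h2 := hr _ _ (clT q) tT (lt_le_trans tq rr).
have h3 : `|X (cl p) om - X (cl q) om| <= a.
  apply: (EP m om Em); rewrite -/iv.
  rewrite (_ : cl p - cl q = (cl p - s) - (cl q - t) + (s - t)); last ring.
  apply: le_lt_trans (ler_normD _ _) _; have := ler_normB (cl p - s) (cl q - t).
  by lra.
rewrite (_ : X s om - X t om = (X (cl p) om - X (cl q) om) -
  ((X (cl p) om - X s om) - (X (cl q) om - X t om))); last ring.
apply: le_trans (ler_normB _ _) _.
by have := ler_normB (X (cl p) om - X s om) (X (cl q) om - X t om); lra.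
Qed.

End likely_modulus.

(** As [u * H + v * K = 0], the left-hand combination splits into the approximation errors [S - H],
    [S' - K] with bounded coefficients, and the freezing errors [uk - u], [vk - v] with coefficients
    [H], [K]. *)
Lemma sqr_cross_le {R : realFieldType} (a B uk vk u v S S' H K : R) :
  `|uk| <= B -> `|vk| <= B -> `|uk - u| <= a -> `|vk - v| <= a ->
  u * H + v * K = 0 ->
  (uk * S + vk * S') ^+ 2 <=
    4 * B ^+ 2 * ((S - H) ^+ 2 + (S' - K) ^+ 2) + 8 * a ^+ 2 * (H ^+ 2 + K ^+ 2).
Proof.
have sq (x b : R) : `|x| <= b -> x ^+ 2 <= b ^+ 2.
  move=> xb; rewrite -real_normK ?num_real// ler_sqr ?nnegrE//.
  exact: le_trans xb.
move=> /sq uB /sq vB /sq ua /sq va uv0.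
have -> : uk * S + vk * S' = uk * (S - H) + vk * (S' - K) +
    ((uk - u) * H + (vk - v) * K) by rewrite -[RHS]addr0 -uv0; ring.
have sq2 (x y : R) : (x + y) ^+ 2 <= 2 * (x ^+ 2 + y ^+ 2).
  by have := sqr_ge0 (x - y); lra.
apply: le_trans (sq2 _ _) _; rewrite mulrDr; apply: lerD.
  have := sq2 (uk * (S - H)) (vk * (S' - K)); rewrite !exprMn.
  have := ler_wpM2r (sqr_ge0 (S - H)) uB; have := ler_wpM2r (sqr_ge0 (S' - K)) vB.
  by lra.
have := sq2 ((uk - u) * H) ((vk - v) * K); rewrite !exprMn.
have := ler_wpM2r (sqr_ge0 H) ua; have := ler_wpM2r (sqr_ge0 K) va.
have := mulr_ge0 (sqr_ge0 a) (sqr_ge0 H); have := mulr_ge0 (sqr_ge0 a) (sqr_ge0 K).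
by lra.
Qed.

Section cross_variation.
Context {R : realType} {d : measure_display} {Omega : measurableType d}.
Variables (P : probability Omega R) (theta T : R).
Variables (F : R -> set (set Omega)) (w : R -> Omega -> R).
Hypothesis F_filtration : complete_filtration P theta T F.
Hypothesis w_wiener : filtered_wiener_process P theta T F w.

Local Notation mu := (@lebesgue_measure R).

(** Real random variables are finite everywhere, so the events where their sum of absolute values is
    at most [m] exhaust the space. *)
Lemma likely_bounded n (X : nat -> Omega -> R) (e : R) :
  (forall k, (k < n)%N -> measurable_fun setT (X k)) -> 0 < e ->
  exists2 B : R, 0 <= B & likely P e (fun om => forall k, (k < n)%N -> `|X k om| <= B).
Proof.
move=> mX e0; pose Y om := \sum_(k < n) `|X k om|.
have mY : measurable_fun setT Y.
  by apply: measurable_sum => k; apply: measurableT_comp => //; exact: mX.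
pose E m := Y @^-1` `]-oo, m%:R].
have mE m : measurable (E m).
  by rewrite -[X in measurable X]setTI; exact: mY.
have subE m : E m `<=` E m.+1.
  by move=> om; rewrite /E/= !in_itv/= => /le_trans; apply; rewrite ler_nat.
have exE : {ae P, forall om, exists m, E m om}.
  apply: aeW => om; exists (Num.truncn (Y om)).+1.
  by rewrite /E/= in_itv/=; exact/ltW/truncnS_gt.
have [m hm] := likely_nondecreasing mE subE exE e0.
exists m%:R => //; apply: likely_sub hm => om; rewrite /E/= in_itv/= => Ym k kn.
apply: le_trans Ym; rewrite /Y (bigD1 (Ordinal kn))//= lerDl.
exact: sumr_ge0.
Qed.

Lemma grid_locate a b N (x : nat -> R) y : is_grid a b N x -> a < y <= b ->
  exists2 k, (k < N)%N & x k < y <= x k.+1.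
Proof.
move=> gx /andP[ay yb]; have [xa xb inc] := gx; rewrite -{}xb in yb; rewrite -{}xa in ay.
elim: N yb {gx inc} => [|N ih] yb; first by move: (lt_le_trans ay yb); rewrite ltxx.
have [/ih[k kN h]|xy] := leP y (x N); last by exists N => //; rewrite xy.
by exists k => //; exact: leqW.
Qed.

Lemma simple_fun_on_grid a b N (x : nat -> R) (u : nat -> Omega -> R) y k om :
  is_grid a b N x -> (k < N)%N -> x k < y <= x k.+1 ->
  simple_fun (SimpleProcess N x u) y om = u k om.
Proof.
move=> gx kN /andP[xy yx]; rewrite /simple_fun/= (bigD1 (Ordinal kN))//=.
rewrite indicE mem_setE in_itv/= xy yx mulr1 big1 ?addr0// => i ik.
rewrite indicE mem_setE in_itv/=.
suff -> : (x i < y <= x i.+1) = false by rewrite mulr0.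
apply/negbTE/negP => /andP[h1 h2]; move: ik; rewrite -val_eqE/= => /eqP; apply.
apply/eqP; rewrite eqn_leq; apply/andP; split.
  rewrite leqNgt; apply/negP => ki.
  have := grid_le gx ki (ltnW (ltn_ord i)) => h.
  by have := le_lt_trans h h1; rewrite ltNge yx.
rewrite leqNgt; apply/negP => ik.
have := grid_le gx ik (ltnW kN) => h.
by have := le_lt_trans h xy; rewrite ltNge h2.
Qed.

Lemma ito_cross_variation (H M K M' u v : R -> Omega -> R) t e :
  ito_integral P theta T F w H M -> ito_integral P theta T F w K M' ->
  adapted theta T F u -> adapted theta T F v ->
  {ae P, forall om, {within `[theta, T], continuous u^~ om}} ->
  {ae P, forall om, {within `[theta, T], continuous v^~ om}} ->
  {ae P, forall om, forall s, theta <= s <= T -> u s om * H s om + v s om * K s om = 0} ->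
  theta <= t -> t <= T -> 0 < e ->
  exists2 eta : R, 0 < eta & forall N x, is_grid theta t N x ->
    (forall k, (k < N)%N -> x k.+1 - x k < eta) ->
    likely P e (fun om => `|\sum_(k < N) (u (x k) om * (M (x k.+1) om - M (x k) om) +
      v (x k) om * (M' (x k.+1) om - M' (x k) om))| < e).
Proof.
move=> HM KM adu adv cu cv uvHK tht tT e0.
have [mH _ _] := HM; have [mK _ _] := KM; have thT := le_trans tht tT.
have mad (X : R -> Omega -> R) : adapted theta T F X ->
    forall s, theta <= s <= T -> measurable_fun setT (X s).
  move=> adX s sT; have sI : s \in `[theta, T] by rewrite in_itv.
  move=> _ B mB; rewrite setTI.
  exact/(filtration_measurable F_filtration sI)/(adX s sI).
(* There are ten exceptional sets of positive probability bound; the almost sure facts cost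
   nothing. *)
pose e1 := e / 10; have e10 : 0 < e1 by rewrite divr_gt0.
have [L L0 cL] := likely_ito_norm_bounded HM thT e10.
have [L' L'0 cL'] := likely_ito_norm_bounded KM thT e10.
(* The square integral for which Chebyshev's inequality at level [e / 2] costs exactly [e1]. Half of
   it goes to the freezing errors ([al2]), half to the approximation errors ([dmE]). *)
pose delta := e1 * (e / 2) ^+ 2.
have e20 : 0 < (e / 2) ^+ 2 by rewrite exprn_gt0// divr_gt0.
have delta0 : 0 < delta by exact: mulr_gt0.
have deltaE : delta / (e / 2) ^+ 2 = e1 by rewrite /delta mulfK// gt_eqF.
have LL : 0 < L + L' + 1 by rewrite ltr_wpDl// addr_ge0.
pose al := Num.min 1 (delta / (16 * (L + L' + 1))).
have al0 : 0 < al by rewrite lt_min ltr01 divr_gt0// mulr_gt0.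
have al2 : 8 * al ^+ 2 * (L + L') <= delta / 2.
  have h1 : al ^+ 2 <= al by rewrite expr2 -[leRHS]mulr1 ler_wpM2l ?(ltW al0)// ge_min lexx.
  have h2 : al <= delta / (16 * (L + L' + 1)) by rewrite ge_min lexx orbT.
  have h3 : delta / (16 * (L + L' + 1)) * (L + L' + 1) = delta / 16.
    by field; rewrite gt_eqF.
  have h4 : al ^+ 2 * (L + L') <= al * (L + L' + 1).
    apply: ler_pM => //; rewrite ?sqr_ge0 ?addr_ge0// lerDl.
    exact: ler01.
  have h5 : al * (L + L' + 1) <= delta / 16 by rewrite -h3 ler_wpM2r// ltW.
  by clear -F_filtration w_wiener h4 h5; lra.
have [mu1 mu10 cmu] := likely_uniform_modulus thT (mad _ adu) cu al0 e10.
have [mv1 mv10 cmv] := likely_uniform_modulus thT (mad _ adv) cv al0 e10.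
exists (Num.min mu1 mv1); first by rewrite lt_min mu10.
move=> N x gx mesh.
have xT k : (k <= N)%N -> theta <= x k <= T.
  by move=> /(grid_range gx)/andP[-> h]/=; exact: le_trans tT.
have [x0 xN xinc] := gx.
have [B B0 cB] : exists2 B : R, 0 <= B & likely P e1 (fun om =>
    forall k, (k < N)%N -> `|u (x k) om| <= B /\ `|v (x k) om| <= B).
  pose X k om := `|u (x k) om| + `|v (x k) om|.
  have [|B B0 h] := @likely_bounded N X e1 _ e10.
    move=> k kN; apply: measurable_funD; apply: measurableT_comp => //.
      by apply: (mad _ adu); exact/xT/ltnW.
    by apply: (mad _ adv); exact/xT/ltnW.
  exists B => //; apply: likely_sub h => om h k /h; rewrite /X ger0_norm ?addr_ge0// => hk.
  split; apply: le_trans hk; rewrite ?lerDl ?lerDr//.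
have B20 := sqr_ge0 B.
have B21 : 0 < B ^+ 2 + 1 by rewrite ltr_wpDl.
have B1 : 0 < B + 1 by rewrite ltr_wpDl.
pose dm := delta / (16 * (B ^+ 2 + 1)).
have dm0 : 0 < dm by rewrite divr_gt0// mulr_gt0.
have dmE : 8 * B ^+ 2 * dm <= delta / 2.
  have h : dm * (16 * (B ^+ 2 + 1)) = delta by rewrite /dm mulfVK// gt_eqF// mulr_gt0.
  have dm0' := ltW dm0.
  by clear -F_filtration w_wiener h dm0'; lra.
pose a := e / (16 * N.+1%:R * (B + 1)).
have a0 : 0 < a by rewrite divr_gt0// !mulr_gt0.
have aE : 4 * (N%:R * (B * a)) <= e / 4.
  have h : a * (16 * N.+1%:R * (B + 1)) = e by rewrite /a mulfVK// gt_eqF// !mulr_gt0.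
  have h2 : N%:R * (B * a) <= N.+1%:R * ((B + 1) * a).
    apply: ler_pM; [by []|exact: mulr_ge0 B0 (ltW a0)|by rewrite ler_nat|].
    by apply: ler_wpM2r; [exact: ltW|rewrite lerDl].
  have h3 : N.+1%:R * ((B + 1) * a) = e / 16 by rewrite -[in RHS]h; field.
  by clear -F_filtration w_wiener h2 h3; lra.
have [S [adS limH limM]] := ito_integral_approximation HM.
have [S' [adS' limK limM']] := ito_integral_approximation KM.
have [n1 hn1] := limH _ _ dm0 e10; have [n2 hn2] := limK _ _ dm0 e10.
have [n3 hn3] := limM N x a _ xT a0 e10; have [n4 hn4] := limM' N x a _ xT a0 e10.
pose m := maxn (maxn n1 n2) (maxn n3 n4).
have cH : likely P e1 _ := hn1 m (leq_trans (leq_maxl _ _) (leq_maxl _ _)).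
have cK : likely P e1 _ := hn2 m (leq_trans (leq_maxr _ _) (leq_maxl _ _)).
have cM : likely P e1 _ := hn3 m (leq_trans (leq_maxl _ _) (leq_maxr _ _)).
have cM' : likely P e1 _ := hn4 m (leq_trans (leq_maxr _ _) (leq_maxr _ _)).
(* [u] and [v] frozen at the left ends. Their values need not be bounded, which the cut-off inside
   [likely_sum_sqr_blocks] allows. *)
pose U := SimpleProcess N x (fun k => u (x k)).
pose V := SimpleProcess N x (fun k => v (x k)).
pose pts := [seq x k | k <- iota 0 N.+1] ++
  ([seq Num.min (sp_time (S m) k) t | k <- iota 0 (sp_size (S m)).+1] ++
   [seq Num.min (sp_time (S' m) k) t | k <- iota 0 (sp_size (S' m)).+1]).
have minr (S0 : simple_process) k : simple_adapted theta T F S0 ->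
    k \in iota 0 (sp_size S0).+1 -> theta <= Num.min (sp_time S0 k) t <= t.
  move=> [Srange _ _ _]; rewrite mem_iota/= add0n ltnS => /Srange.
  by rewrite in_itv/= => /andP[h _]; rewrite le_min h tht ge_min lexx orbT.
have [n [r [gr pt]]] : exists n r, is_grid theta t n r /\
    {in pts, forall z, grid_point n r z}.
  apply: grid_through => // z; rewrite !mem_cat => /or3P[] /mapP[k kI ->].
  - by apply: (grid_range gx); rewrite mem_iota/= add0n ltnS in kI.
  - exact: minr kI.
  - exact: minr kI.
have px k : (k <= N)%N -> grid_point n r (x k).
  move=> kN; apply: pt; rewrite mem_cat; apply/orP; left; apply: map_f.
  by rewrite mem_iota/= add0n ltnS.
have rS : refines n r t (S m).
  move=> k kS; apply: pt; rewrite !mem_cat; apply/or3P; apply: Or32.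
  by apply/mapP; exists k => //; rewrite mem_iota/= add0n ltnS.
have rS' : refines n r t (S' m).
  move=> k kS; apply: pt; rewrite !mem_cat; apply/or3P; apply: Or33.
  by apply/mapP; exists k => //; rewrite mem_iota/= add0n ltnS.
have rU : refines n r t U.
  move=> k kN; rewrite min_l; first exact: px.
  by have /andP[] := grid_range gx kN.
have rV : refines n r t V by exact: rU.
have rT i : (i <= n)%N -> theta <= r i <= T.
  by move=> /(grid_range gr)/andP[-> h]/=; exact: le_trans tT.
have rinc : forall i, (i < n)%N -> r i < r i.+1 by case: gr.
have sF i : (i < n)%N -> sigma_algebra setT (F (r i)).
  by move=> ni; apply: (filtration_sigma_algebra F_filtration); rewrite in_itv/= rT// ltnW.
have Uad (X : R -> Omega -> R) i : adapted theta T F X -> (i < n)%N ->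
    refines n r t (SimpleProcess N x (fun k => X (x k))) ->
    sub_measurable (F (r i)) (simple_fun (SimpleProcess N x (fun k => X (x k))) (r i.+1)).
  move=> adX ni rX; apply: (simple_fun_adapted gr rX ni (sF i ni)) => /=.
    move=> k kN kr; have /andP[xk _] := xT _ (ltnW kN).
    apply: (filtration_mono F_filtration xk kr).
    by have /andP[] := rT _ (ltnW ni).
  by move=> k kN; apply: adX; rewrite in_itv/= xT// ltnW.
pose g i om := simple_fun U (r i.+1) om * simple_fun (S m) (r i.+1) om +
  simple_fun V (r i.+1) om * simple_fun (S' m) (r i.+1) om.
have mg i : (i < n)%N -> sub_measurable (F (r i)) (g i).
  move=> ni; apply: sub_measurableD; first exact: sF.
    apply: sub_measurableM; [exact: sF|exact: Uad|].
    exact: (simple_fun_grid_adapted F_filtration (adS m) tT gr rS).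
  apply: sub_measurableM; [exact: sF|exact: Uad|].
  exact: (simple_fun_grid_adapted F_filtration (adS' m) tT gr rS').
(* A single block made of all cells: here the square of the whole sum is needed, not a sum of
   squares. *)
have key := likely_sum_sqr_blocks (N := 1) (b := fun _ _ => true)
  F_filtration w_wiener rT rinc delta0 e20 mg.
have {}key : likely P e1 (fun om => \sum_(i < n) g i om ^+ 2 * (r i.+1 - r i) <= delta ->
    (\sum_(i < n) g i om * (w (r i.+1) om - w (r i) om)) ^+ 2 < (e / 2) ^+ 2).
  rewrite -deltaE; apply: likely_sub (key _); last first.
    by move=> i _; rewrite big_ord1.
  move=> om h /h; rewrite big_ord1.
  by under eq_bigr do rewrite mul1r.
have := likely_and (likely_and (likely_ae mH) (likely_and (likely_ae mK) (likely_ae uvHK)))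
 (likely_and cL (likely_and cL' (likely_and cmu (likely_and cmv (likely_and cB
 (likely_and cH (likely_and cK (likely_and cM (likely_and cM' key))))))))).
move=> big; apply: (likely_sub _ (likelyW _ big)); last first.
  by rewrite /e1; clear -F_filtration w_wiener; lra.
move=> om [[mHom [mKom uvom]] [HL [KL [mod_u [mod_v [uvB [HS [KS [hM [hM' keyom]]]]]]]]]].
have mS (D : set R) := @measurable_simple_fun _ _ _ (S m) D om.
have mS' (D : set R) := @measurable_simple_fun _ _ _ (S' m) D om.
have mU (D : set R) := @measurable_simple_fun _ _ _ U D om.
have mV (D : set R) := @measurable_simple_fun _ _ _ V D om.
have sub_t : (`[theta, t]%classic : set R) `<=` `[theta, T]%classic.
  by move=> y /=; rewrite !in_itv/= => /andP[->] /le_trans; apply.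
have mD : measurable (`[theta, t]%classic : set R) by [].
have mHt : measurable_fun `[theta, t] (H^~ om) by exact: measurable_funS mHom.
have mKt : measurable_fun `[theta, t] (K^~ om) by exact: measurable_funS mKom.
have subI (f : R -> R) (C : R) : measurable_fun `[theta, T] f -> (forall y, 0 <= f y) ->
    (\int[mu]_(y in `[theta, T]) (f y)%:E <= C%:E)%E ->
    (\int[mu]_(y in `[theta, t]) (f y)%:E <= C%:E)%E.
  move=> mf f0; apply: le_trans; apply: ge0_subset_integral => //.
  - by apply/measurable_EFinP; exact: mf.
  - by move=> y _; rewrite lee_fin.
have {}HL : (\int[mu]_(y in `[theta, t]) (H y om ^+ 2)%:E <= L%:E)%E.
  by apply: (subI _ _ _ _ HL) => [|y]; [exact: measurable_funX|exact: sqr_ge0].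
have {}KL : (\int[mu]_(y in `[theta, t]) (K y om ^+ 2)%:E <= L'%:E)%E.
  by apply: (subI _ _ _ _ KL) => [|y]; [exact: measurable_funX|exact: sqr_ge0].
have {}HS : (\int[mu]_(y in `[theta, t])
    ((simple_fun (S m) y om - H y om) ^+ 2)%:E <= dm%:E)%E.
  apply: (subI (fun y => (simple_fun (S m) y om - H y om) ^+ 2) _ _ _ (ltW HS)).
    by apply: measurable_funX; exact: measurable_funB.
  by move=> y; exact: sqr_ge0.
have {}KS : (\int[mu]_(y in `[theta, t])
    ((simple_fun (S' m) y om - K y om) ^+ 2)%:E <= dm%:E)%E.
  apply: (subI (fun y => (simple_fun (S' m) y om - K y om) ^+ 2) _ _ _ (ltW KS)).
    by apply: measurable_funX; exact: measurable_funB.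
  by move=> y; exact: sqr_ge0.
pose phi y := (simple_fun U y om * simple_fun (S m) y om +
  simple_fun V y om * simple_fun (S' m) y om) ^+ 2.
have phiE : (\int[mu]_(y in `[theta, t]) (phi y)%:E =
    (\sum_(i < n) g i om ^+ 2 * (r i.+1 - r i))%:E)%E.
  rewrite (stepwise_integral gr)// => [y|i y ni ry]; first exact: sqr_ge0.
  rewrite /phi (simple_fun_stepwise gr rS om ni ry) (simple_fun_stepwise gr rS' om ni ry).
  by rewrite (simple_fun_stepwise gr rU om ni ry) (simple_fun_stepwise gr rV om ni ry).
pose p1 y := (simple_fun (S m) y om - H y om) ^+ 2 + (simple_fun (S' m) y om - K y om) ^+ 2.
pose p2 y := H y om ^+ 2 + K y om ^+ 2.
have mp1 : measurable_fun `[theta, t] p1.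
  by apply: measurable_funD; apply: measurable_funX; exact: measurable_funB.
have mp2 : measurable_fun `[theta, t] p2.
  by apply: measurable_funD; exact: measurable_funX.
have p10 y : 0 <= p1 y by rewrite addr_ge0// sqr_ge0.
have p20 y : 0 <= p2 y by rewrite addr_ge0// sqr_ge0.
have c1 : 0 <= 4 * B ^+ 2 by exact: mulr_ge0.
have c2 : 0 <= 8 * al ^+ 2 by apply: mulr_ge0 => //; exact: sqr_ge0.
have phi_le y : theta <= y <= t -> phi y <= 4 * B ^+ 2 * p1 y + 8 * al ^+ 2 * p2 y.
  move=> yt; have yT : theta <= y <= T by move: (sub_t y); rewrite /= !in_itv/=; exact.
  have := uvom _ yT; have /andP[+ yt2] := yt.
  (* At [theta] all frozen functions vanish, their intervals being open on the left; every later
     time lies in a cell. *)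
  rewrite le_eqVlt => /predU1P[<- _|ty uv0].
    have E0 (X : nat -> Omega -> R) : simple_fun (SimpleProcess N x X) theta om = 0.
      rewrite /simple_fun/= big1// => i _; rewrite indicE mem_setE in_itv/=.
      by rewrite ltNge; have /andP[-> _] := xT _ (ltnW (ltn_ord i)); rewrite mulr0.
    by rewrite /phi !E0 !mul0r addr0 expr0n/=;
      exact: addr_ge0 (mulr_ge0 c1 (p10 _)) (mulr_ge0 c2 (p20 _)).
  have [|k kN xyx] := grid_locate gx (_ : theta < y <= t); first by rewrite ty.
  have /andP[xky yxk] := xyx.
  have dist : `|x k - y| < Num.min mu1 mv1.
    rewrite distrC ger0_norm ?subr_ge0 ?(ltW xky)//.
    by apply: le_lt_trans (mesh _ kN); rewrite lerD2r.
  move: dist; rewrite lt_min => /andP[du dv].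
  have hu := mod_u _ _ (xT _ (ltnW kN)) yT du.
  have hv := mod_v _ _ (xT _ (ltnW kN)) yT dv.
  have [uB vB] := uvB _ kN.
  rewrite /phi /p1 /p2 !(simple_fun_on_grid _ _ gx kN xyx).
  move: uB vB hu hv uv0; set uk := u (x k) om; set vk := v (x k) om.
  set uy := u y om; set vy := v y om; set Hm := simple_fun (S m) y om.
  set Km := simple_fun (S' m) y om; set Hy := H y om; set Ky := K y om.
  exact: sqr_cross_le.
have key_hyp : \sum_(i < n) g i om ^+ 2 * (r i.+1 - r i) <= delta.
  rewrite -lee_fin -phiE.
  have bound : 4 * B ^+ 2 * (1 * dm + 1 * dm) + 8 * al ^+ 2 * (1 * L + 1 * L') <= delta.
    by clear -F_filtration w_wiener dmE al2; lra.
  apply: (@le_trans _ _ (4 * B ^+ 2 * (1 * dm + 1 * dm) +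
      8 * al ^+ 2 * (1 * L + 1 * L'))%:E); last by rewrite lee_fin.
  apply: (@lebesgue_integral_le_lin2 _ _ _ _ p1 p2) => //.
  - apply: measurable_funX; apply: measurable_funD; exact: measurable_funM.
  - by move=> y _; exact: sqr_ge0.
  - apply: (@lebesgue_integral_le_lin2 _ _ _ _
      (fun y => (simple_fun (S m) y om - H y om) ^+ 2)
      (fun y => (simple_fun (S' m) y om - K y om) ^+ 2)) => //.
    + by apply: measurable_funX; exact: measurable_funB.
    + by apply: measurable_funX; exact: measurable_funB.
    + by move=> y _; rewrite sqr_ge0.
    + by move=> y _; rewrite sqr_ge0.
    + by move=> y _; rewrite !mul1r.
  - apply: (@lebesgue_integral_le_lin2 _ _ _ _
      (fun y => H y om ^+ 2) (fun y => K y om ^+ 2)) => //.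
    + exact: measurable_funX.
    + exact: measurable_funX.
    + by move=> y _; rewrite sqr_ge0.
    + by move=> y _; rewrite sqr_ge0.
    + by move=> y _; rewrite !mul1r.
pose ga k := simple_integral w (S m) (x k.+1) om - simple_integral w (S m) (x k) om.
pose ga' k := simple_integral w (S' m) (x k.+1) om - simple_integral w (S' m) (x k) om.
have sumE : \sum_(i < n) g i om * (w (r i.+1) om - w (r i) om) =
    \sum_(k < N) (u (x k) om * ga k + v (x k) om * ga' k).
  have E (Y : R -> Omega -> R) (S0 : simple_process) : simple_adapted theta T F S0 ->
      refines n r t S0 ->
      \sum_(i < n) simple_fun (SimpleProcess N x (fun k => Y (x k))) (r i.+1) om *
        simple_fun S0 (r i.+1) om * (w (r i.+1) om - w (r i) om) =
      \sum_(k < N) Y (x k) om *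
        (simple_integral w S0 (x k.+1) om - simple_integral w S0 (x k) om).
    move=> [_ mono _ _] rS0.
    under [RHS]eq_bigr => k _.
      rewrite (simple_integral_increment gr rS0 w om (px _ (ltnW (ltn_ord k)))
        (px _ (ltn_ord k)) (ltW (xinc _ (ltn_ord k))) mono) mulr_sumr; over.
    rewrite exchange_big/=; apply: eq_bigr => i _.
    rewrite /simple_fun/= !mulr_suml; apply: eq_bigr => k _.
    by rewrite indicE mem_setE in_itv/= !mulrA.
  rewrite big_split/= -!E// -big_split/=; apply: eq_bigr => i _.
  by rewrite /g mulrDl.
have /(_ key_hyp) := keyom; rewrite sumE => h1.
have {}h1 : `|\sum_(k < N) (u (x k) om * ga k + v (x k) om * ga' k)| < e / 2.
  by rewrite -ltr_sqr ?nnegrE ?divr_ge0 ?(ltW e0)// real_normK ?num_real.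
(* Each cell contributes two coefficients bounded by [B] and, for each, errors below [a] at two
   ends. *)
have h2 : `|\sum_(k < N) (u (x k) om * (M (x k.+1) om - M (x k) om) +
    v (x k) om * (M' (x k.+1) om - M' (x k) om)) -
    \sum_(k < N) (u (x k) om * ga k + v (x k) om * ga' k)| <= 4 * (N%:R * (B * a)).
  rewrite -sumrB; apply: le_trans (ler_norm_sum _ _ _) _.
  rewrite mulrCA -[X in X%:R * _]card_ord mulr_natl -sumr_const.
  apply: ler_sum => k _; have [uB vB] := uvB _ (ltn_ord k).
  have d1 := hM _ (ltn_ord k : (k.+1 < N.+1)%N).
  have d2 := hM _ (ltnW (ltn_ord k : (k.+1 < N.+1)%N)).
  have d3 := hM' _ (ltn_ord k : (k.+1 < N.+1)%N).
  have d4 := hM' _ (ltnW (ltn_ord k : (k.+1 < N.+1)%N)).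
  rewrite (_ : _ - _ =
    - (u (x k) om * ((simple_integral w (S m) (x k.+1) om - M (x k.+1) om) -
                   (simple_integral w (S m) (x k) om - M (x k) om))
    + v (x k) om * ((simple_integral w (S' m) (x k.+1) om - M' (x k.+1) om) -
                   (simple_integral w (S' m) (x k) om - M' (x k) om)))); last first.
    by rewrite /ga /ga'; ring.
  have two (c z1 z2 : R) : `|c| <= B -> `|z1| < a -> `|z2| < a -> `|c * (z1 - z2)| <= 2 * (B * a).
    move=> cB' z1a z2a; rewrite normrM (_ : 2 * (B * a) = B * (2 * a)); last ring.
    apply: ler_pM => //; apply: le_trans (ler_normB _ _) _.
    by clear -F_filtration w_wiener z1a z2a; lra.
  rewrite normrN; apply: le_trans (ler_normD _ _) _.
  have := two _ _ _ uB d1 d2; have := two _ _ _ vB d3 d4.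
  by clear; lra.
move: h1 h2 aE; set A1 := \sum_(k < N) _; set A2 := \sum_(k < N) _.
move=> h1 h2 aE; rewrite -[X in `|X|](subrK A1); apply: le_lt_trans (ler_normD _ _) _.
by clear -F_filtration w_wiener h1 h2 aE e0; lra.
Qed.

End cross_variation.

(** * Pathwise argument *)

Section ae_likely.
Context {R : realType} {d : measure_display} {Omega : measurableType d}.
Variable P : probability Omega R.

(** The exceptional sets for the tolerances 1/(k+1) intersect in a null set, outside which [Q]
    holds. *)
Lemma ae_of_likely (Q : Omega -> Prop) :
  (forall e : R, 0 < e -> likely P e Q) -> {ae P, forall om, Q om}.
Proof.
move=> h; have /choice[A hA] : forall k : nat, exists A : set Omega,
    [/\ measurable A, (P A <= k.+1%:R^-1%:E)%E & forall w, ~ A w -> Q w].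
  by move=> k; apply: h; rewrite invr_gt0.
exists (\bigcap_k A k); split.
- by apply: bigcapT_measurable => k; case: (hA k).
- apply/eqP; rewrite eq_le measure_ge0 andbT; apply/lee_addgt0Pr => e e0.
  rewrite add0e; pose k := Num.truncn e^-1.
  apply: (@le_trans _ _ (P (A k))).
    apply: le_measure; rewrite ?inE.
    + by apply: bigcapT_measurable => j; case: (hA j).
    + by case: (hA k).
    + by move=> om; exact.
  have [_ PA _] := hA k; apply: le_trans PA _; rewrite lee_fin.
  by rewrite invf_ple ?posrE//; exact/ltW/truncnS_gt.
- move=> om /= nQ k _; apply: contrapT => nA.
  by have [_ _ /(_ _ nA)] := hA k.
Qed.

End ae_likely.

Lemma lebesgue_integrable_lin {R : realType} (D : set R) (f g : R -> R) (c1 c2 : R) :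
  measurable D ->
  lebesgue_measure.-integrable D (EFin \o f) ->
  lebesgue_measure.-integrable D (EFin \o g) ->
  lebesgue_measure.-integrable D (EFin \o (fun x => c1 * f x + c2 * g x)).
Proof.
move=> mD fi gi; have mD' : @measurable _ (measurableTypeR R) D := mD.
have := integrableD mD' (integrableZl mD' c1 fi) (integrableZl mD' c2 gi).
by apply: eq_integrable.
Qed.

Lemma lebesgue_integrable_norm {R : realType} (D : set R) (f : R -> R) :
  measurable D ->
  lebesgue_measure.-integrable D (EFin \o f) ->
  lebesgue_measure.-integrable D (EFin \o (fun x => `|f x|)).
Proof.
move=> mD fi; have mD' : @measurable _ (measurableTypeR R) D := mD.
by have := integrable_norm fi; apply: eq_integrable.
Qed.

Section cumulative_integral.
Context {R : realType}.
Variables a b : R.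
Local Notation mu := (@lebesgue_measure R).
Local Notation I f s := (\int[mu]_(x in `[a, s]) f x).
Implicit Types (f g : R -> R) (s t : R).

Let sub_ab s t : a <= s -> t <= b -> (`]s, t]%classic : set R) `<=` `[a, b]%classic.
Proof.
move=> sa tb x /=; rewrite !in_itv/= => /andP[h1 h2].
by rewrite (le_trans sa (ltW h1)) (le_trans h2 tb).
Qed.

Let sub_ab' t : t <= b -> (`[a, t]%classic : set R) `<=` `[a, b]%classic.
Proof.
by move=> tb x /=; rewrite !in_itv/= => /andP[-> /le_trans]; apply.
Qed.

Lemma cumulative_increment f s t : a <= s -> s <= t -> t <= b ->
  mu.-integrable `[a, b] (EFin \o f) ->
  I f t - I f s = \int[mu]_(x in `]s, t]) f x.
Proof.
move=> sa st tb fi; rewrite (Rintegral_itvB (a := BLeft a) (b := BRight t))//.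
apply: integrableS fi => //; exact: sub_ab'.
Qed.

Lemma cumulative_increment_le f g s t : a <= s -> s <= t -> t <= b ->
  mu.-integrable `[a, b] (EFin \o f) -> mu.-integrable `[a, b] (EFin \o g) ->
  (forall x, s < x <= t -> `|f x| <= g x) ->
  `|I f t - I f s| <= I g t - I g s.
Proof.
move=> sa st tb fi gi fg; rewrite !cumulative_increment//.
have fi' : mu.-integrable `]s, t] (EFin \o f).
  by apply: integrableS fi => //; exact: sub_ab.
have gi' : mu.-integrable `]s, t] (EFin \o g).
  by apply: integrableS gi => //; exact: sub_ab.
apply: le_trans (le_normr_Rintegral _ fi') _ => //.
apply: le_Rintegral => //.
exact: lebesgue_integrable_norm.
Qed.

Lemma cumulative_lin f g (c1 c2 : R) t : t <= b ->
  mu.-integrable `[a, b] (EFin \o f) -> mu.-integrable `[a, b] (EFin \o g) ->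
  I (fun x => c1 * f x + c2 * g x) t = c1 * I f t + c2 * I g t.
Proof.
move=> tb fi gi.
have fi' : mu.-integrable `[a, t] (EFin \o f) by apply: integrableS fi => //; exact: sub_ab'.
have gi' : mu.-integrable `[a, t] (EFin \o g) by apply: integrableS gi => //; exact: sub_ab'.
have scaled (k : R -> R) (c : R) : mu.-integrable `[a, t] (EFin \o k) ->
    mu.-integrable `[a, t] (EFin \o (fun x => c * k x)).
  move=> ki; have := @lebesgue_integrable_lin _ _ k k c 0 (measurable_itv _) ki ki.
  by rewrite (_ : (fun x => c * k x + 0 * k x) = (fun x => c * k x))//;
    apply/funext => x; rewrite mul0r addr0.
by rewrite RintegralD ?RintegralZl//; exact: scaled.
Qed.

Lemma cumulative_start f : I f a = 0.
Proof. by rewrite set_itv1 Rintegral_set1. Qed.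

End cumulative_integral.

Section pathwise.
Context {R : realType}.
Local Notation mu := (@lebesgue_measure R).

Lemma sum_grid_increments (theta t : R) N (x : nat -> R) (f : R -> R) :
  is_grid theta t N x -> \sum_(k < N) (f (x k.+1) - f (x k)) = f t - f theta.
Proof.
move=> [<- <- _]; have := telescope_sumr (f \o x) (leq0n N).
by rewrite big_mkord.
Qed.

(** Ito's formula for the squared modulus along one path. With dU = dA + dM and dV = dB + dM', all
    contributions of the drifts are bounded by [e] times the total mass [J] of |a| + |b|; the
    hypothesis on grids controls the rest. In the final constant, [6 * J] collects the drift terms,
    and 4 the doubled cross sum and the two quadratic variations. *)
Lemma sqr_sum_identity (theta t : R) (U V M M' a b : R -> R) (c c' : R) :
  {within `[theta, t], continuous U} -> {within `[theta, t], continuous V} ->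
  {within `[theta, t], continuous M} -> {within `[theta, t], continuous M'} ->
  mu.-integrable `[theta, t] (EFin \o a) -> mu.-integrable `[theta, t] (EFin \o b) ->
  (forall s, theta <= s <= t -> U s = U theta + \int[mu]_(r in `[theta, s]) a r + M s) ->
  (forall s, theta <= s <= t -> V s = V theta + \int[mu]_(r in `[theta, s]) b r + M' s) ->
  (forall s, theta <= s <= t -> U s * a s + V s * b s = 0) ->
  (forall e, 0 < e -> exists N x, [/\ is_grid theta t N x,
     forall k, (k < N)%N -> x k.+1 - x k < e,
     `|\sum_(k < N) (U (x k) * (M (x k.+1) - M (x k)) +
       V (x k) * (M' (x k.+1) - M' (x k)))| < e,
     `|\sum_(k < N) (M (x k.+1) - M (x k)) ^+ 2 - c| < e &
     `|\sum_(k < N) (M' (x k.+1) - M' (x k)) ^+ 2 - c'| < e]) ->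
  U t ^+ 2 + V t ^+ 2 = U theta ^+ 2 + V theta ^+ 2 + c + c'.
Proof.
move=> cU cV cM cM' ia ib UE VE ab0 grids.
pose A s := \int[mu]_(r in `[theta, s]) a r.
pose B s := \int[mu]_(r in `[theta, s]) b r.
pose g r := `|a r| + `|b r|.
have ia' : mu.-integrable `[theta, t] (EFin \o (fun r => `|a r|)).
  exact: lebesgue_integrable_norm.
have ib' : mu.-integrable `[theta, t] (EFin \o (fun r => `|b r|)).
  exact: lebesgue_integrable_norm.
have ig : mu.-integrable `[theta, t] (EFin \o g).
  have := lebesgue_integrable_lin 1 1 (measurable_itv _) ia' ib'.
  rewrite (_ : (fun x => 1 * `|a x| + 1 * `|b x|) = g)//.
  by apply/funext => x; rewrite !mul1r.
pose G s := \int[mu]_(r in `[theta, s]) g r.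
pose J := G t.
have J0 : 0 <= J by apply: Rintegral_ge0 => r _; rewrite addr_ge0.
suff key e : 0 < e < 1 ->
    `|U t ^+ 2 + V t ^+ 2 - (U theta ^+ 2 + V theta ^+ 2 + c + c')| <= (6 * J + 4) * e.
  apply/eqP; rewrite -subr_eq0 -normr_le0.
  by apply: (@ler_small _ _ _ (6 * J + 4)) => e e01; rewrite add0r; exact: key.
move=> /andP[e0 e1].
have [mU mU0 hU] := within_continuous_modulus cU e0.
have [mV mV0 hV] := within_continuous_modulus cV e0.
have [mM mM0 hM] := within_continuous_modulus cM e0.
have [mM' mM'0 hM'] := within_continuous_modulus cM' e0.
(* Below all four moduli, so that no path moves by [e] within a cell, and at most [e], so that the
   errors granted by [grids] are below [e]. *)
pose m := Num.min (Num.min mU mV) (Num.min (Num.min mM mM') e).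
have m0 : 0 < m by rewrite !lt_min mU0 mV0 mM0 mM'0.
have me : m <= e by rewrite !ge_min lexx !orbT.
have [N [x [gx mesh cross qM qM']]] := grids _ m0.
have [x0 xN xinc] := gx.
have xt k : (k <= N)%N -> theta <= x k <= t by move=> /(grid_range gx).
have close k r : (k < N)%N -> x k <= r <= x k.+1 ->
    [/\ `|U (x k) - U r| < e, `|V (x k) - V r| < e,
        `|M (x k) - M r| < e & `|M' (x k) - M' r| < e].
  move=> kN /andP[xr rx].
  have h1 := xt _ (ltnW kN); have h2 : theta <= r <= t.
    have /andP[h3 _] := h1; have /andP[_ h4] := xt _ kN.
    by rewrite (le_trans h3 xr) (le_trans rx h4).
  have : `|x k - r| < m.
    rewrite distrC ger0_norm ?subr_ge0//; apply: le_lt_trans (mesh _ kN).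
    by rewrite lerD2r.
  rewrite !lt_min => /and3P[/andP[d1 d2] /andP[d3 d4] _].
  by split; [exact: hU|exact: hV|exact: hM|exact: hM'].
have dG0 k : (k < N)%N -> 0 <= G (x k.+1) - G (x k).
  move=> kN; have /andP[h1 _] := xt _ (ltnW kN); have /andP[_ h2] := xt _ kN.
  rewrite (cumulative_increment h1 (ltW (xinc _ kN)) h2 ig).
  by apply: Rintegral_ge0 => r _; rewrite addr_ge0.
have sumG : \sum_(k < N) (G (x k.+1) - G (x k)) = J.
  by rewrite (sum_grid_increments G gx) /G cumulative_start subr0.
have dA k : (k < N)%N -> `|A (x k.+1) - A (x k)| <= G (x k.+1) - G (x k).
  move=> kN; have /andP[h1 _] := xt _ (ltnW kN); have /andP[_ h2] := xt _ kN.
  apply: (cumulative_increment_le h1 (ltW (xinc _ kN)) h2 ia ig) => r _.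
  by rewrite lerDl.
have dB k : (k < N)%N -> `|B (x k.+1) - B (x k)| <= G (x k.+1) - G (x k).
  move=> kN; have /andP[h1 _] := xt _ (ltnW kN); have /andP[_ h2] := xt _ kN.
  apply: (cumulative_increment_le h1 (ltW (xinc _ kN)) h2 ib ig) => r _.
  by rewrite lerDr.
(* The integrand [U (x k) * a + V (x k) * b] is small because it vanishes once the coefficients are
   unfrozen. *)
have dUV k : (k < N)%N ->
    `|U (x k) * (A (x k.+1) - A (x k)) + V (x k) * (B (x k.+1) - B (x k))| <=
    e * (G (x k.+1) - G (x k)).
  move=> kN; have /andP[h1 h1'] := xt _ (ltnW kN); have /andP[h2' h2] := xt _ kN.
  pose f r := U (x k) * a r + V (x k) * b r.
  have f_int : mu.-integrable `[theta, t] (EFin \o f).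
    exact: lebesgue_integrable_lin.
  have eg_int : mu.-integrable `[theta, t] (EFin \o (fun r => e * g r + 0 * g r)).
    exact: lebesgue_integrable_lin.
  have := cumulative_increment_le h1 (ltW (xinc _ kN)) h2 f_int eg_int.
  rewrite !(cumulative_lin _ _ _ ia ib)// !(cumulative_lin _ _ _ ig ig)//.
  rewrite -/(A _) -/(A _) -/(B _) -/(B _) -/(G _) -/(G _) => h.
  rewrite (_ : U (x k) * _ + _ = U (x k) * A (x k.+1) + V (x k) * B (x k.+1) -
    (U (x k) * A (x k) + V (x k) * B (x k))); last ring.
  rewrite (_ : e * _ = e * G (x k.+1) + 0 * G (x k.+1) - (e * G (x k) + 0 * G (x k)));
    last ring.
  apply: h => r /andP[xr rx].
  have xrx : x k <= r <= x k.+1 by rewrite (ltW xr).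
  have [du dv _ _] := close _ _ kN xrx.
  have rt : theta <= r <= t by rewrite (le_trans h1 (ltW xr)) (le_trans rx h2).
  rewrite (_ : f r = (U (x k) - U r) * a r + (V (x k) - V r) * b r); last first.
    by rewrite /f -[LHS]subr0 -(ab0 _ rt); ring.
  rewrite mul0r addr0 /g mulrDr; apply: le_trans (ler_normD _ _) _.
  by rewrite !normrM; apply: lerD; apply: ler_wpM2r => //; exact: ltW.
have dU k : (k <= N)%N -> U (x k) = U theta + A (x k) + M (x k).
  by move=> kN; exact: UE (xt _ kN).
have dV k : (k <= N)%N -> V (x k) = V theta + B (x k) + M' (x k).
  by move=> kN; exact: VE (xt _ kN).
(* What the drift adds to the squared increments: (dA + dM)^2 - dM^2 = dA (dU + dM), and likewise
   for [V]. *)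
pose rest k := (A (x k.+1) - A (x k)) * ((U (x k.+1) - U (x k)) + (M (x k.+1) - M (x k)))
  + (B (x k.+1) - B (x k)) * ((V (x k.+1) - V (x k)) + (M' (x k.+1) - M' (x k))).
have rest_le k : (k < N)%N -> `|rest k| <= 4 * e * (G (x k.+1) - G (x k)).
  move=> kN; have := close _ (x k.+1) kN; rewrite lexx (ltW (xinc _ kN)) => /(_ isT)[].
  rewrite ![`|_ (x k) - _|]distrC => d1 d2 d3 d4.
  apply: le_trans (ler_normD _ _) _; rewrite !normrM.
  rewrite (_ : 4 * e * _ = (G (x k.+1) - G (x k)) * (2 * e) +
    (G (x k.+1) - G (x k)) * (2 * e)); last ring.
  apply: lerD; apply: ler_pM => //; [exact: dA| |exact: dB|].
  - by apply: le_trans (ler_normD _ _) _; clear -d1 d3; lra.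
  - by apply: le_trans (ler_normD _ _) _; clear -d2 d4; lra.
have total : U t ^+ 2 + V t ^+ 2 - (U theta ^+ 2 + V theta ^+ 2) =
    2 * \sum_(k < N) (U (x k) * (A (x k.+1) - A (x k)) + V (x k) * (B (x k.+1) - B (x k)))
    + 2 * \sum_(k < N) (U (x k) * (M (x k.+1) - M (x k)) +
       V (x k) * (M' (x k.+1) - M' (x k)))
    + \sum_(k < N) (M (x k.+1) - M (x k)) ^+ 2
    + \sum_(k < N) (M' (x k.+1) - M' (x k)) ^+ 2 + \sum_(k < N) rest k.
  rewrite -(sum_grid_increments (fun s => U s ^+ 2 + V s ^+ 2) gx).
  rewrite !mulr_sumr -!big_split/=; apply: eq_bigr => k _.
  have h1 := dU _ (ltnW (ltn_ord k)); have h2 := dU _ (ltn_ord k).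
  have h3 := dV _ (ltnW (ltn_ord k)); have h4 := dV _ (ltn_ord k).
  by rewrite /rest h1 h2 h3 h4; ring.
have s1 : `|\sum_(k < N) (U (x k) * (A (x k.+1) - A (x k)) +
    V (x k) * (B (x k.+1) - B (x k)))| <= e * J.
  rewrite -sumG mulr_sumr; apply: le_trans (ler_norm_sum _ _ _) _.
  by apply: ler_sum => k _; exact: dUV.
have s2 : `|\sum_(k < N) rest k| <= 4 * e * J.
  rewrite -sumG mulr_sumr; apply: le_trans (ler_norm_sum _ _ _) _.
  by apply: ler_sum => k _; exact: rest_le.
have -> : U t ^+ 2 + V t ^+ 2 - (U theta ^+ 2 + V theta ^+ 2 + c + c') =
  (U t ^+ 2 + V t ^+ 2 - (U theta ^+ 2 + V theta ^+ 2)) - c - c' by ring.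
rewrite total; move: s1 s2 cross qM qM'.
set S1 := \sum_(k < N) _; set S2 := \sum_(k < N) _; set S3 := \sum_(k < N) _.
set S4 := \sum_(k < N) _; set S5 := \sum_(k < N) _ => s1 s2 s3 s4 s5.
move: s1 s2 s3 s4 s5; rewrite !ler_norml !ltr_norml.
by clear -me; nra.
Qed.

End pathwise.

(** * Logarithm of the solution of a linear integral equation *)

Section logarithmic_integration.
Context {R : realType}.
Variables a b : R.
Hypothesis ab : a <= b.
Local Notation mu := (@lebesgue_measure R).

(** Along a grid of mesh [e] the quadratic bounds add up to at most [D * (b - a) * e]. *)
Lemma constant_of_quadratic_increments (L : R -> R) (D : R) : 0 <= D ->
  (forall s t, a <= s -> s <= t -> t <= b -> `|L t - L s| <= D * (t - s) ^+ 2) ->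
  L b = L a.
Proof.
move=> D0 LD; apply/eqP; rewrite -subr_eq0 -normr_le0.
apply: (@ler_small _ _ _ (D * (b - a))) => e /andP[e0 _]; rewrite add0r.
have [n [x [gx _ mesh]]] := fine_grid_through (s := [::]) ab e0 (fun _ => ltac:(done)).
rewrite -(sum_grid_increments L gx) -(sum_grid_increments id gx) mulr_sumr mulr_suml.
apply: le_trans (ler_norm_sum _ _ _) _; apply: ler_sum => k _.
have [_ _ inc] := gx; have xk := inc _ (ltn_ord k).
have /andP[h1 _] := grid_range gx (ltnW (ltn_ord k)).
have /andP[_ h2] := grid_range gx (ltn_ord k).
apply: le_trans (LD _ _ h1 (ltW xk) h2) _.
rewrite expr2 mulrA ler_wpM2l//; last exact/ltW/mesh.
by rewrite mulr_ge0// subr_ge0 ltW.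
Qed.

Lemma bounded_lebesgue_integrable (f : R -> R) (C : R) :
  measurable_fun `[a, b] f -> (forall s, a <= s <= b -> `|f s| <= C) ->
  mu.-integrable `[a, b] (EFin \o f).
Proof.
move=> mf fC; apply: measurable_bounded_integrable => //.
- rewrite /= lebesgue_measure_itv/=; case: ifP => _; rewrite ?ltry//.
- exists C; split; first exact: num_real.
  by move=> x Cx s /=; rewrite in_itv/= => /fC /le_trans; apply; exact: ltW.
Qed.

(** Replaces differentiation of [ln N], as [g] is only measurable. [N] is nondecreasing, so over a
    step its increment lies between N s dG and N t dG, where [G] is the integral of [g]; hence
    [ln N - G] has quadratic increments and is constant. *)
Lemma ln_of_linear_integral_equation (N g : R -> R) (B C : R) :
  measurable_fun `[a, b] g -> measurable_fun `[a, b] N ->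
  (forall s, a <= s <= b -> 0 <= g s <= C) ->
  (forall s, a <= s <= b -> 0 <= N s <= B) ->
  (forall s, a <= s <= b -> N s = 1 + \int[mu]_(r in `[a, s]) (N r * g r)) ->
  ln (N b) = \int[mu]_(r in `[a, b]) g r.
Proof.
move=> mg mN gC NB NE.
have a_in : a <= a <= b by rewrite lexx.
have b_in : a <= b <= b by rewrite ab lexx.
have B0 : 0 <= B by have /andP[h1 h2] := NB _ a_in; exact: le_trans h2.
have C0 : 0 <= C by have /andP[h1 h2] := gC _ a_in; exact: le_trans h2.
have ig : mu.-integrable `[a, b] (EFin \o g).
  by apply: (bounded_lebesgue_integrable mg (C := C)) => s /gC/andP[h1 h2]; rewrite ger0_norm.
have iNg : mu.-integrable `[a, b] (EFin \o (fun r => N r * g r)).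
  apply: (bounded_lebesgue_integrable (C := B * C)); first exact: measurable_funM.
  move=> s sab; have /andP[h1 h2] := NB _ sab; have /andP[h3 h4] := gC _ sab.
  by rewrite normrM !ger0_norm// ler_pM.
have icst (c : R) : mu.-integrable `[a, b] (EFin \o (fun=> c)).
  by apply: (bounded_lebesgue_integrable (C := `|c|)).
pose G s := \int[mu]_(r in `[a, s]) g r.
have sub s t : a <= s -> t <= b -> forall r, s < r <= t -> a <= r <= b.
  by move=> sa tb r /andP[sr rt]; rewrite (le_trans sa (ltW sr)) (le_trans rt tb).
have dN s t : a <= s -> s <= t -> t <= b ->
    N t - N s = \int[mu]_(r in `]s, t]) (N r * g r).
  move=> sa st tb; rewrite !NE ?sa ?st ?(le_trans sa st) ?tb ?(le_trans st tb)//.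
  by rewrite opprD addrACA subrr add0r (cumulative_increment sa st tb iNg).
have dG s t : a <= s -> s <= t -> t <= b -> G t - G s = \int[mu]_(r in `]s, t]) g r.
  by move=> sa st tb; rewrite (cumulative_increment sa st tb ig).
have N_mono s t : a <= s -> s <= t -> t <= b -> N s <= N t.
  move=> sa st tb; rewrite -subr_ge0 dN//; apply: Rintegral_ge0 => r /=.
  rewrite in_itv/= => /(sub _ _ sa tb) rab.
  by rewrite mulr_ge0//; [have /andP[] := NB _ rab|have /andP[] := gC _ rab].
have dG0 s t : a <= s -> s <= t -> t <= b -> 0 <= G t - G s.
  move=> sa st tb; rewrite dG//; apply: Rintegral_ge0 => r /=.
  by rewrite in_itv/= => /(sub _ _ sa tb)/gC/andP[].
have isub (f : R -> R) s t : a <= s -> t <= b ->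
    mu.-integrable `[a, b] (EFin \o f) -> mu.-integrable `]s, t] (EFin \o f).
  move=> sa tb fi; apply: integrableS fi => // r /=; rewrite !in_itv/=.
  exact: sub.
have icstM (f : R -> R) (c : R) s t : a <= s -> t <= b ->
    mu.-integrable `[a, b] (EFin \o f) ->
    mu.-integrable `]s, t] (EFin \o (fun r => c * f r)).
  move=> sa tb fi; have := lebesgue_integrable_lin c 0 (measurable_itv _)
    (isub _ _ _ sa tb fi) (isub _ _ _ sa tb fi).
  by rewrite (_ : (fun x => c * f x + 0 * f x) = (fun x => c * f x))//;
    apply/funext => x; rewrite mul0r addr0.
have N_lo s t : a <= s -> s <= t -> t <= b -> N s * (G t - G s) <= N t - N s.
  move=> sa st tb; rewrite dG// dN// -RintegralZl//; last exact: isub.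
  apply: le_Rintegral => //; [exact: icstM|exact: isub|].
  move=> r /=; rewrite in_itv/= => /[dup] /(sub _ _ sa tb) rab /andP[sr rt].
  apply: ler_wpM2r; first by have /andP[] := gC _ rab.
  by apply: N_mono => //; [exact: ltW|exact: le_trans tb].
have N_hi s t : a <= s -> s <= t -> t <= b -> N t - N s <= N t * (G t - G s).
  move=> sa st tb; rewrite dG// dN// -RintegralZl//; last exact: isub.
  apply: le_Rintegral => //; [exact: isub|exact: icstM|].
  move=> r /=; rewrite in_itv/= => /[dup] /(sub _ _ sa tb) rab /andP[sr rt].
  apply: ler_wpM2r; first by have /andP[] := gC _ rab.
  by apply: N_mono => //; exact: (le_trans sa (ltW sr)).
have G_hi s t : a <= s -> s <= t -> t <= b -> G t - G s <= C * (t - s).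
  move=> sa st tb; rewrite dG//.
  have -> : C * (t - s) = \int[mu]_(r in `]s, t]) C.
    rewrite Rintegral_cst//= lebesgue_measure_itv/= lte_fin.
    move: st; rewrite le_eqVlt => /predU1P[->|st]; first by rewrite ltxx subrr.
    by rewrite st.
  apply: le_Rintegral => //; [exact: isub|exact: isub|].
  by move=> r /=; rewrite in_itv/= => /(sub _ _ sa tb)/gC/andP[].
have Na : N a = 1 by rewrite NE// cumulative_start addr0.
have N1 s : a <= s <= b -> 1 <= N s.
  by move=> /andP[sa sb]; rewrite -Na; exact: N_mono.
pose L s := ln (N s) - G s.
suff : L b = L a.
  by rewrite /L Na ln1 {2}/G cumulative_start subr0 => /eqP; rewrite subr_eq0 => /eqP.
apply: (@constant_of_quadratic_increments _ (B * C ^+ 2)).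
  by rewrite mulr_ge0// sqr_ge0.
move=> s t sa st tb.
have sab : a <= s <= b by rewrite sa (le_trans st tb).
have tab : a <= t <= b by rewrite tb (le_trans sa st).
have Ns := N1 _ sab; have Nt := N1 _ tab.
have Ns0 : 0 < N s by rewrite (lt_le_trans ltr01).
have Nt0 : 0 < N t by rewrite (lt_le_trans ltr01).
have h1 := N_lo _ _ sa st tb; have h2 := N_hi _ _ sa st tb.
have h3 := G_hi _ _ sa st tb; have h4 := dG0 _ _ sa st tb.
have h5 := N_mono _ _ sa st tb; have /andP[_ NtB] := NB _ tab.
have ln_le (z : R) : 0 < z -> ln z <= z - 1.
  move=> z0; have := @le_ln1Dx R (z - 1).
  by rewrite (_ : 1 + (z - 1) = z); [apply; rewrite ltrBrDr addNr|ring].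
have up : ln (N t) - ln (N s) <= N t / N s - 1.
  by rewrite -ln_div ?posrE// ln_le// divr_gt0.
have lo : 1 - N s / N t <= ln (N t) - ln (N s).
  rewrite -(opprB (ln (N s))) -ln_div ?posrE// lerNr opprB.
  by rewrite ln_le// divr_gt0.
(* Both [N] and [G] are Lipschitz, which makes the gap between the two bounds quadratic in
   [t - s]. *)
have quad : (N t - N s) * (G t - G s) <= B * C ^+ 2 * (t - s) ^+ 2.
  have p1 : N t - N s <= B * (C * (t - s)).
    by apply: le_trans h2 _; apply: ler_pM => //; exact: ltW.
  rewrite (_ : B * C ^+ 2 * (t - s) ^+ 2 = B * (C * (t - s)) * (C * (t - s))); last ring.
  by apply: ler_pM => //; rewrite subr_ge0.
have Ds : 0 <= N t - N s by rewrite subr_ge0.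
have Dg := mulr_ge0 Ds h4.
(* Multiplying by [N s] reduces this to [h2]; [N s >= 1] absorbs the factor. The lower bound uses
   [N t] and [h1]. *)
have up2 : N t / N s - 1 - (G t - G s) <= (N t - N s) * (G t - G s).
  rewrite -(ler_pM2l Ns0) (_ : N s * (N t / N s - 1 - (G t - G s)) =
    (N t - N s) - N s * (G t - G s)); last by field; rewrite gt_eqF.
  have Ns1 : 0 <= N s - 1 by rewrite subr_ge0.
  by have := mulr_ge0 Ns1 Dg; clear -h2 Dg ab; lra.
have lo2 : - ((N t - N s) * (G t - G s)) <= 1 - N s / N t - (G t - G s).
  rewrite -(ler_pM2l Nt0) (_ : N t * (1 - N s / N t - (G t - G s)) =
    (N t - N s) - N t * (G t - G s)); last by field; rewrite gt_eqF.
  have Nt1 : 0 <= N t - 1 by rewrite subr_ge0.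
  by have := mulr_ge0 Nt1 Dg; clear -h1 Dg ab; lra.
rewrite /L ler_norml; clear -up lo quad up2 lo2 ab; lra.
Qed.

End logarithmic_integration.

(** * Squared modulus of a pair of Ito processes *)

Lemma within_continuous_stopped {R : realType} (a b c : R) (f : R -> R) :
  a <= c -> {within `[a, c], continuous f} ->
  {within `[a, b], continuous (fun s => f (Num.min s c))}.
Proof.
move=> ac cf; apply/subspace_continuousP => x; rewrite /= in_itv/= => /andP[ax xb].
have xac : a <= Num.min x c <= c by rewrite le_min ax ac ge_min lexx orbT.
apply/cvgrPdist_lt => e e0.
have [r r0 hr] := within_continuous_modulus_at cf xac e0.
rewrite near_withinE; apply/nbhs_ballP; exists r => //= z xz.
rewrite in_itv/= => /andP[az _]; rewrite distrC; apply: hr.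
  by rewrite le_min az ac ge_min lexx orbT.
apply: le_lt_trans (_ : `|z - x| < r); last by move: xz; rewrite /ball/= distrC.
have [zc|cz] := leP z c; have [xc|cx] := leP x c; rewrite ?subrr ?normr0//.
- rewrite distrC (distrC z) !ger0_norm ?subr_ge0 ?(le_trans zc (ltW cx))//.
  by rewrite lerD2r ltW.
- rewrite !ger0_norm ?subr_ge0 ?(le_trans xc (ltW cz))//.
  by rewrite lerD2r ltW.
Qed.

Section complex_components.
Context {R : realType}.

Lemma Re_rotated (z : R[i]) (x y : R) :
  complex.Re ('i%C * z / x%:C%C * y%:C%C) = - (complex.Im z * (y / x)).
Proof.
rewrite -mulrA -[x%:C%C^-1]fmorphV -rmorphM; case: z => p q /=.
by rewrite mulr0 subr0 mul0r mul1r sub0r mulNr (mulrC y).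
Qed.

Lemma Im_rotated (z : R[i]) (x y : R) :
  complex.Im ('i%C * z / x%:C%C * y%:C%C) = complex.Re z * (y / x).
Proof.
rewrite -mulrA -[x%:C%C^-1]fmorphV -rmorphM; case: z => p q /=.
by rewrite mulr0 add0r mul0r mul1r add0r (mulrC y).
Qed.

End complex_components.

Section ito_pair.
Context {R : realType} {d : measure_display} {Omega : measurableType d}.
Variables (P : probability Omega R) (theta T : R).
Variables (F : R -> set (set Omega)) (w : R -> Omega -> R) (tau : Omega -> R).
Hypothesis F_filtration : complete_filtration P theta T F.
Hypothesis w_wiener : filtered_wiener_process P theta T F w.
Hypothesis tau_markov : markov_time P theta T F tau.

Local Notation mu := (@lebesgue_measure R).

(** The two orthogonality hypotheses express that the coefficient vectors are rotated from [(U, V)]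
    by a right angle. Time [t] is deterministic because the grids must not depend on the path; the
    random time appears only in [t <= tau om] and in the indicators. *)
Lemma ito_pair_sqr (U V a b p q : R -> Omega -> R) t :
  ito_process P theta T F w tau U a p -> ito_process P theta T F w tau V b q ->
  (forall s om, U s om * a s om + V s om * b s om = 0) ->
  (forall s om, U s om * p s om + V s om * q s om = 0) ->
  theta <= t -> t <= T ->
  {ae P, forall om, t <= tau om ->
    U t om ^+ 2 + V t om ^+ 2 = U theta om ^+ 2 + V theta om ^+ 2 +
    fine (\int[mu]_(s in `[theta, t]) ((\1_(`[theta, tau om]) s * p s om) ^+ 2)%:E) +
    fine (\int[mu]_(s in `[theta, t]) ((\1_(`[theta, tau om]) s * q s om) ^+ 2)%:E)}.
Proof.
move=> [adU cU iU [M MU eqU]] [adV cV iV [M' MV eqV]] UaVb UpVq tht tT.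
pose H s om := \1_(`[theta, tau om]) s * p s om.
pose K s om := \1_(`[theta, tau om]) s * q s om.
(* The stopped processes are adapted and continuous on all of [[theta, T]], as [ito_cross_variation]
   requires; beyond [tau] the integrands [H] and [K] vanish, so orthogonality is preserved. *)
pose u := stopped tau U; pose v := stopped tau V.
have cstop (X : R -> Omega -> R) :
    {ae P, forall om, {within `[theta, tau om], continuous X^~ om}} ->
    {ae P, forall om, {within `[theta, T], continuous (stopped tau X)^~ om}}.
  move=> cX; have := markov_time_range tau_markov; apply: filterS2 cX.
  move=> om cX; rewrite in_itv/= => /andP[h _].
  exact: within_continuous_stopped (ltW h) cX.
have uvHK : {ae P, forall om, forall s, theta <= s <= T ->
    u s om * H s om + v s om * K s om = 0}.
  apply: aeW => om s _; rewrite /H /K indicE mem_setE in_itv/=.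
  case: (boolP (theta <= s <= tau om)) => [/andP[_ st]|_].
    by rewrite !mul1r /u /v /stopped min_l.
  by rewrite !mul0r !mulr0 addr0.
(* A mere existence statement: the grid may vary with [e], as the pathwise identity allows. *)
pose Q e om := exists N x, [/\ is_grid theta t N x,
     forall k, (k < N)%N -> x k.+1 - x k < e,
     `|\sum_(k < N) (u (x k) om * (M (x k.+1) om - M (x k) om) +
       v (x k) om * (M' (x k.+1) om - M' (x k) om))| < e,
     `|\sum_(k < N) (M (x k.+1) om - M (x k) om) ^+ 2 -
       fine (\int[mu]_(s in `[theta, t]) (H s om ^+ 2)%:E)| < e &
     `|\sum_(k < N) (M' (x k.+1) om - M' (x k) om) ^+ 2 -
       fine (\int[mu]_(s in `[theta, t]) (K s om ^+ 2)%:E)| < e].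
have aeQ e : 0 < e -> {ae P, forall om, Q e om}.
  move=> e0; apply: ae_of_likely => r r0.
  pose e1 := Num.min e (r / 3).
  have e10 : 0 < e1 by rewrite lt_min e0 divr_gt0.
  have e1e : e1 <= e by rewrite ge_min lexx.
  have e1r : e1 <= r / 3 by rewrite ge_min lexx orbT.
  have [D1 [m1 [D1r m10 h1]]] := ito_quadratic_variation F_filtration w_wiener MU tht tT e10.
  have [D2 [m2 [D2r m20 h2]]] := ito_quadratic_variation F_filtration w_wiener MV tht tT e10.
  have [m3 m30 h3] := ito_cross_variation F_filtration w_wiener MU MV adU adV
    (cstop _ cU) (cstop _ cV) uvHK tht tT e10.
  pose m := Num.min (Num.min m1 m2) (Num.min m3 e).
  have m0 : 0 < m by rewrite !lt_min m10 m20 m30 e0.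
  have Dr : {in D1 ++ D2, forall z, theta <= z <= t}.
    by move=> z; rewrite mem_cat => /orP[/D1r|/D2r].
  have [N [x [gx Dx mesh]]] := fine_grid_through tht m0 Dr.
  have mesh' k : (k < N)%N -> [/\ x k.+1 - x k < m1, x k.+1 - x k < m2,
      x k.+1 - x k < m3 & x k.+1 - x k < e].
    by move=> /mesh; rewrite !lt_min => /andP[/andP[-> ->] /andP[-> ->]].
  have Dx1 : {in D1, forall z, grid_point N x z}.
    by move=> z zD; apply: Dx; rewrite mem_cat zD.
  have Dx2 : {in D2, forall z, grid_point N x z}.
    by move=> z zD; apply: Dx; rewrite mem_cat zD orbT.
  have mesh1 k : (k < N)%N -> x k.+1 - x k < m1 by case/mesh'.
  have mesh2 k : (k < N)%N -> x k.+1 - x k < m2 by case/mesh'.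
  have mesh3 k : (k < N)%N -> x k.+1 - x k < m3 by case/mesh'.
  have mesh4 k : (k < N)%N -> x k.+1 - x k < e by case/mesh'.
  have := likely_and (h3 N x gx mesh3) (likely_and (h1 N x gx Dx1 mesh1)
    (h2 N x gx Dx2 mesh2)).
  move=> big; apply: (likely_sub _ (likelyW _ big)); last first.
    by clear -e1r F_filtration w_wiener tau_markov; lra.
  move=> om [h [h' h'']]; exists N, x; split => //.
  - exact: lt_le_trans h e1e.
  - exact: lt_le_trans h' e1e.
  - exact: lt_le_trans h'' e1e.
(* Countably many tolerances 1/(k+1) provide one null set for all [e]. *)
have Qall : {ae P, forall om, forall e, 0 < e -> Q e om}.
  have : {ae P, forall om, forall k : nat, Q k.+1%:R^-1 om}.
    by apply/ae_foralln => k; apply: aeQ; rewrite invr_gt0.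
  apply: filterS => om Qk e e0.
  have [N [x [gx mesh q1 q2 q3]]] := Qk (Num.truncn e^-1).
  have ke : (Num.truncn e^-1).+1%:R^-1 <= e.
    by rewrite invf_ple ?posrE//; exact/ltW/truncnS_gt.
  exists N, x; split => //.
  - by move=> k kN; exact: lt_le_trans (mesh k kN) ke.
  - exact: lt_le_trans q1 ke.
  - exact: lt_le_trans q2 ke.
  - exact: lt_le_trans q3 ke.
have [_ cM _] := MU; have [_ cM' _] := MV.
have good : {ae P, forall om, [/\ {within `[theta, tau om], continuous U^~ om},
    {within `[theta, tau om], continuous V^~ om},
    {within `[theta, T], continuous M^~ om} & {within `[theta, T], continuous M'^~ om}]}.
  by apply: (filterS2 _ _ (filterI cU cV) (filterI cM cM')) => om [? ?] [].
have good2 : {ae P, forall om, [/\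
    mu.-integrable `[theta, tau om] (EFin \o a^~ om),
    mu.-integrable `[theta, tau om] (EFin \o b^~ om),
    forall t, t \in `[theta, tau om] -> U t om = U theta om +
          \int[mu]_(s in `[theta, t]) a s om + M t om &
    forall t, t \in `[theta, tau om] -> V t om = V theta om +
          \int[mu]_(s in `[theta, t]) b s om + M' t om]}.
  by apply: (filterS2 _ _ (filterI iU iV) (filterI eqU eqV)) => om [? ?] [].
apply: (filterS3 _ _ good good2 Qall) => om.
move=> [cUom cVom cMom cM'om] [ia ib UE VE] Qom ttau.
have sub1 : (`[theta, t]%classic : set R) `<=` `[theta, tau om]%classic.
  by move=> s /=; rewrite !in_itv/= => /andP[-> /le_trans]; apply.
have sub2 : (`[theta, t]%classic : set R) `<=` `[theta, T]%classic.
  by move=> s /=; rewrite !in_itv/= => /andP[-> /le_trans]; apply.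
apply: (@sqr_sum_identity _ theta t (U^~ om) (V^~ om) (M^~ om) (M'^~ om) (a^~ om)
  (b^~ om)).
- exact: continuous_subspaceW sub1 cUom.
- exact: continuous_subspaceW sub1 cVom.
- exact: continuous_subspaceW sub2 cMom.
- exact: continuous_subspaceW sub2 cM'om.
- by apply: integrableS ia.
- by apply: integrableS ib.
- by move=> s /andP[h1 h2]; apply: UE; rewrite in_itv/= h1 (le_trans h2).
- by move=> s /andP[h1 h2]; apply: VE; rewrite in_itv/= h1 (le_trans h2).
- by move=> s _; exact: UaVb.
- move=> e e0; have [N [x [gx mesh q1 q2 q3]]] := Qom _ e0.
  exists N, x; split => //; move: q1.
  rewrite (eq_bigr (fun k : 'I_N => U (x k) om * (M (x k.+1) om - M (x k) om) +
       V (x k) om * (M' (x k.+1) om - M' (x k) om)))// => k _.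
  rewrite /u /v /stopped min_l//; apply: le_trans ttau.
  by have /andP[] := grid_range gx (ltnW (ltn_ord k)).
Qed.

End ito_pair.

(** * Equation for the squared modulus at all times *)

Section squared_modulus_equation.
Context {R : realType}.
Variables a b : R.
Hypothesis ab : a <= b.
Local Notation mu := (@lebesgue_measure R).

Lemma within_continuous_bounded (X : R -> R) : {within `[a, b], continuous X} ->
  exists B : R, forall s, a <= s <= b -> `|X s| <= B.
Proof.
move=> cX; have [c _ maxX] := EVT_max ab cX; have [c' _ minX] := EVT_min ab cX.
exists (Num.max (X c) (- X c')) => s sab; rewrite ler_norml lerNl !le_max.
by rewrite lerN2 minX ?orbT ?maxX// in_itv.
Qed.

Lemma within_continuous_measurable (X : R -> R) : {within `[a, b], continuous X} ->
  measurable_fun `[a, b] X.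
Proof. by move=> cX; exact: subspace_continuous_measurable_fun. Qed.

(** Both sides are continuous in [s]. The starting point is treated apart, since it need not be
    rational and admits no rational to its left in the interval. *)
Lemma extend_linear_integral_equation (N g : R -> R) (B C : R) :
  {within `[a, b], continuous N} -> measurable_fun `[a, b] g ->
  (forall s, a <= s <= b -> `|g s| <= C) ->
  (forall s, a <= s <= b -> `|N s| <= B) -> N a = 1 ->
  (forall q : rat, a <= ratr q <= b ->
     N (ratr q) = 1 + \int[mu]_(r in `[a, ratr q]) (N r * g r)) ->
  forall s, a <= s <= b -> N s = 1 + \int[mu]_(r in `[a, s]) (N r * g r).
Proof.
move=> cN mg gC NB Na NE s /andP[sa sb].
move: sa; rewrite le_eqVlt => /predU1P[<-|sa]; first by rewrite cumulative_start addr0.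
have mN := within_continuous_measurable cN.
have NgB r : a <= r <= b -> `|N r * g r| <= B * C.
  by move=> rab; rewrite normrM ler_pM// ?NB ?gC.
have iNg : mu.-integrable `[a, b] (EFin \o (fun r => N r * g r)).
  by apply: (bounded_lebesgue_integrable (C := B * C)) => //; exact: measurable_funM.
have icst : mu.-integrable `[a, b] (EFin \o (fun=> B * C)).
  by apply: (bounded_lebesgue_integrable (C := `|B * C|)).
have sab : a <= s <= b by rewrite ltW.
apply/eqP; rewrite -subr_eq0 -normr_le0.
apply: (@ler_small _ _ _ (1 + `|B * C|)) => e /andP[e0 _]; rewrite add0r.
have [r r0 hr] := within_continuous_modulus_at cN sab e0.
(* A rational between [m] and [s] stays in the interval, within the modulus of [N] and within [e] of
   [s]. *)
pose m := Num.max a (Num.max (s - r) (s - e)).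
have ms : m < s by rewrite !gt_max sa/= !ltrBlDr !ltrDl r0.
have [q] := rat_in_itvoo ms; set z := ratr q : R.
rewrite in_itv/= !gt_max => /andP[/and3P[az rz ez] zs].
have zab : a <= z <= b by rewrite (ltW az) (le_trans (ltW zs)).
have Nz : `|N z - N s| < e.
  by apply: hr => //; rewrite distrC gtr0_norm ?subr_gt0// ltrBlDl -ltrBlDr.
have inc : `|\int[mu]_(x in `[a, s]) (N x * g x) - \int[mu]_(x in `[a, z]) (N x * g x)|
    <= B * C * (s - z).
  have NgB' x : z < x <= s -> `|N x * g x| <= B * C.
    by case/andP=> zx xs; rewrite NgB// (le_trans (ltW az) (ltW zx)) (le_trans xs).
  apply: le_trans (cumulative_increment_le (ltW az) (ltW zs) sb iNg icst NgB') _.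
  rewrite (cumulative_increment (ltW az) (ltW zs) sb icst).
  rewrite Rintegral_cst//= lebesgue_measure_itv/= lte_fin zs//.
have NzE : N z - 1 - \int[mu]_(r in `[a, z]) (N r * g r) = 0.
  by rewrite NE//; ring.
rewrite (_ : N s - _ = - (N z - N s) + (N z - 1 - \int[mu]_(r in `[a, z]) (N r * g r)) -
   (\int[mu]_(x in `[a, s]) (N x * g x) - \int[mu]_(x in `[a, z]) (N x * g x))); last ring.
rewrite NzE addr0; apply: le_trans (ler_normB _ _) _; rewrite normrN.
rewrite mulrDl mul1r; apply: lerD; first exact: ltW.
apply: le_trans inc _; apply: ler_pM => //; rewrite ?subr_ge0 ?(ltW zs)//.
- exact: le_trans (normr_ge0 _) (NgB _ sab).
- exact: ler_norm.
- by rewrite lerBlDl -lerBlDr ltW.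
Qed.

(** The two integrals add up to that of [N * beta ^+ 2] for [N = U ^+ 2 + V ^+ 2], a linear
    equation; its integrand is nonnegative, so [N b] is at least 1. *)
Lemma ln_sqr_modulus (U V beta : R -> R) (C : R) :
  {within `[a, b], continuous U} -> {within `[a, b], continuous V} ->
  measurable_fun `[a, b] beta -> (forall s, a <= s <= b -> `|beta s| <= C) ->
  U a = 1 -> V a = 0 ->
  (forall q : rat, a <= ratr q <= b ->
     U (ratr q) ^+ 2 + V (ratr q) ^+ 2 = 1 +
     \int[mu]_(r in `[a, ratr q]) (V r * beta r) ^+ 2 +
     \int[mu]_(r in `[a, ratr q]) (U r * beta r) ^+ 2) ->
  0 < U b ^+ 2 + V b ^+ 2 /\
  ln (U b ^+ 2 + V b ^+ 2) = \int[mu]_(r in `[a, b]) beta r ^+ 2.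
Proof.
move=> cU cV mb bC Ua Va UVE.
have mU := within_continuous_measurable cU; have mV := within_continuous_measurable cV.
pose N s := U s ^+ 2 + V s ^+ 2; pose g s := beta s ^+ 2.
have cN : {within `[a, b], continuous N}.
  by move=> x; apply: cvgD; [exact: (cvgM (cU x) (cU x))|exact: (cvgM (cV x) (cV x))].
have mN := within_continuous_measurable cN.
have mg : measurable_fun `[a, b] g by exact: measurable_funX.
have gC s : a <= s <= b -> 0 <= g s <= C ^+ 2.
  move=> sab; rewrite /g sqr_ge0 -(real_normK (num_real (beta s))).
  rewrite lerXn2r ?nnegrE ?bC//.
  exact: le_trans (normr_ge0 _) (bC _ sab).
have [B NB] := within_continuous_bounded cN.
have [BU UB] := within_continuous_bounded cU.
have [BV VB] := within_continuous_bounded cV.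
have N0 s : 0 <= N s by rewrite addr_ge0 ?sqr_ge0.
have sqr_int (X : R -> R) (K : R) : measurable_fun `[a, b] X -> (forall s, a <= s <= b -> `|X s| <= K) ->
    mu.-integrable `[a, b] (EFin \o (fun r => (X r * beta r) ^+ 2)).
  move=> mX XK; apply: (bounded_lebesgue_integrable (C := (K * C) ^+ 2)).
    by apply: measurable_funX; exact: measurable_funM.
  move=> s sab; have h : `|X s * beta s| <= K * C by rewrite normrM ler_pM ?XK ?bC.
  rewrite normrX lerXn2r ?nnegrE//; exact: le_trans h.
have iU := sqr_int _ _ mU UB; have iV := sqr_int _ _ mV VB.
have NE : forall s, a <= s <= b -> N s = 1 + \int[mu]_(r in `[a, s]) (N r * g r).
  apply: (extend_linear_integral_equation (B := B) (C := C ^+ 2)) => //.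
  - by move=> s /gC/andP[g0 ?]; rewrite ger0_norm.
  - by rewrite /N Ua Va expr1n expr0n addr0.
  - move=> q qab; have /andP[_ qb] := qab.
    have lin := cumulative_lin 1 1 qb iV iU.
    rewrite /N UVE// -addrA; congr (_ + _); rewrite !mul1r in lin; rewrite -lin.
    by apply: eq_Rintegral => r _; rewrite /N /g; ring.
split.
  change (0 < N b); rewrite NE ?ab ?lexx// ltr_wpDr//; apply: Rintegral_ge0 => r _.
  by rewrite mulr_ge0 ?N0 ?sqr_ge0.
apply: (ln_of_linear_integral_equation ab (N := N) (B := B) (C := C ^+ 2)) => //.
by move=> s sab; rewrite N0/= (le_trans (ler_norm _) (NB _ sab)).
Qed.

End squared_modulus_equation.

Lemma ae_forall_countable {d : measure_display} {T : measurableType d} {R : realType}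
    (mu : {measure set T -> \bar R}) (I : countType) (Q : I -> T -> Prop) :
  (forall i, {ae mu, forall x, Q i x}) -> {ae mu, forall x, forall i, Q i x}.
Proof.
move=> aeQ.
have : {ae mu, forall x, forall n, if unpickle n is Some i then Q i x else True}.
  apply/ae_foralln => n; case: unpickle => [i|]; first exact: aeQ.
  exact: aeW.
by apply: filterS => x Qx i; have := Qx (pickle i); rewrite pickleK.
Qed.

(** * Bounds on the volatility ratio and the final formula *)

Section volatility_ratio.
Context {R : realType}.
Implicit Types (x m M s K p q : R).

Lemma powR_ratio_sqr x s p q : 0 < x ->
  (s * (x `^ p) / (x `^ q)) ^+ 2 = x `^ (2 * (p - q)) * s ^+ 2.
Proof.
move=> x0; rewrite -mulrA -powRN -powRD ?(gt_eqF x0) ?implybT// exprMn mulrC.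
by rewrite mulrC (mulrC 2) powRrM powR_mulrn ?powR_ge0// mulrC.
Qed.

Lemma powR_ratio_le x m M s K p q : 0 <= p -> 0 <= q -> 0 < m -> m <= x <= M ->
  `|s| <= K -> `|s * (x `^ p) / (x `^ q)| <= K * (M `^ p) / (m `^ q).
Proof.
move=> p0 q0 m0 /andP[mx xM] sK.
have x0 : 0 < x := lt_le_trans m0 mx.
rewrite !normrM normfV !(ger0_norm (powR_ge0 _ _)); apply: ler_pM => //.
- by rewrite mulr_ge0// powR_ge0.
- by rewrite invr_ge0 powR_ge0.
- apply: ler_pM => //; first exact: powR_ge0.
  by apply: ge0_ler_powR => //; rewrite nnegrE ltW// (lt_le_trans x0).
- rewrite lef_pV2 ?posrE ?powR_gt0//.
  by apply: ge0_ler_powR => //; rewrite nnegrE ltW.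
Qed.

End volatility_ratio.

Lemma measurable_path {R : realType} {d : measure_display} {Omega : measurableType d}
    (theta T : R) (X : R -> Omega -> R) om :
  measurable_fun (`[theta, T] `*` setT)
    (fun p : measurableTypeR R * Omega => X p.1 p.2) ->
  measurable_fun `[theta, T] (X^~ om).
Proof.
move=> mX.
pose pr (t : measurableTypeR R) : measurableTypeR R * Omega := (t, om).
apply: (@measurable_comp _ _ _ (measurableTypeR R) (measurableTypeR R * Omega)%type R
  (`[theta, T] `*` setT) (fun p => X p.1 p.2) `[theta, T]%classic pr) => //.
- by apply: measurableX => //; exact: (measurable_itv _).
- by move=> _ [t tT <-]; split.
- by apply: measurable_funTS; exact: measurable_pair2.
Qed.

Theorem theorem3p1 (R : realType) (d : measure_display)
    (Omega : measurableType d) (P : probability Omega R) (theta T : R)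
    (F : R -> set (set Omega)) (w : R -> Omega -> R) (gamma : R)
    (sigma : R -> Omega -> R) (f : (R -> R) -> R -> Omega -> R)
    (tau : Omega -> R) (y : R -> Omega -> R)
    (theta_lt_T : theta < T)
    (P_complete : measure_is_complete P)
    (F_filtration : complete_filtration P theta T F)
    (w_wiener : filtered_wiener_process P theta T F w)
    (gamma_range : 0 <= gamma <= 1)
    (sigma_diffusion : diffusion_coefficient theta T F sigma)
    (f_drift : drift_coefficient P theta T F f)
    (tau_markov : markov_time P theta T F tau)
    (y_start : {ae P, forall omega, 0 < y theta omega})
    (y_inf : {ae P, forall omega,
       0 < inf [set y s omega | s in `[theta, tau omega]]})
    (y_equation : ito_process P theta T F w tau y
       (drift_along tau f y)
       (fun t omega => sigma t omega * (y t omega `^ gamma))) :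
  forall h : R, 0 <= h <= 1 ->
  forall Y : R -> Omega -> R[i],
    {ae P, forall omega, Y theta omega = 1} ->
    ito_driven P theta T F w tau y
      (drift_along tau f y)
      (fun t omega => sigma t omega * (y t omega `^ gamma))
      Y
      (fun t omega => 'i%C * Y t omega / (y t omega `^ h)%:C%C) ->
    {ae P, forall omega,
      (\int[lebesgue_measure]_(s in `[theta, tau omega])
         ((y s omega `^ (2 * (gamma - h))) * sigma s omega ^+ 2)%:E)%E =
      (2%:E * lne (Normc.normc (Y (tau omega) omega))%:E)%E}.
Proof.
have /andP[gamma0 _] := gamma_range => h /andP[h0 _] Y Y1 [_ [ReY ImY]].
pose U t om := complex.Re (Y t om); pose V t om := complex.Im (Y t om).
pose alpha t om := drift_along tau f y t om / (y t om `^ h).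
pose beta t om := sigma t om * (y t om `^ gamma) / (y t om `^ h).
have itoU : ito_process P theta T F w tau U (fun s om => - (V s om * alpha s om))
    (fun s om => - (V s om * beta s om)).
  by move: ReY; under [X in ito_process _ _ _ _ _ _ _ X _]eq_fun2 do rewrite Re_rotated;
     under [X in ito_process _ _ _ _ _ _ _ _ X]eq_fun2 do rewrite Re_rotated.
have itoV : ito_process P theta T F w tau V (fun s om => U s om * alpha s om)
    (fun s om => U s om * beta s om).
  by move: ImY; under [X in ito_process _ _ _ _ _ _ _ X _]eq_fun2 do rewrite Im_rotated;
     under [X in ito_process _ _ _ _ _ _ _ _ X]eq_fun2 do rewrite Im_rotated.
(* Multiplication by [i] makes the coefficients orthogonal to [(U, V)], for drift and diffusion
   alike. *)
have rotated (c : R -> Omega -> R) s om :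
    U s om * - (V s om * c s om) + V s om * (U s om * c s om) = 0 by ring.
(* [ito_pair_sqr] cannot be applied at the random time [tau]; all rational times are treated at once
   and [tau] is reached by continuity along each path. *)
have sqr_modulus : {ae P, forall om, forall q : rat, theta <= ratr q -> ratr q <= T ->
    ratr q <= tau om -> U (ratr q) om ^+ 2 + V (ratr q) om ^+ 2 =
    U theta om ^+ 2 + V theta om ^+ 2 +
    \int[lebesgue_measure]_(s in `[theta, ratr q])
       (\1_(`[theta, tau om]) s * - (V s om * beta s om)) ^+ 2 +
    \int[lebesgue_measure]_(s in `[theta, ratr q])
       (\1_(`[theta, tau om]) s * (U s om * beta s om)) ^+ 2}.
  apply: ae_forall_countable => q.
  have [thq|?] := leP theta (ratr q : R); last by apply: aeW.
  have [qT|?] := leP (ratr q : R) T; last by apply: aeW.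
  have := ito_pair_sqr F_filtration w_wiener tau_markov itoU itoV (rotated alpha)
    (rotated beta) thq qT.
  by apply: filterS => om E _ _; exact: E.
have [K sK] := diffusion_bounded sigma_diffusion.
have msigma := diffusion_measurable sigma_diffusion.
have cont : {ae P, forall om, [/\ {within `[theta, tau om], continuous U^~ om},
    {within `[theta, tau om], continuous V^~ om} &
    {within `[theta, tau om], continuous y^~ om}]}.
  exact: (filterS3 _ _ (ito_continuous itoU) (ito_continuous itoV)
    (ito_continuous y_equation)).
apply: (filterS3 _ _ (filterI (markov_time_range tau_markov) y_inf) (filterI Y1 cont)
  sqr_modulus) => om [tau_in inf0] [Y1om [cU cV cy]] sqrE.
have [th_tau tauT] : theta <= tau om /\ tau om <= T.
  by move: tau_in; rewrite in_itv/= => /andP[/ltW].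
(* The path attains its minimum on the compact interval, so [y_inf] makes that minimum positive;
   hence [beta], which divides by a power of [y], is bounded along the path. *)
have [c c_in ymin] := EVT_min th_tau cy; have [c' _ ymax] := EVT_max th_tau cy.
have yc0 : 0 < y c om.
  apply: lt_le_trans inf0 (ge_inf _ _); last by exists c.
  by exists (y c om) => _ [s s_in <-]; exact: ymin.
have s_in s : theta <= s <= tau om -> s \in `[theta, tau om] by rewrite in_itv.
have sT s : theta <= s <= tau om -> s \in `[theta, T].
  by rewrite in_itv/= => /andP[-> /le_trans]; apply.
have y0 s : theta <= s <= tau om -> 0 < y s om.
  by move=> /s_in/ymin; exact: lt_le_trans.
pose C := K * (y c' om `^ gamma) / (y c om `^ h).
have betaC s : theta <= s <= tau om -> `|beta s om| <= C.
  move=> sI; apply: powR_ratio_le => //; last exact/sK/sT.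
  by rewrite ymin ?ymax ?s_in.
have m_y := within_continuous_measurable cy.
have m_sigma : measurable_fun `[theta, tau om] (sigma^~ om).
  exact: measurable_funS (measurable_path om msigma).
have m_beta : measurable_fun `[theta, tau om] (beta^~ om).
  rewrite (_ : beta^~ om = fun s =>
    sigma s om * (y s om `^ gamma) * (y s om `^ (- h))); last first.
    by apply/funext => s; rewrite /beta powRN.
  apply: measurable_funM; [apply: measurable_funM => //|];
    exact: (measurableT_comp (measurable_powR _)).
have Uth : U theta om = 1 by rewrite /U Y1om.
have Vth : V theta om = 0 by rewrite /V Y1om.
have lnE := ln_sqr_modulus th_tau cU cV m_beta betaC Uth Vth _.
have {lnE}[N0 lnE] : 0 < U (tau om) om ^+ 2 + V (tau om) om ^+ 2 /\
    ln (U (tau om) om ^+ 2 + V (tau om) om ^+ 2) =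
    \int[lebesgue_measure]_(s in `[theta, tau om]) beta s om ^+ 2.
  apply: lnE => q /andP[thq qtau].
  rewrite sqrE// ?(le_trans qtau)// Uth Vth expr1n expr0n addr0.
  by congr (_ + _ + _); apply: eq_Rintegral => s; rewrite inE/= in_itv/= => /andP[ths sq];
    rewrite indicE mem_setE in_itv/= ths (le_trans sq qtau) mul1r ?sqrrN.
have i_beta : lebesgue_measure.-integrable `[theta, tau om]
    (EFin \o (fun s => beta s om ^+ 2)).
  apply: (bounded_lebesgue_integrable (C := C ^+ 2)); first exact: measurable_funX.
  move=> s /betaC sC; rewrite normrX lerXn2r ?nnegrE//; exact: le_trans sC.
have -> : (\int[lebesgue_measure]_(s in `[theta, tau om])
    ((y s om `^ (2 * (gamma - h))) * sigma s om ^+ 2)%:E)%E =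
  (\int[lebesgue_measure]_(s in `[theta, tau om]) (beta s om ^+ 2)%:E)%E.
  apply: eq_integral => s; rewrite inE/= in_itv/= => /y0 ys.
  by rewrite powR_ratio_sqr.
have -> : Normc.normc (Y (tau om) om) = Num.sqrt (U (tau om) om ^+ 2 + V (tau om) om ^+ 2).
  by rewrite /U /V; case: (Y (tau om) om).
(* The modulus is positive, so [lne] is the real logarithm, and the factor 2 removes the square
   root. *)
rewrite lne_EFin ?sqrtr_gt0// -EFinM mulr_natl -lnXn ?sqrtr_gt0//.
rewrite sqr_sqrtr ?ltW// lnE fineK//.
exact: integrable_fin_num.
Qed.
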